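(* Let $\Omega\subset\mathbb{R}^N$ be a smooth bounded connected open set. There exists a bounded continuous nondecreasing function $H:[0,+\infty)\to[0,+\infty)$, with $H(t)>0$ for $t>0$, such that for every Borel function $V:\Omega\to[0,+\infty]$, if $u\in L^1(\Omega)$ is a duality solution of the Dirichlet problem $-\Delta u+Vu=\mu$ in $\Omega$, $u=0$ on $\partial\Omega$, involving a nonnegative finite Borel measure $\mu$ on $\Omega$, then $$u\ge\zeta_{H(u)}\quad\text{almost everywhere in }\Omega.$$
   Context: For a Borel function $V:\Omega\to[0,+\infty]$ and $f\in L^2(\Omega)$, $\zeta_f$ (which depends on $V$) denotes the unique minimizer of $E(z)=\frac12\int_\Omega(|\nabla z|^2+Vz^2)-\int_\Omega fz$ in $W_0^{1,2}(\Omega)\cap L^2(\Omega;V\,dx)$ (convention $0\cdot\infty=0$). Precise representative: $x\in\Omega$ is a Lebesgue point of $v\in L^1(\Omega)$ if there is $c\in\mathbb{R}$ with $\lim_{r\to0}\frac{1}{|B_r|}\int_{B_r(x)}|v-c|=0$; then $\widehat v(x):=c$. For $f\in L^\infty(\Omega)$, $\zeta_f$ is bounded and every point of $\Omega$ is a Lebesgue point of $\zeta_f$. For a finite Borel measure $\mu$ on $\Omega$, a function $u\in L^1(\Omega)$ is a duality solution of the Dirichlet problem with datum $\mu$ if $\int_\Omega uf=\int_\Omega\widehat{\zeta_f}\,d\mu$ for every $f\in L^\infty(\Omega)$. (When $\mu\ge0$, $u\ge0$ almost everywhere, so $H(u)$ makes sense.) *)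

(* Defs.v *)
From HB Require Import structures.
From mathcomp Require Import all_boot all_order all_algebra.
From mathcomp Require Import all_classical all_reals all_analysis.
From mathcomp Require Import measurable_realfun.

Set Implicit Arguments.
Unset Strict Implicit.
Unset Printing Implicit Defensive.

Import Order.TTheory GRing.Theory Num.Theory.
Import numFieldNormedType.Exports.

Local Open Scope classical_set_scope.
Local Open Scope ring_scope.

Section borel_matrix.
Variables (R : realType) (m n : nat).

HB.instance Definition _ :=
  @isMeasurable.Build (sigma_display (@open 'M[R]_(m, n))) 'M[R]_(m, n)
    <<s @open 'M[R]_(m, n) >>
    (@sigma_algebra0 _ setT _) (@sigma_algebraC _ _)
    (@sigma_algebra_bigcup _ setT _).

End borel_matrix.

Section borel_rV.
Variable R : realType.

Lemma open_measurable_rV n (A : set 'rV[R]_n) : open A -> measurable A.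
Proof. exact: sub_sigma_algebra. Qed.

Lemma measurable_coord_rV n (i : 'I_n) :
  measurable_fun setT (fun v : 'rV[R]_n => v 0 i).
Proof.
apply: (measurability _ (RGenOpens.measurableE R)) => _ [_ [a [b ->] <-]].
rewrite setTI; apply: open_measurable_rV.
have /continuousP := @coord_continuous R 1 n 0 i.
by apply; exact: interval_open.
Qed.

Lemma measurable_fun_rV d (T : measurableType d) n (f : T -> 'rV[R]_n) :
  (forall i, measurable_fun setT (fun x => f x 0 i)) -> measurable_fun setT f.
Proof.
move=> mf; apply: (measurability (@open 'rV[R]_n) erefl) => _ [W oW <-].
rewrite setTI.
pose B (p : 'rV[rat]_n * nat) : set 'rV[R]_n :=
  ball (map_mx ratr p.1 : 'rV[R]_n) (p.2.+1%:R^-1).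
have -> : f @^-1` W = \bigcup_(p in [set p | B p `<=` W]) (f @^-1` (B p)).
  apply/seteqP; split => [x /= Wfx|x [p /= pW Bfx]]; last exact: pW.
  have /nbhs_ballP[e /= e0 eW] : nbhs (f x) W by exact: open_nbhs_nbhs.
  have [k ke] : exists k : nat, k.+1%:R^-1 < e / 2.
    have [k _ H] := near_infty_natSinv_lt (PosNum (divr_gt0 e0 (ltr0n R 2))).
    by exists k; apply: H => /=.
  have k0 : 0 < k.+1%:R^-1 :> R by rewrite invr_gt0.
  have /choice[q qP] : forall i, exists q : rat,
      ratr q \in `](f x 0 i - k.+1%:R^-1), (f x 0 i + k.+1%:R^-1)[.
    by move=> i; apply: rat_in_itvoo; rewrite ltrBlDr -addrA ltrDl addr_gt0.
  have Bx : B (\row_i q i, k) (f x).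
    split=> // i j; rewrite !mxE /= (ord1 i) /ball /= ltr_distl.
    by have := qP j; rewrite in_itv.
  exists (\row_i q i, k) => //= y By; apply: eW.
  have : ball (f x) (k.+1%:R^-1 + k.+1%:R^-1) y.
    by apply: ball_triangle By; exact: ball_sym.
  by apply: le_ball; rewrite (splitr e) lerD// ltW.
rewrite bigcup_mkcond; apply: countable_bigcupT_measurable => // p.
case: ifP => // _.
have -> : f @^-1` (B p) =
    \bigcap_(i in [set: 'I_n])
      ((fun x => f x 0 i) @^-1` ball (ratr (p.1 0 i) : R) (p.2.+1%:R^-1)).
  apply/seteqP; split => x /=.
    by move=> [_ h] i _ /=; have := h 0 i; rewrite mxE.
  by move=> h; split=> [|i j]; rewrite ?invr_gt0// mxE (ord1 i); exact: h.
apply: fin_bigcap_measurable => // i _.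
by rewrite -[X in measurable X]setTI; apply: mf => //; exact: measurable_ball.
Qed.

Definition cons_rV n (p : R * 'rV[R]_n) : 'rV[R]_n.+1 :=
  row_mx (p.1%:M : 'rV[R]_1) p.2.

Lemma measurable_cons_rV n : measurable_fun setT (@cons_rV n).
Proof.
apply: measurable_fun_rV => i.
case: (splitP (i : 'I_(1 + n))) => j ij.
  rewrite (_ : (fun x => _) = fst); first exact: measurable_fst.
  apply/funext => x; have -> : i = lshift n j by exact/val_inj.
  rewrite [LHS](_ : _ = (x.1%:M : 'rV[R]_1) 0 j); first by rewrite mxE (ord1 j).
  exact: row_mxEl.
rewrite (_ : (fun x => _) = (fun v : 'rV[R]_n => v 0 j) \o snd).
  by apply: measurableT_comp; [exact: measurable_coord_rV|exact: measurable_snd].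
apply/funext => x; have -> : i = rshift 1 j by exact/val_inj.
exact: row_mxEr.
Qed.

Definition uncons_rV n (v : 'rV[R]_n.+1) : R * 'rV[R]_n :=
  (v 0 0, rsubmx (v : 'rV[R]_(1 + n))).

Lemma uncons_rVK n : cancel (@uncons_rV n) (@cons_rV n).
Proof.
move=> v; rewrite /cons_rV /=.
have -> : (v 0 0)%:M = lsubmx (v : 'rV[R]_(1 + n)) :> 'rV[R]_1.
  apply/rowP => i; rewrite !mxE (ord1 i) mulr1n.
  by congr (v _ _); exact/val_inj.
exact: (@hsubmxK R 1 1 n v).
Qed.

Lemma cons_rVK n : cancel (@cons_rV n) (@uncons_rV n).
Proof.
move=> [x v]; rewrite /uncons_rV /cons_rV; congr pair; last exact: row_mxKr.
have -> : 0 = lshift n 0 :> 'I_(1 + n) by exact/val_inj.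
rewrite [LHS](_ : _ = (x%:M : 'rV[R]_1) 0 0); first by rewrite mxE.
exact: row_mxEl.
Qed.

Lemma measurable_uncons_rV n : measurable_fun setT (@uncons_rV n).
Proof.
apply: measurable_fun_pair; first exact: measurable_coord_rV.
apply: measurable_fun_rV => i.
rewrite (_ : (fun x => _) = (fun v : 'rV[R]_n.+1 => v 0 (rshift 1 i))).
  exact: measurable_coord_rV.
by apply/funext => v; rewrite mxE.
Qed.

End borel_rV.

(* Lebesgue measure on R^(n+1) is the image of the product of the Lebesgue
   measures of R and R^n under the identification cons_rV. *)
Section lebesgue_rV.
Variable R : realType.

Section step.
Variables (n : nat) (mu : {sigma_finite_measure set 'rV[R]_n -> \bar R}).

Definition lebesgue_rVS : set 'rV[R]_n.+1 -> \bar R :=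
  pushforward (@lebesgue_measure R \x mu)%E (@cons_rV R n).

HB.instance Definition _ := Measure.copy lebesgue_rVS
  (measure_function_pushforward__canonical__measure_function_Measure
     (@lebesgue_measure R \x mu)%E (@measurable_cons_rV R n)).

Let lebesgue_rVS_sigma_finite : sigma_finite setT lebesgue_rVS.
Proof.
have /sigma_finiteP[F [TF ndF Foo]] := sigma_finiteT (@lebesgue_measure R).
have /sigma_finiteP[G [TG ndG Goo]] := sigma_finiteT mu.
exists (fun k => @uncons_rV R n @^-1` (F k `*` G k)).
  apply/seteqP; split=> // v _.
  have [i _ Fi] : (\bigcup_k F k) (v 0 0) by rewrite -TF.
  have [j _ Gj] : (\bigcup_k G k) (@uncons_rV R n v).2 by rewrite -TG.
  exists (maxn i j) => //; split.
  - by move: Fi; exact/subsetPset/ndF/leq_maxl.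
  - by move: Gj; exact/subsetPset/ndG/leq_maxr.
move=> k; have [mF Fk] := Foo k; have [mG Gk] := Goo k; split.
  rewrite -[X in measurable X]setTI; apply: measurable_uncons_rV => //.
  exact: measurableX.
rewrite /lebesgue_rVS /pushforward -comp_preimage.
rewrite (_ : _ \o _ = id); last by apply/funext; exact: cons_rVK.
by rewrite preimage_id product_measure1E// lte_mul_pinfty// ge0_fin_numE.
Qed.

HB.instance Definition _ := Measure_isSigmaFinite.Build _ _ _ lebesgue_rVS
  lebesgue_rVS_sigma_finite.

End step.

Fixpoint lebesgue_rV n : {sigma_finite_measure set 'rV[R]_n -> \bar R} :=
  if n is n'.+1 then lebesgue_rVS (lebesgue_rV n') else \d_(0 : 'rV[R]_0).

End lebesgue_rV.

Section pde.
Variables (R : realType) (N : nat).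

Local Notation E := 'rV[R]_N.
Local Notation leb := (lebesgue_rV R N).

Implicit Types (Omega : set E) (V : E -> \bar R) (f u v w z phi : E -> R).

(* The library norm and balls of 'rV[R]_N are those of the sup norm. *)
Definition enorm (x : E) : R := Num.sqrt (\sum_i x 0 i ^+ 2).

Definition eball (x : E) (r : R) : set E := [set y | enorm (y - x) < r].

Definition partial (i : 'I_N) phi : E -> R := 'D_(delta_mx 0 i) phi.

Definition gradient phi (x : E) : E := \row_i partial i phi x.

Definition iter_partial (s : seq 'I_N) phi : E -> R := foldr partial phi s.

(* C^infinity on U: all iterated partial derivatives are differentiable. *)
Definition smooth_on (U : set E) phi :=
  forall s x, U x -> differentiable (iter_partial s phi) x.

(* The boundary of Omega is smooth: near each of its points, Omega is the
   sublevel set of a smooth function with nonzero gradient at that point. *)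
Definition smooth_boundary Omega :=
  forall a, (closure Omega `\` interior Omega) a ->
  exists (U : set E) (rho : E -> R),
    [/\ open_nbhs a U, smooth_on U rho, gradient rho a != 0 &
        Omega `&` U = [set x | rho x < 0] `&` U].

Definition test_function Omega phi :=
  smooth_on setT phi /\
  exists K, [/\ compact K, K `<=` Omega & forall x, ~ K x -> phi x = 0].

Definition L1 Omega f := leb.-integrable Omega (EFin \o f).

Definition L2 Omega f := measurable_fun Omega f /\
  (\int[leb]_(x in Omega) (f x ^+ 2)%:E < +oo)%E.

Definition Linfty Omega f := measurable_fun Omega f /\
  exists M : R, {ae leb, forall x, Omega x -> `|f x| <= M}.

Definition weak_gradient Omega z (g : E -> E) :=
  forall phi i, test_function Omega phi ->
    \int[leb]_(x in Omega) (z x * partial i phi x) =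
    - \int[leb]_(x in Omega) (g x 0 i * phi x).

Definition L2_weak_gradient Omega z (g : E -> E) :=
  (forall i, L2 Omega (fun x => g x 0 i)) /\ weak_gradient Omega z g.

Definition W12 Omega z := L2 Omega z /\ exists g, L2_weak_gradient Omega z g.

(* A representative of the weak gradient of z in W12 Omega. *)
Definition wgrad Omega z : E -> E :=
  xget (cst 0) [set g | L2_weak_gradient Omega z g].

(* Closure of the test functions in the norm of W12 Omega. *)
Definition W012 Omega z := W12 Omega z /\
  exists phi : nat -> E -> R, (forall k, test_function Omega (phi k)) /\
    (\int[leb]_(x in Omega)
       ((phi k x - z x) ^+ 2 +
        enorm (gradient (phi k) x - wgrad Omega z x) ^+ 2)%:E)%E
      @[k --> \oo] --> 0%E.

(* In \bar R, 0 * +oo = 0. *)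
Definition energy_space Omega V z := W012 Omega z /\
  (\int[leb]_(x in Omega) (V x * (z x ^+ 2)%:E) < +oo)%E.

Definition energy Omega V f z : \bar R :=
  ((2^-1)%:E * \int[leb]_(x in Omega)
      ((enorm (wgrad Omega z x) ^+ 2)%:E + V x * (z x ^+ 2)%:E)
   - \int[leb]_(x in Omega) (f x * z x)%:E)%E.

Definition energy_minimizer Omega V f z := energy_space Omega V z /\
  forall w, energy_space Omega V w ->
    (energy Omega V f z <= energy Omega V f w)%E.

(* For f in L2 Omega the minimizer exists and is unique up to equality almost
   everywhere; zeta is a representative of it. *)
Definition zeta Omega V f : E -> R :=
  xget (cst 0) [set z | energy_minimizer Omega V f z].

Definition lebesgue_value v (x : E) (c : R) :=
  ((fine (leb (eball x r)))^-1%:E * \int[leb]_(y in eball x r) `|v y - c|%:E)%E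
    @[r --> 0^'+] --> 0%E.

(* The precise representative, 0 outside of the set of Lebesgue points. *)
Definition precise v (x : E) : R := xget 0 [set c | lebesgue_value v x c].

(* Only the restriction of mu to Omega is relevant. *)
Definition duality_solution Omega V
    (mu : {finite_measure set E -> \bar R}) u :=
  L1 Omega u /\
  forall f, Linfty Omega f ->
    (\int[leb]_(x in Omega) (u x * f x)%:E =
     \int[mu]_(x in Omega) (precise (zeta Omega V f) x)%:E)%E.

End pde.

(* Main.v *)
Require Import Defs.
From HB Require Import structures.
From mathcomp Require Import all_boot all_order all_algebra.
From mathcomp Require Import all_classical all_reals all_analysis.
From mathcomp Require Import measurable_realfun ring lra.
Set Implicit Arguments.
Unset Strict Implicit.
Unset Printing Implicit Defensive.
Import Order.TTheory GRing.Theory Num.Theory.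
Import numFieldNormedType.Exports.
Local Open Scope classical_set_scope.
Local Open Scope ring_scope.

(* H t = c min(max(t, 0), 1)^2 with c = 1/(4 (1 + C)), where C is a bound for the
   solutions with data in [0, 1]: if |x_j| <= L on Omega, comparison with
   (L^2 + 1 - x_0^2)/2 gives C = (L^2 + 1)/2. Let 0 <= g <= 1 and A = {u > t}.
   The solution z with datum g for the potential V + 1_A is nonnegative, and it
   is zeta_f for f = g - 1_A z. Precise representatives of nonnegative functions
   are nonnegative, hence int u f >= 0 and t int_A z <= int u g. If e solves the
   equation with datum 1_A, the symmetry of the bilinear form yields
     int_A zeta_g = int e g = int e f + int_A e z = int_A z + int_A e z
                 <= (1 + C)/t int u g.
   Summing over the levels t = 2^-(k+1) with weights c 4^-k,
     int zeta_{H(u)} g = int H(u) zeta_g <= int u g,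
   and one concludes with the choice g = 1_{u < zeta_{H(u)}}. *)

(** * Square integrable functions *)

(** The only information on [u] is the sign of its pairing with data whose solution is nonnegative.
    The datum [g - 1_A z] may change sign, so it says more than [u >= 0]: its solution for [V] is
    also the solution of a problem with a larger potential and datum [g >= 0], hence is nonnegative.
    The estimate obtained on [{u > t}] degenerates like [1/t], and the quadratic decay of [H] at 0
    pays for it: level [k] costs [c 4^-k (1 + C) 2^(k+1) = 2^-(k+1)], these costs sum to 1, and this
    fixes [c]. Since [V] may be infinite on large sets and [u] is merely integrable, nothing is
    argued pointwise with the equation: every step is a test in the energy space, whose members have
    to be produced as limits of test functions. The comparison principle therefore uses a smooth
    substitute for the positive part, with errors of order [e]. Gradients and minimizers are choices
    made by [xget]; they become usable once existence and uniqueness almost everywhere are known. *)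

Section square_integrable.
Context d (T : measurableType d) (R : realType).
Variables (mu : {measure set T -> \bar R}) (D : set T) (mD : measurable D).
Implicit Types (f g h : T -> R).

(** For [leb] and [Omega] this is convertible with [L2], so proofs pass from one to the other
    silently. *)
Definition sqint f := measurable_fun D f /\
  (\int[mu]_(x in D) (f x ^+ 2)%:E < +oo)%E.

(** [Rintegral] turns an infinite integral into 0, so this squared norm is meaningful under
    [sqint]. *)
Definition sqn f : R := \int[mu]_(x in D) (f x ^+ 2).

Lemma integrable_ge0P f : (forall x, D x -> 0 <= f x) ->
  measurable_fun D f -> (\int[mu]_(x in D) (f x)%:E < +oo)%E ->
  mu.-integrable D (EFin \o f).
Proof.
move=> f0 mf foo; apply/integrableP; split; first exact/measurable_EFinP.
rewrite (eq_integral (fun x => (f x)%:E))// => x /set_mem Dx.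
by rewrite /= ger0_norm// f0.
Qed.

Lemma le_integrableR f g : measurable_fun D f ->
  (forall x, D x -> `|f x| <= g x) -> mu.-integrable D (EFin \o g) ->
  mu.-integrable D (EFin \o f).
Proof.
move=> mf fg gi; apply: (le_integrable mD _ _ gi); first exact/measurable_EFinP.
by move=> x Dx /=; rewrite lee_fin (le_trans (fg _ Dx))// ler_norm.
Qed.

Lemma eq_integrableR f g : (forall x, D x -> f x = g x) ->
  mu.-integrable D (EFin \o f) -> mu.-integrable D (EFin \o g).
Proof.
by move=> fg; apply: eq_integrable => // x /set_mem Dx /=; rewrite fg.
Qed.

Lemma integrableDR f g : mu.-integrable D (EFin \o f) ->
  mu.-integrable D (EFin \o g) ->
  mu.-integrable D (EFin \o (fun x => f x + g x)).
Proof. by move=> fi gi; exact: (integrableD mD fi gi). Qed.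

Lemma integrableBR f g : mu.-integrable D (EFin \o f) ->
  mu.-integrable D (EFin \o g) ->
  mu.-integrable D (EFin \o (fun x => f x - g x)).
Proof. by move=> fi gi; exact: (integrableB mD fi gi). Qed.

Lemma integrableZR (k : R) f : mu.-integrable D (EFin \o f) ->
  mu.-integrable D (EFin \o (fun x => k * f x)).
Proof. by move=> fi; exact: (integrableZl mD k fi). Qed.

Lemma integrable_sumR (I : Type) (s : seq I) (f : I -> T -> R) :
  (forall i, mu.-integrable D (EFin \o f i)) ->
  mu.-integrable D (EFin \o (fun x => \sum_(i <- s) f i x)).
Proof.
move=> fi; elim: s => [|i s IH].
  have h : mu.-integrable D (cst 0%E) := integrable0 mu D.
  by apply: eq_integrable h => // x _ /=; rewrite big_nil.
apply: eq_integrableR (integrableDR (fi i) IH) => x _ /=.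
by rewrite big_cons.
Qed.

Lemma Rintegral_sumR (I : Type) (s : seq I) (f : I -> T -> R) :
  (forall i, mu.-integrable D (EFin \o f i)) ->
  \int[mu]_(x in D) (\sum_(i <- s) f i x) =
  \sum_(i <- s) \int[mu]_(x in D) f i x.
Proof.
move=> fi; elim: s => [|i s IH].
  rewrite big_nil (@eq_Rintegral _ _ _ mu D (cst 0)); last by move=> x _; rewrite big_nil.
  by rewrite Rintegral_cst// mul0r.
rewrite big_cons -IH -RintegralD//; last exact: integrable_sumR.
by apply: eq_Rintegral => x _; rewrite big_cons.
Qed.

Lemma sqint_meas f : sqint f -> measurable_fun D f. Proof. by case. Qed.

Lemma sqint_integrable f : sqint f ->
  mu.-integrable D (EFin \o (fun x => f x ^+ 2)).
Proof.
case=> mf foo; apply: integrable_ge0P => //; first by move=> x _; rewrite sqr_ge0.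
exact: measurable_funX.
Qed.

Lemma integrable_sqint f : measurable_fun D f ->
  mu.-integrable D (EFin \o (fun x => f x ^+ 2)) -> sqint f.
Proof. by move=> mf /(integrable_lty mD). Qed.

Lemma sqnE f : sqint f -> (\int[mu]_(x in D) (f x ^+ 2)%:E)%E = (sqn f)%:E.
Proof.
by move=> /sqint_integrable fi; rewrite /sqn /Rintegral fineK//; exact: integrable_fin_num.
Qed.

Lemma sqint_le f g : measurable_fun D f ->
  (forall x, D x -> `|f x| <= `|g x|) -> sqint g -> sqint f.
Proof.
move=> mf fg gi; apply: integrable_sqint => //.
apply: le_integrableR (sqint_integrable gi); first exact: measurable_funX.
move=> x Dx; rewrite ger0_norm ?sqr_ge0// -[leLHS]real_normK ?num_real//.
by rewrite -[leRHS]real_normK ?num_real// ler_sqr ?nnegrE// fg.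
Qed.

Lemma sqint_mul f g : sqint f -> sqint g ->
  mu.-integrable D (EFin \o (fun x => f x * g x)).
Proof.
move=> fi gi; apply: le_integrableR
  (integrableDR (sqint_integrable fi) (sqint_integrable gi)).
  by apply: measurable_funM; apply: sqint_meas.
move=> x _; have := sqr_ge0 (f x - g x); have := sqr_ge0 (f x + g x).
have := sqr_ge0 (f x); have := sqr_ge0 (g x).
by move=> *; rewrite ler_norml; apply/andP; split; nra.
Qed.

Lemma sqintD f g : sqint f -> sqint g -> sqint (fun x => f x + g x).
Proof.
move=> fi gi; apply: integrable_sqint.
  by apply: measurable_funD; apply: sqint_meas.
apply: le_integrableR (integrableDR (integrableZR 2 (sqint_integrable fi))
  (integrableZR 2 (sqint_integrable gi))).
  by apply/measurable_funX/measurable_funD; apply: sqint_meas.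
by move=> x _; rewrite ger0_norm ?sqr_ge0//; have := sqr_ge0 (f x - g x); nra.
Qed.

Lemma sqintZ k f : sqint f -> sqint (fun x => k * f x).
Proof.
move=> fi; apply: integrable_sqint.
  by apply: measurable_funM => //; apply: sqint_meas.
apply: eq_integrableR (integrableZR (k ^+ 2) (sqint_integrable fi)).
by move=> x _ /=; rewrite exprMn.
Qed.

Lemma sqintB f g : sqint f -> sqint g -> sqint (fun x => f x - g x).
Proof.
move=> fi /(sqintZ (-1)) /(sqintD fi).
by under eq_fun do rewrite mulN1r.
Qed.

Lemma sqn_ge0 f : 0 <= sqn f.
Proof. by apply: Rintegral_ge0 => x _; rewrite sqr_ge0. Qed.

Lemma le_sqn f g : measurable_fun D f ->
  (forall x, D x -> `|f x| <= `|g x|) -> sqint g -> sqn f <= sqn g.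
Proof.
move=> mf fg gi; have fi := sqint_le mf fg gi.
apply: le_Rintegral; [exact: mD|exact: sqint_integrable|exact: sqint_integrable|].
move=> x Dx; rewrite -[leLHS]real_normK ?num_real//.
by rewrite -[leRHS]real_normK ?num_real// ler_sqr ?nnegrE// fg.
Qed.

Lemma sqnZ k f : sqint f -> sqn (fun x => k * f x) = k ^+ 2 * sqn f.
Proof.
move=> fi; rewrite /sqn -RintegralZl//; last exact: sqint_integrable.
by apply: eq_Rintegral => x _; rewrite exprMn.
Qed.

Lemma sqn_subrr f : sqn (fun x => f x - f x) = 0.
Proof.
rewrite /sqn (@eq_Rintegral _ _ _ mu D (fun=> 0)).
  by rewrite Rintegral_cst// mul0r.
by move=> x _; rewrite subrr expr0n.
Qed.

Lemma sqnB_sym f g : sqn (fun x => f x - g x) = sqn (fun x => g x - f x).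
Proof. by apply: eq_Rintegral => x _; rewrite -sqrrN opprB. Qed.

Lemma sqnDE f g : sqint f -> sqint g ->
  sqn (fun x => f x + g x) = sqn f + 2 * \int[mu]_(x in D) (f x * g x) + sqn g.
Proof.
move=> fi gi; rewrite /sqn -RintegralZl//; last exact: sqint_mul.
rewrite -!RintegralD//; first by apply: eq_Rintegral => x _; ring.
- apply: integrableDR; first exact: sqint_integrable.
  exact/integrableZR/sqint_mul.
- exact: sqint_integrable.
- exact: sqint_integrable.
- exact/integrableZR/sqint_mul.
Qed.

Lemma sqnD_le f g : sqint f -> sqint g ->
  sqn (fun x => f x + g x) <= 2 * sqn f + 2 * sqn g.
Proof.
move=> fi gi; rewrite /sqn -!RintegralZl//; try exact: sqint_integrable.
rewrite -RintegralD//; try exact/integrableZR/sqint_integrable.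
apply: le_Rintegral => //.
- exact/sqint_integrable/sqintD.
- by apply: integrableDR; exact/integrableZR/sqint_integrable.
- by move=> x _; have := sqr_ge0 (f x - g x); nra.
Qed.

Lemma sqn_triangle f g h : sqint f -> sqint g -> sqint h ->
  sqn (fun x => f x - h x) <=
  2 * sqn (fun x => f x - g x) + 2 * sqn (fun x => g x - h x).
Proof.
move=> fi gi hi; have := sqnD_le (sqintB fi gi) (sqintB gi hi).
by under eq_fun do rewrite addrA subrK.
Qed.

(** Pointwise, expand [l (|f| - |g|/l)^2 >= 0]. The free parameter [l] is what lets one of the two
    terms be absorbed later on. *)
Lemma young_Rintegral (l : R) f g : 0 < l -> sqint f -> sqint g ->
  `|\int[mu]_(x in D) (f x * g x)| <= l * sqn f + l^-1 * sqn g.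
Proof.
move=> l0 fi gi; apply: le_trans (le_normr_Rintegral mD (sqint_mul fi gi)) _.
rewrite /sqn -!RintegralZl//; try exact: sqint_integrable.
rewrite -RintegralD//; try exact/integrableZR/sqint_integrable.
apply: le_Rintegral => //.
- exact/(@integrable_norm _ _ _ mu D (fun x => f x * g x))/sqint_mul.
- by apply: integrableDR; exact/integrableZR/sqint_integrable.
- move=> x _; have lu : l * l^-1 = 1 by rewrite divff// gt_eqF.
  have -> : `|f x * g x| = `|f x| * `|g x| by rewrite normrM.
  rewrite -[X in _ * X + _]real_normK ?num_real//.
  rewrite -[X in _ + _ * X]real_normK ?num_real//.
  have H : 0 <= l * (`|f x| - l^-1 * `|g x|) ^+ 2.
    by rewrite mulr_ge0 ?sqr_ge0// ltW.
  have E : l * (`|f x| - l^-1 * `|g x|) ^+ 2 =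
     l * `|f x| ^+ 2 - 2 * (l * l^-1) * `|f x| * `|g x| + (l * l^-1) * l^-1 * `|g x| ^+ 2.
    by ring.
  rewrite lu in E.
  have : 0 <= `|f x| * `|g x| by rewrite mulr_ge0.
  by nra.
Qed.

Lemma ae_eq0_ge0_Rintegral f : mu.-integrable D (EFin \o f) ->
  (forall x, D x -> 0 <= f x) -> \int[mu]_(x in D) f x <= 0 ->
  {ae mu, forall x, D x -> f x = 0}.
Proof.
move=> fi f0 If.
have /(@ae_eq_integral_abs _ _ _ mu D mD (EFin \o f)) : measurable_fun D (EFin \o f).
  exact: measurable_int fi.
have -> : (\int[mu]_(x in D) `|(EFin \o f) x|)%E = 0%E.
  transitivity (\int[mu]_(x in D) f x)%:E; last first.
    by congr EFin; apply/eqP; rewrite eq_le If; apply: Rintegral_ge0.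
  rewrite /Rintegral fineK; last exact: integrable_fin_num.
  by apply: eq_integral => x /set_mem Dx /=; rewrite ger0_norm// f0.
case=> + _ => /(_ erefl); apply: filterS => x + Dx => /(_ Dx) /=.
by case.
Qed.

Lemma sqn_eq0 f : sqint f -> sqn f <= 0 -> {ae mu, forall x, D x -> f x = 0}.
Proof.
move=> fi f0; have := ae_eq0_ge0_Rintegral (sqint_integrable fi) _ f0.
move=> /(_ (fun x _ => sqr_ge0 (f x))); apply: filterS => x + Dx => /(_ Dx) /eqP.
by rewrite sqrf_eq0 => /eqP.
Qed.

Lemma ae_eq_Rintegral f g : measurable_fun D f -> measurable_fun D g ->
  {ae mu, forall x, D x -> f x = g x} ->
  \int[mu]_(x in D) f x = \int[mu]_(x in D) g x.
Proof.
move=> mf mg fg; congr fine; apply: ae_eq_integral => //.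
- exact/measurable_EFinP.
- exact/measurable_EFinP.
- by apply: filterS fg => x h Dx /=; rewrite h.
Qed.

Lemma ae_eq_integrable f g : measurable_fun D g ->
  {ae mu, forall x, D x -> f x = g x} ->
  mu.-integrable D (EFin \o f) -> mu.-integrable D (EFin \o g).
Proof.
move=> mg fg /integrableP[mf foo]; apply/integrableP; split.
  exact/measurable_EFinP.
rewrite -(@ae_eq_integral _ _ _ mu D _ (abse \o (EFin \o f)) mD)//.
- exact: measurableT_comp.
- by apply: measurableT_comp => //; exact/measurable_EFinP.
- by apply: filterS fg => x h Dx /=; rewrite h.
Qed.

Lemma ae_eq_sqint f g : measurable_fun D g ->
  {ae mu, forall x, D x -> f x = g x} -> sqint f -> sqint g.
Proof.
move=> mg fg fi; apply: integrable_sqint => //.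
apply: ae_eq_integrable (sqint_integrable fi); first exact: measurable_funX.
by apply: filterS fg => x h Dx; rewrite h.
Qed.

End square_integrable.

(** * Completeness of L^2 along rapidly converging sequences *)

Section completeness.
Context d (T : measurableType d) (R : realType).
Variables (mu : {measure set T -> \bar R}) (D : set T) (mD : measurable D).
Hypothesis Doo : (mu D < +oo)%E.
Implicit Types (f g h : T -> R).

(** Fatou's lemma for a limit that exists almost everywhere only and a bound that holds from rank
    [k] on: the lower limit ignores the first [k] terms. *)
Lemma fatou_bound (F : nat -> T -> \bar R) (G : T -> \bar R) (M : \bar R) (k : nat) :
  (forall n, measurable_fun D (F n)) -> (forall n x, D x -> 0 <= F n x)%E ->
  measurable_fun D G -> {ae mu, forall x, D x -> F ^~ x @ \oo --> G x} ->
  (forall n, (k <= n)%N -> \int[mu]_(x in D) F n x <= M)%E ->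
  (\int[mu]_(x in D) G x <= M)%E.
Proof.
move=> mF F0 mG FG FM.
have -> : (\int[mu]_(x in D) G x = \int[mu]_(x in D) limn_einf (F ^~ x))%E.
  apply: ae_eq_integral => //; last first.
    apply: filterS FG => x h Dx; have {}h := h Dx.
    by rewrite (cvg_limn_einf_sup h).1.
  have -> : (fun x => limn_einf (F ^~ x)) =
      (fun x => - limn_esup ((fun n x => - F n x) ^~ x))%E.
    apply/funext => x; rewrite -limn_einfN; congr limn_einf.
    by apply/funext => n /=; rewrite oppeK.
  apply: measurableT_comp => //; apply: measurable_fun_limn_esup => n.
  exact: measurableT_comp.
apply: le_trans (fatou mu mD mF F0) _.
rewrite limn_einf_lim; apply: lime_le; first exact: is_cvg_einfs.
apply: nearW => n; apply: le_trans (FM (maxn n k) (leq_maxr _ _)).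
by apply: ereal_inf_lbound; exists (maxn n k) => //=; exact: leq_maxl.
Qed.

Lemma integrable_cstR (k : R) : mu.-integrable D (EFin \o (fun=> k)).
Proof.
apply: measurable_bounded_integrable => //.
by exists `|k|; split; rewrite ?num_real// => M kM x _ /=; exact: ltW.
Qed.

Lemma sqint_cst (k : R) : sqint mu D (fun=> k).
Proof.
by apply: (integrable_sqint mD) => //; exact: (integrable_cstR (k ^+ 2)).
Qed.

Lemma sqint_bnd (M : R) f : measurable_fun D f ->
  (forall x, D x -> `|f x| <= M) -> sqint mu D f.
Proof.
move=> mf fM; apply: (sqint_le mD mf _ (sqint_cst M)) => x Dx.
by rewrite (le_trans (fM x Dx))// ler_norm.
Qed.

Lemma sqint_integrable1 f : sqint mu D f -> mu.-integrable D (EFin \o f).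
Proof.
move=> fi; have := sqint_mul mD fi (sqint_cst 1).
by apply: eq_integrableR => // x _; rewrite mulr1.
Qed.

(** Young's inequality against the constant 1, which is square integrable because [D] has finite
    measure. *)
Lemma le_Rintegral_norm (l : R) f : 0 < l -> sqint mu D f ->
  \int[mu]_(x in D) `|f x| <= l * sqn mu D f + l^-1 * fine (mu D).
Proof.
move=> l0 fi; have mf := sqint_meas fi.
have afi : sqint mu D (fun x => `|f x|).
  apply: (sqint_le mD _ _ fi); first exact: measurableT_comp.
  by move=> x _; rewrite normr_id.
have := young_Rintegral mD l0 afi (sqint_cst 1).
have -> : sqn mu D (fun x => `|f x|) = sqn mu D f.
  by apply: eq_Rintegral => x _; rewrite real_normK ?num_real.
have -> : sqn mu D (fun=> 1) = fine (mu D).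
  by rewrite /sqn Rintegral_cst// expr1n mul1r.
apply: le_trans; rewrite (eq_Rintegral _ (g := fun x => `|f x| * 1)).
  exact: ler_norm.
by move=> x _; rewrite mulr1.
Qed.

(** The sum of the increments [|f k.+1 - f k|] has an integral bounded by a geometric series, hence
    is finite almost everywhere; there the telescoping series converges absolutely. *)
Lemma fast_L1_cvg (f : nat -> T -> R) (C : R) :
  (forall k, mu.-integrable D (EFin \o f k)) ->
  (forall k, \int[mu]_(x in D) `|f k.+1 x - f k x| <= C * 2^-1 ^+ k) ->
  {ae mu, forall x, D x -> cvgn (f ^~ x)}.
Proof.
move=> fi fC.
have di k : mu.-integrable D (EFin \o (fun x => f k.+1 x - f k x)).
  exact: integrableBR.
have mdf k : measurable_fun D (fun x => `|f k.+1 x - f k x|%:E).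
  by apply/measurable_EFinP/measurableT_comp => //; apply/measurable_EFinP;
     exact: measurable_int (di k).
pose S x := (\sum_(0 <= k <oo) `|f k.+1 x - f k x|%:E)%E.
have S0 x : (0 <= S x)%E by apply: nneseries_ge0 => *; rewrite lee_fin.
have mS : measurable_fun D S by apply: ge0_emeasurable_sum => // *; rewrite lee_fin.
have Si : mu.-integrable D S.
  apply/integrableP; split => //.
  under eq_integral do rewrite gee0_abs//.
  rewrite /S integral_nneseries//.
  apply: (@le_lt_trans _ _ (\sum_(0 <= k <oo) (C * 2^-1 ^+ k)%:E)%E).
    apply: lee_nneseries => [k _ _|k _].
      by apply: integral_ge0 => *; rewrite lee_fin.
    rewrite -[leLHS]fineK ?lee_fin; first exact: fC.
    apply: (integrable_fin_num mD).
    exact: (@integrable_norm _ _ _ mu D (fun x => f k.+1 x - f k x)).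
  have /(@cvg_lim _) : (\sum_(0 <= i < k) (C * 2^-1 ^+ i)%:E)%E @[k --> \oo] --> (C * (1 - 2^-1)^-1)%:E.
    rewrite (_ : (fun k => _) = EFin \o series (geometric C 2^-1)).
      apply: cvg_EFin; first exact: nearW.
      by apply: cvg_geometric_series; rewrite ger0_norm ?invr_ge0//; lra.
    by apply/funext => k; rewrite /series /= -sumEFin.
  by move=> ->//; rewrite ltry.
have := integrable_ae mD Si; apply: filterS => x + Dx => /(_ Dx) Sfin.
have : cvgn (series (fun k => f k.+1 x - f k x)).
  apply: normed_cvg; apply: nondecreasing_is_cvgn.
    by apply/nondecreasing_seqP => k; rewrite /= seriesSr lerDl.
  exists (fine (S x)) => _ [k _ <-].
  rewrite -lee_fin fineK// /series /= -sumEFin.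
  by apply: nneseries_lim_ge => *; rewrite lee_fin.
move=> cs; apply/cvg_ex.
exists (f 0%N x + limn (series (fun k => f k.+1 x - f k x))).
have -> : f ^~ x = (fun n => f 0%N x + series (fun k => f k.+1 x - f k x) n).
  by apply/funext => n; rewrite /series /= telescope_sumr// addrC subrK.
by apply: cvgD => //; exact: cvg_cst.
Qed.

Lemma fast_L2_cvg (f : nat -> T -> R) (C : R) :
  (forall k, sqint mu D (f k)) ->
  (forall k m, (k <= m)%N -> sqn mu D (fun x => f m x - f k x) <= C * 4^-1 ^+ k) ->
  exists g, [/\ sqint mu D g, {ae mu, forall x, D x -> f ^~ x @ \oo --> g x} &
    forall k, sqn mu D (fun x => g x - f k x) <= C * 4^-1 ^+ k].
Proof.
move=> fi fC.
have : {ae mu, forall x, D x -> cvgn (f ^~ x)}.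
  apply: (@fast_L1_cvg f (C + fine (mu D))) => [k|k]; first exact: sqint_integrable1.
  (* Taking [l = 2^k] balances the two terms: [2^k 4^-k] and [l^-1] are both [2^-k], which is
     summable. *)
  have p0 : 0 < 2 ^+ k :> R by rewrite exprn_gt0.
  apply: le_trans (le_Rintegral_norm p0 (sqintB mD (fi k.+1) (fi k))) _.
  rewrite exprVn mulrDl [fine _ * _]mulrC lerD2r mulrC.
  rewrite -ler_pdivlMr// -mulrA; apply: le_trans (fC k k.+1 (leqnSn _)) _.
  by rewrite -invfM -exprMn -exprVn -natrM.
move=> cv.
(* The upper limit is measurable on all of [D] and is the limit wherever the sequence converges. *)
pose g x := fine (limn_esup (fun k => (f k x)%:E)).
have gE x : cvgn (f ^~ x) -> f ^~ x @ \oo --> g x.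
  move=> cx; suff -> : g x = limn (f ^~ x) by [].
  rewrite /g is_cvg_limn_esupE.
    by rewrite (_ : (fun k => _) = EFin \o (f ^~ x))// EFin_lim.
  apply/cvg_ex; exists (limn (f ^~ x))%:E; apply: cvg_EFin => //.
  exact: nearW.
have mg : measurable_fun D g.
  apply: measurableT_comp => //; apply: measurable_fun_limn_esup => k.
  exact/measurable_EFinP/sqint_meas.
have {}cv : {ae mu, forall x, D x -> f ^~ x @ \oo --> g x}.
  by apply: filterS cv => x h Dx; apply: gE; exact: h.
have key k : (\int[mu]_(x in D) ((g x - f k x) ^+ 2)%:E <= (C * 4^-1 ^+ k)%:E)%E.
  have mfk m : measurable_fun D (fun x => ((f m x - f k x) ^+ 2)%:E).
    apply/measurable_EFinP/measurable_funX/measurable_funB; exact: sqint_meas.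
  apply: (@fatou_bound (fun m x => ((f m x - f k x) ^+ 2)%:E) _ _ k) => //.
  - by move=> m x _; rewrite lee_fin sqr_ge0.
  - by apply/measurable_EFinP/measurable_funX/measurable_funB => //; exact: sqint_meas.
  - apply: filterS cv => x h Dx; have {}h := h Dx; apply: cvg_EFin; first exact: nearW.
    have hb : (f n x - f k x) @[n --> \oo] --> g x - f k x.
      by apply: cvgB => //; exact: cvg_cst.
    by rewrite expr2; exact: (cvgM hb hb).
  - by move=> m km; rewrite sqnE ?lee_fin ?fC//; exact: sqintB.
have gi : sqint mu D g.
  have h0 : sqint mu D (fun x => g x - f 0%N x).
    split; first by apply: measurable_funB => //; exact: sqint_meas.
    by apply: le_lt_trans (key 0%N) _; rewrite ltry.
  have := sqintD mD h0 (fi 0%N).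
  by under eq_fun do rewrite subrK.
exists g; split=> // k; rewrite -lee_fin -sqnE; first exact: key.
  exact: mD.
by apply: sqintB.
Qed.

End completeness.

Section cauchy_schwarz.
Context (R : realType).

(** Stands in for passages to the limit: errors proportional to [e] are discarded at once. [C] may
    have any sign, whence [|C| + 1] in the proof. *)
Lemma le0_small (a C : R) : (forall e, 0 < e -> a <= e * C) -> a <= 0.
Proof.
move=> H; apply/ler_addgt0Pr => e e0; rewrite add0r.
apply: le_trans (H (e / (`|C| + 1)) _) _; first by rewrite divr_gt0.
rewrite mulrAC ler_pdivrMr// ler_pM2l// (le_trans (ler_norm C))//.
by rewrite lerDl.
Qed.

(** The discriminant of a polynomial that is nonnegative on the whole line. It yields both
    Cauchy-Schwarz inequalities and the estimate [almost_minimizer]. *)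
Lemma quadratic_ge0 (a b c : R) : 0 <= c ->
  (forall t, 0 <= a + 2 * t * b + t ^+ 2 * c) -> b ^+ 2 <= a * c.
Proof.
rewrite le_eqVlt => /predU1P[<-|c0] H.
  have [->|b0] := eqVneq b 0; first by rewrite expr0n mulr0.
  (* With [c = 0] and [b] nonzero, the affine function takes the value -1 at this point. *)
  have := H (- (a + 1) / (2 * b)).
  have -> : a + 2 * (- (a + 1) / (2 * b)) * b + (- (a + 1) / (2 * b)) ^+ 2 * 0 = -1.
    by field.
  by rewrite lerNr oppr0 ler10.
have := H (- b / c).
have -> : a + 2 * (- b / c) * b + (- b / c) ^+ 2 * c = a - b ^+ 2 / c.
  by field; rewrite gt_eqF.
by rewrite subr_ge0 ler_pdivrMr.
Qed.

Context d (T : measurableType d).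
Variables (mu : {measure set T -> \bar R}) (D : set T) (mD : measurable D).

Lemma cauchy_schwarz_Rintegral (f g : T -> R) : sqint mu D f -> sqint mu D g ->
  (\int[mu]_(x in D) (f x * g x)) ^+ 2 <= sqn mu D f * sqn mu D g.
Proof.
move=> fi gi; apply: quadratic_ge0; first exact: sqn_ge0.
move=> t; have := sqn_ge0 mu D (fun x => f x + t * g x).
rewrite sqnDE//; last exact: sqintZ.
rewrite sqnZ//.
have -> : \int[mu]_(x in D) (f x * (t * g x)) = t * \int[mu]_(x in D) (f x * g x).
  rewrite -RintegralZl//; last exact: sqint_mul.
  by apply: eq_Rintegral => x _; rewrite mulrCA.
by rewrite mulrA.
Qed.

End cauchy_schwarz.

(** * Smooth functions *)

Section smooth_functions.
Variables (R : realType) (N : nat).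
Local Notation E := 'rV[R]_N.
Implicit Types (f g p : E -> R).

Definition smooth f := smooth_on setT f.

Lemma partial_comp (F : R -> R) f x (dF : R) i :
  is_derive (f x) 1 F dF -> differentiable f x ->
  differentiable (F \o f) x /\ partial i (F \o f) x = dF * partial i f x.
Proof.
move=> [FD FE] df.
have dF' : differentiable F (f x) by apply/derivable1_diffP.
split; first exact: differentiable_comp.
rewrite /partial !deriveE//; last exact: differentiable_comp.
rewrite diff_comp//= diff1E//= derive1E FE.
by rewrite mulrC.
Qed.

Lemma partialD f g x i : differentiable f x -> differentiable g x ->
  partial i (fun x => f x + g x) x = partial i f x + partial i g x.
Proof. by move=> df dg; apply: deriveD; exact: diff_derivable. Qed.

Lemma partialM f g x i : differentiable f x -> differentiable g x ->
  partial i (fun x => f x * g x) x = f x * partial i g x + g x * partial i f x.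
Proof. by move=> df dg; apply: deriveM; exact: diff_derivable. Qed.

Lemma partial_coord (j i : 'I_N) x :
  partial i (fun x : E => x 0 j) x = (i == j)%:R.
Proof.
rewrite /partial deriveE; last exact: differentiable_coord.
have lc : linear (fun x : E => x 0 j) by move=> a u v; rewrite !mxE.
pose cj : {linear E -> R} := HB.pack (fun x : E => x 0 j)
  (GRing.isLinear.Build R E R _ (fun x : E => x 0 j) lc).
rewrite (@diff_lin _ _ _ cj x)/=; last exact: coord_continuous.
by rewrite mxE eqxx eq_sym.
Qed.

Inductive alg (B : set (E -> R)) : set (E -> R) :=
| alg_base f : B f -> alg B f
| alg_add f g : alg B f -> alg B g -> alg B (fun x => f x + g x)
| alg_mul f g : alg B f -> alg B g -> alg B (fun x => f x * g x).

(** By the sum and product rules the partial derivatives of members of [alg B] stay in [alg B],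
    whose members are all differentiable. Smoothness is thus reduced to first derivatives of the
    generators, without formulas for higher ones. *)
Lemma alg_smooth (B : set (E -> R)) :
  (forall f, B f -> (forall x, differentiable f x) /\
    forall i, alg B (partial i f)) ->
  forall f, alg B f -> smooth f.
Proof.
move=> HB.
have Hd f : alg B f -> forall x, differentiable f x.
  elim=> {f} [f /HB[]//|f g _ df _ dg x|f g _ df _ dg x].
    exact: differentiableD.
  exact: differentiableM.
have Hp f : alg B f -> forall i, alg B (partial i f).
  elim=> {f} [f /HB[]//|f g Af IHf Ag IHg i|f g Af IHf Ag IHg i].
    rewrite (_ : partial i _ = fun x => partial i f x + partial i g x).
      exact: alg_add.
    by apply/funext => x; apply: partialD; exact: Hd.
  rewrite (_ : partial i _ = fun x => f x * partial i g x + g x * partial i f x).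
    by apply: alg_add; apply: alg_mul.
  by apply/funext => x; apply: partialM; exact: Hd.
move=> f Af s x _; elim: s x => [|i s IH] x; first exact: Hd.
suff : alg B (iter_partial (i :: s) f) by move=> /Hd.
by elim: {IH} (i :: s) => //= j t IH; exact: Hp.
Qed.

Lemma smooth_differentiable f x : smooth f -> differentiable f x.
Proof. by move=> /(_ [::] x I). Qed.

Lemma smooth_partial f i : smooth f -> smooth (partial i f).
Proof. by move=> sf s x _; have := sf (rcons s i) x I; rewrite /iter_partial foldr_rcons. Qed.

Lemma smoothW f : smooth f -> (forall x, differentiable f x) /\
    forall i, alg smooth (partial i f).
Proof.
move=> sf; split=> [x|i]; first exact: smooth_differentiable.
exact/alg_base/smooth_partial.
Qed.

Lemma smoothD f g : smooth f -> smooth g -> smooth (fun x => f x + g x).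
Proof.
by move=> sf sg; apply: (alg_smooth smoothW); apply: alg_add; exact: alg_base.
Qed.

Lemma smoothM f g : smooth f -> smooth g -> smooth (fun x => f x * g x).
Proof.
by move=> sf sg; apply: (alg_smooth smoothW); apply: alg_mul; exact: alg_base.
Qed.

Lemma partial_cst (k : R) i : partial i (fun _ : E => k) = fun=> 0.
Proof. by apply/funext => x; exact: derive_cst. Qed.

Lemma smooth_cst (k : R) : smooth (fun=> k).
Proof.
apply: (@alg_smooth (fun f => exists k, f = fun=> k)); last first.
  by apply: alg_base; exists k.
move=> _ [l ->]; split => [x|i]; first exact: differentiable_cst.
by apply: alg_base; exists 0; exact: partial_cst.
Qed.

Lemma smooth_coord (j : 'I_N) : smooth (fun x => x 0 j).
Proof.
apply: (@alg_smooth (fun f => f = (fun x => x 0 j) \/ smooth f)); last first.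
  by apply: alg_base; left.
have sub g : alg smooth g -> alg (fun f => f = (fun x => x 0 j) \/ smooth f) g.
  by elim=> {g} [g sg|g h _ ? _ ?|g h _ ? _ ?];
    [apply: alg_base; right|exact: alg_add|exact: alg_mul].
move=> f [->|/smoothW[? sf]]; split => //; last by move=> i; exact/sub.
- by move=> x; exact: differentiable_coord.
- move=> i; apply: alg_base; right; rewrite (_ : partial i _ = fun=> (i == j)%:R).
    exact: smooth_cst.
  by apply/funext => x; exact: partial_coord.
Qed.

Lemma smoothZ (k : R) f : smooth f -> smooth (fun x => k * f x).
Proof. by move=> sf; apply: smoothM => //; exact: smooth_cst. Qed.

Lemma smoothB f g : smooth f -> smooth g -> smooth (fun x => f x - g x).
Proof.
move=> sf /(smoothZ (-1)) /(smoothD sf).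
by under eq_fun do rewrite mulN1r.
Qed.

Lemma smooth_sqr f : smooth f -> smooth (fun x => f x ^+ 2).
Proof. by move=> sf; exact: smoothM. Qed.

Lemma smooth_sum (I : Type) (s : seq I) (f : I -> E -> R) :
  (forall i, smooth (f i)) -> smooth (fun x => \sum_(i <- s) f i x).
Proof.
move=> sf; elim: s => [|i s IH].
  by under eq_fun do rewrite big_nil; exact: smooth_cst.
by under eq_fun do rewrite big_cons; exact: smoothD.
Qed.

(* All derivatives of F o p are polynomials in the derivatives of p and in the
   functions F_k o p. *)
Lemma smooth_comp (F : nat -> R -> R) (G : nat -> R -> R) p :
  smooth p ->
  (forall k x, is_derive (p x) 1 (F k) (G k (p x))) ->
  (forall k, alg (fun f => smooth f \/ exists m, f = F m \o p) (G k \o p)) ->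
  forall k, smooth (F k \o p).
Proof.
move=> sp FG AG k.
apply: (@alg_smooth (fun f => smooth f \/ exists m, f = F m \o p)); last first.
  by apply: alg_base; right; exists k.
have dp x : differentiable p x by exact: smooth_differentiable.
move=> f [sf|[m ->]].
  split=> [x|i]; first exact: smooth_differentiable.
  by apply: alg_base; left; exact: smooth_partial.
split=> [x|i].
  apply: differentiable_comp => //; apply/derivable1_diffP.
  exact: (@ex_derive _ _ _ _ _ _ _ (FG m x)).
- rewrite (_ : partial i _ = (fun x => (G m \o p) x * partial i p x)).
    by apply: alg_mul => //; apply: alg_base; left; exact: smooth_partial.
  by apply/funext => x; exact: (partial_comp i (FG m x) (dp x)).2.
Qed.

Lemma is_derive_sqrt_inv (x : R) : 0 < x ->
  is_derive x 1 (fun x : R => (Num.sqrt x)^-1)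
    (- 2^-1 * ((Num.sqrt x)^-1 * (Num.sqrt x)^-1 * (Num.sqrt x)^-1)).
Proof.
move=> x0; have s0 : Num.sqrt x != 0 by rewrite gt_eqF// sqrtr_gt0.
apply: (is_derive_eq (is_deriveV s0 (is_derive1_sqrt x0))).
by rewrite /GRing.scale/= invfM; field.
Qed.

Lemma smooth_sqrt p : (forall x, 0 < p x) -> smooth p ->
  smooth (fun x => Num.sqrt (p x)).
Proof.
move=> p0 sp.
(* The square root and its inverse form a family closed under differentiation: the derivative of
   [1/sqrt] is [-1/2] times its cube. *)
pose F k : R -> R := if k is 0%N then Num.sqrt else fun x => (Num.sqrt x)^-1.
pose G k (x : R) : R := if k is 0%N then 2^-1 * F 1%N x else
  (- 2^-1) * (F 1%N x * F 1%N x * F 1%N x).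
apply: (@smooth_comp F G p sp _ _ 0%N) => [[|k] x|[|k]].
- apply: (is_derive_eq (is_derive1_sqrt (p0 x))).
  by rewrite /G/F/= invfM.
- exact: is_derive_sqrt_inv.
- apply: (@alg_mul _ (fun=> 2^-1) (F 1%N \o p)); apply: alg_base.
    by left; exact: smooth_cst.
  by right; exists 1%N.
- have A1 : alg (fun f => smooth f \/ exists m, f = F m \o p) (F 1%N \o p).
    by apply: alg_base; right; exists 1%N.
  apply: (@alg_mul _ (fun=> - 2^-1) (fun x => F 1%N (p x) * F 1%N (p x) * F 1%N (p x))).
    by apply: alg_base; left; exact: smooth_cst.
  by apply: (alg_mul _ A1); exact: (alg_mul A1 A1).
Qed.

(** For [k = 0] this is the classical flat function [exp(-1/s)]. The factors [s^-k] make the family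
    stable under differentiation up to linear combinations. *)
Definition bump k (s : R) : R := if 0 < s then s^-1 ^+ k * expR (- s^-1) else 0.

(** The exponential series gives [y^(k+2) <= (k+2)! exp y], applied at [y = 1/s]. A quadratic bound
    is all that differentiability at 0 requires. *)
Lemma bump_quadratic k : exists C : R, forall s : R, `|bump k s| <= C * s ^+ 2.
Proof.
exists ((k.+2)`!%:R) => s; rewrite /bump; case: ifPn => s0; last first.
  by rewrite normr0 mulr_ge0// sqr_ge0.
have i0 : 0 < s^-1 by rewrite invr_gt0.
rewrite ger0_norm; last by rewrite mulr_ge0 ?expR_ge0// exprn_ge0// ltW.
rewrite expRN ler_pdivrMr ?expR_gt0//.
have H := @expR_ge1Dxn _ _ k.+1 (ltW i0).
have {}H : s^-1 ^+ k.+2 <= k.+2`!%:R * expR s^-1.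
  rewrite -ler_pdivrMl ?ltr0n ?fact_gt0// mulrC.
  by apply: le_trans H; rewrite lerDr.
have -> : s^-1 ^+ k = s^-1 ^+ k.+2 * s ^+ 2.
  by rewrite -addn2 exprD -mulrA -exprMn mulVf ?gt_eqF// expr1n mulr1.
by rewrite [leRHS]mulrAC ler_wpM2r ?sqr_ge0.
Qed.

Lemma is_derive_quadratic (f : R -> R) (C : R) :
  (forall s, `|f s| <= C * s ^+ 2) -> is_derive (0 : R) 1 f 0.
Proof.
move=> fC.
have f0 : f 0 = 0.
  by apply/eqP; rewrite -normr_le0; have := fC 0; rewrite expr0n mulr0.
have C0 : 0 <= C by have := fC 1; rewrite expr1n mulr1; exact: le_trans.
have C1 : 0 < C + 1 by rewrite ltr_wpDl.
have c : h^-1 *: (f (h *: 1 + 0) - f 0) @[h --> 0^'] --> (0 : R).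
  apply/cvgr0Pnorm_le => e e0; near=> h.
  have h0 : h != 0 by near: h; exact: nbhs_dnbhs_neq.
  rewrite f0 subr0 addr0 /GRing.scale/= mulr1 normrM normfV.
  rewrite ler_pdivrMl ?normr_gt0//.
  apply: le_trans (fC h) _.
  rewrite -real_normK ?num_real// expr2 mulrCA ler_wpM2l//.
  apply: (@le_trans _ _ ((C + 1) * `|h|)); first by rewrite ler_wpM2r// lerDl.
  rewrite -ler_pdivlMl//; near: h; apply: dnbhs0_le.
  by rewrite mulr_gt0// invr_gt0.
split; first by apply/cvg_ex; exists 0.
exact: cvg_lim c.
Unshelve. all: by end_near.
Qed.

Lemma is_derive_bump k (s : R) :
  is_derive s 1 (bump k) (- k%:R * bump k.+1 s + bump k.+2 s).
Proof.
have [s0|s0|->] := ltgtP s 0.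
- rewrite /bump !ltNge (ltW s0)/= mulr0 addr0.
  apply: (near_eq_is_derive _ (is_derive_cst (0 : R) s 1)).
  have : \forall y \near s, y < 0 by exact: lt_nbhsl.
  by apply: filterS => y y0; rewrite /bump ltNge (ltW y0).
- have sn0 : s != 0 by rewrite gt_eqF.
  have d1 := is_deriveV sn0 (is_derive_id s 1).
  have d2 := is_deriveX k d1.
  have d3 := @is_derive1_comp R expR (fun x => - x^-1) s _ _
    (is_derive_expR (- s^-1)) (is_deriveN d1).
  have d4 := is_deriveM d2 d3.
  apply: (near_eq_is_derive _ (is_derive_eq d4 _)).
    have : \forall y \near s, 0 < y by exact: lt_nbhsr.
    by apply: filterS => y y0; rewrite /bump y0 !fctE.
  rewrite /bump s0 /GRing.scale/= !fctE.
  case: k {d2 d4} => [|k]; last first.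
    by rewrite /= !exprS; field.
  by rewrite /=; field.
- have [C HC] := bump_quadratic k.
  rewrite /bump ltxx mulr0 addr0; exact: is_derive_quadratic HC.
Qed.

Lemma smooth_bump p : smooth p -> smooth (bump 0 \o p).
Proof.
move=> sp; apply: (@smooth_comp bump
  (fun k s => - k%:R * bump k.+1 s + bump k.+2 s) p) => // k.
- by move=> x; exact: is_derive_bump.
- have A1 m : alg (fun f => smooth f \/ exists m, f = bump m \o p) (bump m \o p).
    by apply: alg_base; right; exists m.
  apply: (@alg_add _ (fun x => - k%:R * (bump k.+1 \o p) x) (bump k.+2 \o p)) => //.
  apply: (@alg_mul _ (fun=> - k%:R)) => //.
  by apply: alg_base; left; exact: smooth_cst.
Qed.

End smooth_functions.

(** * Integration by parts and test functions *)

Section lebesgue_rV_theory.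
Variable R : realType.

Lemma cons_rV0 n (s : R) (y : 'rV[R]_n) : cons_rV (s, y) 0 ord0 = s.
Proof. by have := cons_rVK (s, y); rewrite /uncons_rV => -[]. Qed.

Lemma cons_rVS n (s : R) (y : 'rV[R]_n) j : cons_rV (s, y) 0 (lift ord0 j) = y 0 j.
Proof.
have -> : lift ord0 j = rshift 1 j by exact/val_inj.
exact: row_mxEr.
Qed.

Lemma rV_consP n (x y : 'rV[R]_n.+1) : x 0 ord0 = y 0 ord0 ->
  (forall j, x 0 (lift ord0 j) = y 0 (lift ord0 j)) -> x = y.
Proof. by move=> h0 hS; apply/rowP => i; case: (unliftP ord0 i) => [j ->|->]. Qed.

Lemma rV_scaleDE n (t : R) (u v : 'rV[R]_n) i : (t *: u + v) 0 i = t * u 0 i + v 0 i.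
Proof. by rewrite !mxE. Qed.

Lemma delta_rVE n (i j : 'I_n) : (delta_mx 0 i : 'rV[R]_n) 0 j = (j == i)%:R.
Proof. by rewrite mxE eqxx. Qed.

Lemma cons_rV_shift0 n (t s : R) (y : 'rV[R]_n) :
  cons_rV (t + s, y) = t *: delta_mx 0 ord0 + cons_rV (s, y).
Proof.
apply: rV_consP => [|j]; rewrite rV_scaleDE delta_rVE.
  by rewrite !cons_rV0 !eqxx mulr1.
by rewrite !cons_rVS /= mulr0 add0r.
Qed.

Lemma cons_rV_shiftS n (t s : R) j (y : 'rV[R]_n) :
  cons_rV (s, t *: delta_mx 0 j + y) =
  t *: delta_mx 0 (lift ord0 j) + cons_rV (s, y).
Proof.
apply: rV_consP => [|k]; rewrite rV_scaleDE delta_rVE.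
  by rewrite !cons_rV0 /= mulr0 add0r.
by rewrite !cons_rVS rV_scaleDE delta_rVE (inj_eq lift_inj).
Qed.

Lemma norm_coord_le n (x : 'rV[R]_n) j : `|x 0 j| <= `|x|.
Proof.
apply/ler_addgt0Pr => e e0.
have : ball (0 : 'rV[R]_n) (`|x| + e) x.
  by rewrite -ball_normE /ball_ /= sub0r normrN ltrDl.
by move=> [_ /(_ 0 j)]; rewrite /ball/= mxE sub0r normrN => /ltW.
Qed.

(** The ball of the sup norm, written by coordinates so that it splits as a product under
    [cons_rV]. *)
Definition box n (x : 'rV[R]_n) (r : R) : set 'rV[R]_n :=
  [set y | forall i, `|x 0 i - y 0 i| < r].

Lemma box_ball n (x : 'rV[R]_n) (r : R) : 0 < r -> box x r = ball x r.
Proof.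
move=> r0; apply/seteqP; split=> y.
  by move=> h; split=> // i j; rewrite (ord1 i); exact: h.
by move=> [_ h] i; exact: h.
Qed.

Lemma measurable_box n (x : 'rV[R]_n) (r : R) : 0 < r -> measurable (box x r).
Proof. by move=> r0; rewrite box_ball//; apply: open_measurable_rV; exact: ball_open. Qed.

Lemma lebesgue_box n (x : 'rV[R]_n) (r : R) : 0 < r ->
  lebesgue_rV R n (box x r) = ((r *+ 2) ^+ n)%:E.
Proof.
move=> r0; elim: n x => [|n IH] x.
  by rewrite /= /dirac indicE mem_set ?expr0// => -[].
rewrite /= /lebesgue_rVS /pushforward.
pose x' := (uncons_rV x).2.
have xE : x = cons_rV (x 0 0, x') by rewrite -{1}(uncons_rVK x).
have -> : (@cons_rV R n) @^-1` box x r = ball (x 0 0) r `*` box x' r.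
  apply/seteqP; split=> -[s y] /=.
    move=> h; split=> /=.
      by have := h ord0; rewrite cons_rV0.
    by move=> j; have := h (lift ord0 j); rewrite cons_rVS {1}xE cons_rVS.
  move=> [h0 hS] i; case: (unliftP ord0 i) => [j ->|->].
    by rewrite cons_rVS {1}xE cons_rVS; exact: hS.
  by rewrite cons_rV0; exact: h0.
rewrite product_measure1E; [|exact: measurable_ball|exact: measurable_box].
rewrite IH [X in (X * _)%E](lebesgue_measure_ball (x 0 0) (ltW r0)) -EFinM; congr EFin.
by rewrite exprS.
Qed.

Lemma continuous_measurable_rV n (g : 'rV[R]_n -> R) :
  continuous g -> measurable_fun setT g.
Proof.
move=> cg; apply: (measurability _ (RGenOpens.measurableE R)) => _ [_ [a [b ->] <-]].
rewrite setTI; apply: open_measurable_rV.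
by move/continuousP : cg; apply; exact: interval_open.
Qed.

Lemma compact_box n (L : R) : compact [set x : 'rV[R]_n | forall j, `|x 0 j| <= L].
Proof.
have := @rV_compact R n (fun=> `[-L, L]%classic) (fun=> @segment_compact _ _ _).
congr compact; apply/seteqP; split=> x /= h j; have := h j.
  by rewrite in_itv/= ler_norml.
by rewrite in_itv/= ler_norml.
Qed.

Lemma continuous_bounded_compact n (g : 'rV[R]_n -> R) K : compact K -> continuous g ->
  exists M, forall x, K x -> `|g x| <= M.
Proof.
move=> cK cg.
have /compact_bounded [M [_ HM]] : compact (g @` K).
  by apply: continuous_compact => //; exact: continuous_subspaceT.
exists (M + 1) => x Kx; apply: (HM (M + 1)); first by rewrite ltrDl.
by exists x.
Qed.

Lemma lebesgue_compact_lty n (K : set 'rV[R]_n) (L : R) : measurable K ->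
  (forall x, K x -> forall j, `|x 0 j| <= L) -> (lebesgue_rV R n K < +oo)%E.
Proof.
move=> mK KL; have L0 : 0 < `|L| + 1 by rewrite ltr_wpDl.
apply: (@le_lt_trans _ _ (lebesgue_rV R n (box 0 (`|L| + 1)))); last first.
  by rewrite lebesgue_box// ltry.
apply: le_measure.
- by rewrite inE.
- by rewrite inE; exact: measurable_box.
- move=> x /KL h j; rewrite mxE sub0r normrN; apply: le_lt_trans (h j) _.
  by rewrite (le_lt_trans (ler_norm _))// ltrDl.
Qed.

Lemma continuous_supp_integrable n (g : 'rV[R]_n -> R) (L : R) : continuous g ->
  (forall x : 'rV[R]_n, (exists j, L < `|x 0 j|) -> g x = 0) ->
  (lebesgue_rV R n).-integrable setT (EFin \o g).
Proof.
move=> cg g0; pose K := [set x : 'rV[R]_n | forall j, `|x 0 j| <= L].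
have cK : compact K := @compact_box n L.
have mK : measurable K.
  rewrite -[K]setCK; apply: measurableC; apply: open_measurable_rV.
  by rewrite openC; apply: compact_closed => //; exact: norm_hausdorff.
have -> : g = g \_ K.
  apply/funext => x; rewrite patchE; case: ifPn => // /negP xK.
  apply: g0; apply: contrapT => h; apply: xK; rewrite inE => j.
  by rewrite leNgt; apply/negP => Lj; apply: h; exists j.
rewrite -restrict_EFin; apply/(integrable_mkcond _ mK).
apply: measurable_bounded_integrable => //.
- by apply: (@lebesgue_compact_lty _ _ L).
- by apply: (measurable_funS measurableT _ (continuous_measurable_rV cg)).
have [M HM] := continuous_bounded_compact cK cg.
by exists M; split; rewrite ?num_real// => m Mm x Kx; apply: le_trans (HM x Kx) (ltW Mm).
Qed.

Lemma continuous_cons_rV n (y : 'rV[R]_n) : continuous (fun s : R => cons_rV (s, y)).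
Proof.
have -> : (fun s : R => cons_rV (s, y)) =
    (fun s : R => s *: delta_mx 0 ord0 + cons_rV (0, y)).
  by apply/funext => s; rewrite -cons_rV_shift0 addr0.
move=> s; apply: cvgD; last exact: cvg_cst.
by apply: cvgZr_tmp; exact: cvg_id.
Qed.

Lemma continuous_cons_rVr n (s : R) : continuous (fun y : 'rV[R]_n => cons_rV (s, y)).
Proof.
move=> y A /nbhs_ballP[e /= e0 eA]; apply/nbhs_ballP; exists e => // y' yy'.
apply: eA; move: yy'; rewrite -!box_ball// => h i.
case: (unliftP ord0 i) => [j ->|->]; last by rewrite !cons_rV0 subrr normr0.
by rewrite !cons_rVS; exact: h.
Qed.

Lemma is_derive_line (V : normedModType R) (h : V -> R) (v x : V) (s : R) :
  derivable h (s *: v + x) v ->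
  is_derive s 1 (fun t : R => h (t *: v + x)) ('D_v h (s *: v + x)).
Proof.
have E : (fun e : R => e^-1 *: (((fun t : R => h (t *: v + x)) \o shift s) (e *: 1) -
     (fun t : R => h (t *: v + x)) s)) =
  (fun e : R => e^-1 *: ((h \o shift (s *: v + x)) (e *: v) - h (s *: v + x))).
  by apply/funext => e /=; rewrite addrA -scalerDl /GRing.scale/= mulr1.
move=> dh; split; first by rewrite /derivable E.
by rewrite /derive E.
Qed.

(* The assumptions bear on one direction only, so that they pass to slices. *)
Lemma integral_partial0 n (i : 'I_n) (h : 'rV[R]_n -> R) (L : R) :
  (forall x, derivable h x (delta_mx 0 i)) -> continuous (partial i h) ->
  (forall x : 'rV[R]_n, (exists j, L <= `|x 0 j|) -> h x = 0) ->
  (\int[lebesgue_rV R n]_x (partial i h x)%:E = 0)%E.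
Proof.
elim: n i h => [[]//|n IH] i h dh ch h0.
(* The strict inequality is an open condition: [h] vanishes near such a point, and so does its
   derivative there. *)
have dh0 (x : 'rV[R]_n.+1) : (exists j, L < `|x 0 j|) -> partial i h x = 0.
  move=> [j Lj]; rewrite -[RHS](@derive_cst _ _ _ (0 : R) x (delta_mx 0 i)).
  apply: near_eq_derive.
  have : nbhs x [set y : 'rV[R]_n.+1 | L < `|y 0 j|].
    have cn : {for x, continuous (fun y : 'rV[R]_n.+1 => `|y 0 j|)}.
      by apply: continuous_comp; [exact: coord_continuous|exact: norm_continuous].
    exact: (cn _ (lt_nbhsr Lj)).
  by apply: filterS => y Ly; apply: h0; exists j; exact: ltW.
have ih := continuous_supp_integrable ch dh0.
have mh : measurable_fun setT (EFin \o partial i h).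
  by apply/measurable_EFinP; exact: (continuous_measurable_rV ch).
have mcons := @measurable_cons_rV R n.
have ihp : (@lebesgue_measure R \x lebesgue_rV R n)%E.-integrable setT
    ((EFin \o partial i h) \o @cons_rV R n).
  apply/integrableP; split; first exact: measurableT_comp.
  move/integrableP : ih => [_].
  rewrite /= /lebesgue_rVS ge0_integral_pushforward//.
  by apply: (@measurableT_comp _ _ _ _ _ _ abse _ (EFin \o partial i h)).
transitivity (\int[lebesgue_rVS (lebesgue_rV R n)]_x (EFin \o partial i h) x)%E => //.
rewrite /lebesgue_rVS integral_pushforward//.
rewrite preimage_setT.
(* By Fubini, a derivative in a later coordinate is handled by induction on the slices with fixed
   first coordinate; a derivative in the first one by the fundamental theorem of calculus on each
   line. *)
case: (unliftP ord0 i) => [j ij|i0].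
  rewrite -integral12_prod_meas1//= /fubini_F.
  apply: integral0_eq => s _ /=.
  have E y : (fun e : R => e^-1 *: (((fun y => h (cons_rV (s, y))) \o shift y)
      (e *: delta_mx 0 j) - h (cons_rV (s, y)))) =
     (fun e : R => e^-1 *: ((h \o shift (cons_rV (s, y)))
      (e *: delta_mx 0 i) - h (cons_rV (s, y)))).
    by apply/funext => e /=; rewrite cons_rV_shiftS ij.
  have Ep : partial j (fun y => h (cons_rV (s, y))) =
      (fun y => partial i h (cons_rV (s, y))).
    by apply/funext => y; rewrite /partial /derive E.
  transitivity (\int[lebesgue_rV R n]_y
      (partial j (fun y => h (cons_rV (s, y))) y)%:E)%E; first by rewrite Ep.
  apply: IH.
  - by move=> y; rewrite /derivable E; exact: dh.
  - rewrite Ep => y; apply: (@continuous_comp _ _ _ (fun y => cons_rV (s, y))).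
      exact: continuous_cons_rVr.
    exact: ch.
  - by move=> y [k Lk]; apply: h0; exists (lift ord0 k); rewrite cons_rVS.
rewrite -integral21_prod_meas1//= /fubini_G.
apply: integral0_eq => y _ /=.
(* Larger than [L] and positive: the interval is nondegenerate and [g] vanishes at both of its
   ends. *)
pose L' : R := `|L| + 1.
have LL' : L < L' by rewrite (le_lt_trans (ler_norm _))// ltrDl.
have L'0 : 0 < L' by rewrite ltr_wpDl.
pose g (t : R) := h (t *: delta_mx 0 i + cons_rV (0, y)).
pose f (t : R) := partial i h (cons_rV (t, y)).
have consE t : cons_rV (t, y) = t *: delta_mx 0 i + cons_rV (0, y).
  by rewrite i0 -cons_rV_shift0 addr0.
have gf (t : R) : is_derive t 1 g (f t).
  by rewrite /f consE; exact: is_derive_line.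
have gc : continuous g.
  move=> t; apply: differentiable_continuous; apply/derivable1_diffP.
  exact: (@ex_derive _ _ _ _ _ _ _ (gf t)).
have g0 t : L <= `|t| -> g t = 0.
  by move=> Lt; rewrite /g -consE; apply: h0; exists ord0; rewrite cons_rV0.
pose I : set R := `[- L', L']%classic.
transitivity (\int[lebesgue_measure]_(x in I) (f x)%:E)%E.
  rewrite [RHS]integral_mkcond; apply: eq_integral => t _.
  rewrite patchE; case: ifPn => // /negP tL; congr EFin.
  apply: dh0; exists ord0; rewrite cons_rV0 ltNge; apply/negP => tL'.
  apply: tL; rewrite inE /I /mkset in_itv/= -ler_norml.
  exact: le_trans tL' (ltW LL').
rewrite (@continuous_FTC2 _ f g)//.
- rewrite !g0 ?subee//; first by rewrite normrN gtr0_norm// ltW.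
  by rewrite gtr0_norm// ltW.
- by rewrite gtrN.
- apply: continuous_subspaceT => t.
  apply: (@continuous_comp _ _ _ (fun s => cons_rV (s, y)) (partial i h)).
    exact: continuous_cons_rV.
  exact: ch.
- split.
  + by move=> t _; exact: (@ex_derive _ _ _ _ _ _ _ (gf t)).
  + by apply: cvg_at_right_filter; exact: gc.
  + by apply: cvg_at_left_filter; exact: gc.
- by move=> t _; rewrite derive1E; exact: (@derive_val _ _ _ _ _ _ _ (gf t)).
Qed.

End lebesgue_rV_theory.

(** * Calculus with test functions and the Poincare inequality *)

Section test_functions.
Variables (R : realType) (N : nat) (Omega : set 'rV[R]_N).
Local Notation E := 'rV[R]_N.
Local Notation leb := (lebesgue_rV R N).
Local Notation test := (test_function Omega).
Implicit Types (f g p phi psi : E -> R).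

Lemma bounded_coord (K : set E) : bounded_set K ->
  exists2 L : R, 0 < L & forall x, K x -> forall j, `|x 0 j| <= L.
Proof.
move=> [M [_ HM]]; exists (`|M| + 1); first by rewrite ltr_wpDl.
move=> x Kx j; apply: le_trans (norm_coord_le x j) _.
by apply: (HM (`|M| + 1)) => //; rewrite (le_lt_trans (ler_norm _))// ltrDl.
Qed.

Lemma rV_compact_closed (K : set E) : compact K -> closed K.
Proof. by move=> cK; apply: compact_closed => //; exact: norm_hausdorff. Qed.

Lemma smooth_continuous f : smooth f -> continuous f.
Proof. by move=> sf x; exact/differentiable_continuous/smooth_differentiable. Qed.

Lemma smooth_measurable f D : measurable D -> smooth f -> measurable_fun D f.
Proof.
move=> mD sf; apply: (measurable_funS measurableT) => //.
exact: (continuous_measurable_rV (smooth_continuous sf)).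
Qed.

Lemma test_smooth phi : test phi -> smooth phi. Proof. by case. Qed.

Lemma test_partial i phi : test phi -> test (partial i phi).
Proof.
move=> [sphi [K [cK KO K0]]]; split; first exact: smooth_partial.
exists K; split=> // x Kx.
rewrite -[RHS](@derive_cst _ _ _ (0 : R) x (delta_mx 0 i)).
apply: near_eq_derive.
have : nbhs x (~` K).
  by apply: open_nbhs_nbhs; split=> //; rewrite openC; exact: rV_compact_closed.
by apply: filterS => y; exact: K0.
Qed.

Lemma testMl f phi : smooth f -> test phi -> test (fun x => f x * phi x).
Proof.
move=> sf [sphi [K [cK KO K0]]]; split; first exact: smoothM.
by exists K; split=> // x Kx; rewrite K0// mulr0.
Qed.

Lemma testD phi psi : test phi -> test psi -> test (fun x => phi x + psi x).
Proof.
move=> [sphi [K [cK KO K0]]] [spsi [L [cL LO L0]]]; split; first exact: smoothD.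
exists (K `|` L); split => [| |x KLx]; first exact: compactU.
  by move=> x [/KO|/LO].
by rewrite K0 ?L0 ?addr0// => ?; apply: KLx; [right|left].
Qed.

Lemma testZ k phi : test phi -> test (fun x => k * phi x).
Proof. by move=> tphi; apply: testMl => //; exact: smooth_cst. Qed.

Lemma test0 : test (fun=> 0).
Proof.
split; first exact: smooth_cst.
by exists set0; split=> //; exact: compact0.
Qed.

Lemma test_bounded phi : test phi -> exists M, forall x, `|phi x| <= M.
Proof.
move=> [sphi [K [cK KO K0]]].
have [M HM] := continuous_bounded_compact cK (smooth_continuous sphi).
exists `|M| => x; have [Kx|Kx] := pselect (K x).
  by rewrite (le_trans (HM x Kx))// ler_norm.
by rewrite K0// normr0.
Qed.

Lemma test_off phi x : test phi -> ~ Omega x -> phi x = 0.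
Proof. by move=> [_ [K [cK KO K0]]] Ox; apply: K0 => /KO. Qed.

Hypothesis (oO : open Omega).
Let mO : measurable Omega. Proof. exact: open_measurable_rV. Qed.

(** A test function and its derivatives vanish off [Omega], so the integral may be taken over the
    whole space. *)
Lemma Rintegral_partial_test i phi : test phi ->
  \int[leb]_(x in Omega) partial i phi x = 0.
Proof.
move=> tphi; have [sphi [K [cK KO K0]]] := tphi.
have [L L0 HL] := bounded_coord (compact_bounded cK).
rewrite /Rintegral integral_mkcond.
rewrite (_ : \int[leb]_x _ = \int[leb]_x (partial i phi x)%:E)%E.
  rewrite (@integral_partial0 _ _ _ _ (L + 1))//.
  - by move=> x; apply: diff_derivable; exact: smooth_differentiable.
  - exact/smooth_continuous/smooth_partial.
  - move=> x [j Lj]; apply: K0 => /HL /(_ j) Hj.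
    by have := le_trans Lj Hj; rewrite gerDl leNgt ltr01.
apply: eq_integral => x _; rewrite patchE; case: ifPn => //.
by rewrite notin_setE => /(test_off (test_partial i tphi)) ->.
Qed.

Hypothesis (bO : bounded_set Omega).

Lemma leb_bounded_lty : (leb Omega < +oo)%E.
Proof. by have [L _ HL] := bounded_coord bO; exact: (lebesgue_compact_lty mO HL). Qed.

Lemma test_sqint phi : test phi -> sqint leb Omega phi.
Proof.
move=> tphi; have [M HM] := test_bounded tphi.
apply: (sqint_bnd mO leb_bounded_lty (M := M)) => //.
by apply: smooth_measurable => //; exact: test_smooth.
Qed.

Lemma test_ibp i phi psi : test phi -> test psi ->
  \int[leb]_(x in Omega) (phi x * partial i psi x) =
  - \int[leb]_(x in Omega) (partial i phi x * psi x).
Proof.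
move=> tphi tpsi.
have tdphi := test_partial i tphi; have tdpsi := test_partial i tpsi.
apply/eqP; rewrite -subr_eq0 opprK -RintegralD//.
- rewrite -(Rintegral_partial_test i (testMl (test_smooth tphi) tpsi)).
  apply/eqP/eq_Rintegral => x _; rewrite partialM//.
  + by rewrite [X in _ = _ + X]mulrC.
  + exact/smooth_differentiable/test_smooth.
  + exact/smooth_differentiable/test_smooth.
- exact/(sqint_mul mO (test_sqint _) (test_sqint _)).
- exact/(sqint_mul mO (test_sqint _) (test_sqint _)).
Qed.

(* The first coordinate times psi ^+ 2 is a test function; its derivative along
   the first coordinate has zero integral. *)
Lemma test_poincare (i : 'I_N) L psi : 0 < L ->
  (forall x, Omega x -> forall j, `|x 0 j| <= L) -> test psi ->
  sqn leb Omega psi <= 16 * L ^+ 2 * sqn leb Omega (partial i psi).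
Proof.
move=> L0 HL tpsi.
have tdpsi := test_partial i tpsi.
have spsi := test_smooth tpsi.
have [si sdi] := (test_sqint tpsi, test_sqint tdpsi).
have sxi : sqint leb Omega (fun x => x 0 i * psi x).
  by apply: test_sqint; apply: testMl => //; exact: smooth_coord.
have := Rintegral_partial_test i (testMl (smooth_coord i) (testMl spsi tpsi)).
have -> : \int[leb]_(x in Omega) partial i (fun x => x 0 i * (psi x * psi x)) x =
  sqn leb Omega psi + 2 * \int[leb]_(x in Omega) (x 0 i * psi x * partial i psi x).
  rewrite /sqn -RintegralZl//; last exact: (sqint_mul mO).
  rewrite -RintegralD//; last 2 first.
  - exact: sqint_integrable.
  - by apply: integrableZR => //; exact: (sqint_mul mO).
  apply: eq_Rintegral => x _; rewrite partialM.
  - rewrite partialM ?partial_coord ?eqxx; try exact: smooth_differentiable.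
    by rewrite /=; ring.
  - exact: differentiable_coord.
  - by apply: differentiableM; exact: smooth_differentiable.
move=> H.
(* With this [l], twice the first Young term is at most half of [sqn psi] and moves to the left; the
   other one carries [2 * 4 L^2], and doubling gives 16. *)
have l0 : 0 < (4 * L ^+ 2)^-1 by rewrite invr_gt0 mulr_gt0// exprn_gt0.
have Y := young_Rintegral mO l0 sxi sdi.
have S : sqn leb Omega (fun x => x 0 i * psi x) <= L ^+ 2 * sqn leb Omega psi.
  rewrite -sqnZ//; apply: le_sqn => //; last exact: sqintZ.
    exact: sqint_meas sxi.
  move=> x Ox; rewrite !normrM ler_wpM2r// [leRHS]gtr0_norm//.
  exact: HL.
rewrite invrK in Y.
have {}S : (4 * L ^+ 2)^-1 * sqn leb Omega (fun x => x 0 i * psi x) <= 4^-1 * sqn leb Omega psi.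
  rewrite invfM -mulrA ler_wpM2l ?invr_ge0// ler_pdivrMl ?exprn_gt0//.
move: Y; rewrite ler_norml => /andP[Y _].
nra.
Qed.

End test_functions.

(** * Approximation of open sets by test functions and the fundamental lemma *)

Section density_of_test_functions.
Variables (R : realType) (N : nat) (Omega : set 'rV[R]_N).
Local Notation E := 'rV[R]_N.
Local Notation leb := (lebesgue_rV R N).
Local Notation test := (test_function Omega).
Hypotheses (oO : open Omega) (bO : bounded_set Omega).
Let mO : measurable Omega. Proof. exact: open_measurable_rV. Qed.

Definition sqdist (a x : E) : R := \sum_i (x 0 i - a 0 i) ^+ 2.

(** As [n] grows, these increase to the indicator of the open Euclidean ball of center [a] and
    radius [r]. *)
Definition ball_bump (a : E) (r : R) (n : nat) (x : E) : R :=
  bump 0 (n.+1%:R * (r ^+ 2 - sqdist a x)).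

Lemma sqdist_coord (a x : E) (r : R) j : 0 <= r -> sqdist a x <= r ^+ 2 ->
  `|x 0 j - a 0 j| <= r.
Proof.
move=> r0; rewrite /sqdist (bigD1 j)//= => h.
rewrite -ler_sqr ?nnegrE// real_normK ?num_real//; apply: le_trans h.
by rewrite lerDl sumr_ge0// => i _; rewrite sqr_ge0.
Qed.

Lemma smooth_sqdist a : smooth (sqdist a).
Proof.
apply: smooth_sum => i; apply: smooth_sqr; apply: smoothB; last exact: smooth_cst.
exact: smooth_coord.
Qed.

Lemma ball_bump_test a r n : 0 <= r -> (forall x, sqdist a x <= r ^+ 2 -> Omega x) ->
  test (ball_bump a r n).
Proof.
move=> r0 rO; split.
  apply: smooth_bump; apply: smoothZ; apply: smoothB; first exact: smooth_cst.
  exact: smooth_sqdist.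
exists [set x | sqdist a x <= r ^+ 2]; split=> //.
  apply: (subclosed_compact _ (@compact_box R N (`|a| + r))).
    have -> : [set x | sqdist a x <= r ^+ 2] = sqdist a @^-1` [set y | y <= r ^+ 2].
      by [].
    apply: closed_comp; last exact: closed_le.
    by move=> x _; exact: (smooth_continuous (smooth_sqdist a)).
  move=> x /= /(sqdist_coord _ r0) h j; rewrite -(subrK (a 0 j) (x 0 j)).
  rewrite (le_trans (ler_normD _ _))// addrC lerD//.
  exact: norm_coord_le.
move=> x /= /negP; rewrite -ltNge => h; rewrite /ball_bump /bump pmulr_rgt0//.
by rewrite subr_gt0 ltNge (ltW h).
Qed.

Lemma ball_bump_le a r n x : 0 <= ball_bump a r n x <= 1.
Proof.
rewrite /ball_bump /bump; case: ifPn => [h|_]; last by rewrite lexx ler01.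
by rewrite expr0 mul1r expR_ge0 -[leRHS]expR0 ler_expR oppr_le0 invr_ge0 ltW.
Qed.

Lemma ball_bump_cvg a r x : sqdist a x < r ^+ 2 ->
  ball_bump a r ^~ x @ \oo --> (1 : R).
Proof.
move=> h; rewrite -expR0.
have -> : ball_bump a r ^~ x = (fun n => expR (- (n.+1%:R^-1 * (r ^+ 2 - sqdist a x)^-1))).
  apply/funext => n; rewrite /ball_bump /bump pmulr_rgt0// subr_gt0 h.
  by rewrite expr0 mul1r invfM.
apply: (@continuous_cvg _ _ _ _ _ _ expR); first exact: continuous_expR.
rewrite -oppr0; apply: cvgN; rewrite -(mul0r ((r ^+ 2 - sqdist a x)^-1)).
by apply: cvgM; [exact: cvg_harmonic|exact: cvg_cst].
Qed.

Section approx.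
Variable U : set E.
Let rad (p : 'rV[rat]_N * nat) : R := p.2.+1%:R^-1.
Let ctr (p : 'rV[rat]_N * nat) : E := map_mx ratr p.1.
Let adm p := forall x, sqdist (ctr p) x <= rad p ^+ 2 -> (U `&` Omega) x.
(** The balls with rational center, radius [1/(k+1)] and closure inside [U] and [Omega], enumerated
    through [pickle]; any other code gives the zero function. *)
Let beta m n : E -> R :=
  if unpickle m is Some p then
    if `[< adm p >] then ball_bump (ctr p) (rad p) n else fun=> 0
  else fun=> 0.

Let beta_test m n : test (beta m n).
Proof.
rewrite /beta; case: unpickle => [p|]; last exact: test0.
case: asboolP => ap; last exact: test0.
by apply: ball_bump_test => [|x /ap[]//]; rewrite invr_ge0.
Qed.

Let beta_le m n x : 0 <= beta m n x <= 1.
Proof.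
rewrite /beta; case: unpickle => [p|]; last by rewrite lexx ler01.
by case: ifPn => _; [exact: ball_bump_le|rewrite lexx ler01].
Qed.

Let beta_off m n x : ~ U x -> Omega x -> beta m n x = 0.
Proof.
move=> Ux Ox; rewrite /beta; case: unpickle => [p|//].
case: asboolP => // ap; rewrite /ball_bump /bump pmulr_rgt0// subr_gt0.
by case: ifPn => // /ltW /ap[].
Qed.

Let beta_cvg x : open U -> U x -> Omega x ->
  exists m, beta m ^~ x @ \oo --> (1 : R).
Proof.
move=> oU Ux Ox.
have /nbhs_ballP[e /= e0 eW] : nbhs x (U `&` Omega).
  by apply: open_nbhs_nbhs; split=> //; exact: openI.
have [k ke] : exists k : nat, k.+1%:R^-1 < e / 2.
  have [k _ H] := near_infty_natSinv_lt (PosNum (divr_gt0 e0 (ltr0n R 2))).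
  by exists k; apply: H => /=.
pose r : R := k.+1%:R^-1.
have r0 : 0 < r by rewrite invr_gt0.
(* A center off by less than [dl] in each coordinate is at squared distance at most [N dl^2], and
   dividing by [N + 1] keeps this strictly below [r^2]. *)
pose dl := r / N.+1%:R.
have dl0 : 0 < dl by rewrite divr_gt0.
have dlr : dl <= r by rewrite ler_pdivrMr// ler_peMr ?(ltW r0)// ler1n.
have /choice[q qP] : forall i, exists q : rat, ratr q \in `](x 0 i - dl), (x 0 i + dl)[.
  by move=> i; apply: rat_in_itvoo; rewrite ltrBlDr -addrA ltrDl addr_gt0.
have qx i : `|x 0 i - ratr (q i)| < dl.
  by rewrite distrC ltr_distl; have := qP i; rewrite in_itv.
pose p := ((\row_i q i) : 'rV[rat]_N, k).
have cE i : ctr p 0 i = ratr (q i) by rewrite !mxE.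
exists (pickle p); rewrite /beta pickleK.
have ap : adm p.
  move=> y /(sqdist_coord _ (ltW r0)) h; apply: eW; rewrite -box_ball// => i.
  rewrite -(subrK (ctr p 0 i) (x 0 i)) -addrA; apply: le_lt_trans (ler_normD _ _) _.
  have hx := qx i; rewrite -cE in hx; have hy := h i.
  rewrite distrC in hy.
  by move: ke; rewrite -/r ltr_pdivlMr// => ke; lra.
rewrite asboolT//; apply: ball_bump_cvg.
apply: (@le_lt_trans _ _ (\sum_(i < N) dl ^+ 2)).
  apply: ler_sum => i _; rewrite -real_normK ?num_real// ler_sqr ?nnegrE ?(ltW dl0)//.
  by rewrite cE ltW.
rewrite sumr_const card_ord -mulr_natl /dl expr_div_n -/(rad p) -/r mulrCA.
rewrite gtr_pMr ?exprn_gt0// ltr_pdivrMr ?exprn_gt0// mul1r -natrX ltr_nat.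
by rewrite expnS expn1; exact: leq_pmull.
Qed.

(* a + b - a b is a smooth substitute for the maximum of a, b in [0, 1]. *)
Let bump_join n m : E -> R := iteri m (fun k f x => f x + beta k n x - f x * beta k n x) (fun=> 0).

Let bump_join_test n m : test (bump_join n m).
Proof.
elim: m => [|m IH]; first exact: test0.
rewrite /bump_join /=; under eq_fun do rewrite -mulN1r.
apply: testD; first exact: testD.
apply: testMl; first exact: smooth_cst.
by apply: testMl => //; exact: test_smooth IH.
Qed.

Let bump_join_le n m x : 0 <= bump_join n m x <= 1.
Proof.
elim: m => [|m IH]; first by rewrite lexx ler01.
have := beta_le m n x; rewrite /bump_join /= -/(bump_join n m); move: IH.
by move=> /andP[? ?] /andP[? ?]; apply/andP; split; nra.
Qed.

Let bump_join_ge n m k x : (k < m)%N -> beta k n x <= bump_join n m x.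
Proof.
elim: m => // m IH; rewrite ltnS leq_eqVlt => /predU1P[->|/IH {}IH].
  have := beta_le m n x; have := bump_join_le n m x.
  by rewrite /bump_join /= -/(bump_join n m) => /andP[? ?] /andP[? ?]; nra.
apply: le_trans IH _.
have := beta_le m n x; have := bump_join_le n m x.
by rewrite /bump_join /= -/(bump_join n m) => /andP[? ?] /andP[? ?]; nra.
Qed.

Let bump_join_off n m x : ~ U x -> Omega x -> bump_join n m x = 0.
Proof.
move=> Ux Ox; elim: m => // m IH.
by rewrite /bump_join /= -/(bump_join n m) IH beta_off// mul0r addr0 subr0.
Qed.

(** Diagonal sequence: the first [n] balls, each at sharpness [n]. At a point of [U] in [Omega] some
    fixed ball gives a lower bound that tends to 1. *)
Lemma open_indic_test : open U -> exists psi : nat -> E -> R,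
  [/\ forall n, test (psi n), forall n x, `|psi n x| <= 1 &
      forall x, Omega x -> psi ^~ x @ \oo --> (\1_U x : R)].
Proof.
move=> oU; exists (fun n => bump_join n n); split => // [n x|x Ox].
  by have /andP[T0 T1] := bump_join_le n n x; rewrite ger0_norm.
rewrite indicE; have [xU|xU] := boolP (x \in U); last first.
  rewrite (_ : (fun n => _) = fun=> 0); first exact: cvg_cst.
  by apply/funext => n; apply: bump_join_off => //; move: xU; rewrite notin_setE.
have [m bm] := beta_cvg oU (set_mem xU) Ox.
apply: (squeeze_cvgr _ bm (cvg_cst _)).
near=> n; apply/andP; split; last by have /andP[] := bump_join_le n n x.
by apply: bump_join_ge; near: n; exact: nbhs_infty_gt.
Unshelve. all: by end_near. Qed.

End approx.

(** Dominated convergence along [open_indic_test] makes the integral of [g] vanish on open sets.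
    These are stable under intersection and generate the Borel sets, so a Dynkin argument extends
    this to all measurable sets. *)
Lemma test_ae_eq0 (g : E -> R) : leb.-integrable Omega (EFin \o g) ->
  (forall phi, test phi -> \int[leb]_(x in Omega) (g x * phi x) = 0) ->
  {ae leb, forall x, Omega x -> g x = 0}.
Proof.
move=> gi gphi.
have mg : measurable_fun Omega g by apply/measurable_EFinP; exact: measurable_int gi.
have openP U : open U -> (\int[leb]_(x in U `&` Omega) (g x)%:E = 0)%E.
  move=> oU; have [psi [tpsi psi1 psiU]] := open_indic_test oU.
  have mU : measurable U by exact: open_measurable_rV.
  rewrite setIC integral_mkcondr.
  have -> : (fun x => (g x)%:E) \_ U = (fun x => (g x * \1_U x)%:E).
    by apply/funext => x; rewrite patchE indicE; case: ifPn; rewrite ?mulr1 ?mulr0.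
  have [||||| _ _ C] := @dominated_convergence _ _ _ leb Omega mO
    (fun n x => (g x * psi n x)%:E) (fun x => (g x * \1_U x)%:E) (fun x => `|g x|%:E).
  - move=> n; apply/measurable_EFinP/measurable_funM => //.
    by apply: smooth_measurable => //; exact: test_smooth.
  - by apply/measurable_EFinP/measurable_funM => //; exact: measurable_indic.
  - apply: aeW => x Ox.
    apply: cvg_EFin; first exact: nearW.
    by apply: cvgM; [exact: cvg_cst|exact: psiU].
  - exact: (@integrable_norm _ _ _ leb Omega g).
  - apply: aeW => x n Ox; rewrite lee_fin normrM ler_piMr//.
  apply: (cvg_unique _ C) => //.
  rewrite (_ : [sequence _]_n = fun=> 0%E); first exact: cvg_cst.
  apply/funext => n /=.
  rewrite -[LHS]fineK; first by congr EFin; exact: gphi.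
  apply: (integrable_fin_num mO); apply: (le_integrableR mO _ _ (integrable_norm gi)).
    by apply: measurable_funM => //; apply: smooth_measurable => //; exact: test_smooth.
  by move=> x Ox; rewrite normrM ler_piMr//.
pose P (A : set E) := (\int[leb]_(x in A `&` Omega) (g x)%:E = 0)%E.
have allP A : measurable A -> P A.
  apply: (@dynkin_induction _ _ (@open E) P) => //.
  - by move=> B C oB oC; exact: openI.
  - exact/openP/openT.
  - move=> S mS PS.
    have := openP _ openT; rewrite setTI.
    have -> : Omega = (S `&` Omega) `|` (~` S `&` Omega).
      by rewrite -setIUl setUv setTI.
    rewrite integral_setU_EFin//.
    + by rewrite PS add0e.
    + exact: measurableI.
    + by apply: measurableI => //; exact: measurableC.
    + by rewrite -setIUl setUv setTI.
    + apply/disj_setPS => x [[Sx _] [nSx _]]; exact: nSx.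
  - move=> F mF tF PF; rewrite /P setI_bigcupl integral_bigcup.
    + by apply: eseries0 => n _ _; exact: PF.
    + exact: trivIset_setIr.
    + by move=> k; exact: measurableI.
    + rewrite -setI_bigcupl; apply: integrableS gi => //.
        by apply: measurableI => //; exact: bigcup_measurable.
have := @integral_ae_eq _ _ _ leb Omega mO (cst 0%E) (EFin \o g) gi.
move=> /(_ (measurable_cst _)) H.
have {}H : ae_eq leb Omega (EFin \o g) (cst 0%E).
  apply: H => A AO mA; rewrite integral0.
  by rewrite -(setIidl AO); exact: allP.
by apply: filterS H => x + Ox => /(_ Ox) [].
Qed.

End density_of_test_functions.

(** * The Sobolev space *)

Section sobolev.
Variables (R : realType) (N : nat) (Omega : set 'rV[R]_N).
Local Notation E := 'rV[R]_N.
Local Notation leb := (lebesgue_rV R N).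
Local Notation test := (test_function Omega).
Hypotheses (oO : open Omega) (bO : bounded_set Omega).
Let mO : measurable Omega. Proof. exact: open_measurable_rV. Qed.
Let Ooo : (leb Omega < +oo)%E. Proof. exact: leb_bounded_lty. Qed.
Local Notation sqint := (sqint leb Omega).
Local Notation sqn := (sqn leb Omega).
Implicit Types (z w phi psi p q : E -> R) (G H : 'I_N -> E -> R).

(* W_0^{1,2} with the gradient G of z as a parameter in place of wgrad. *)
Definition H10 z G := [/\ sqint z, forall i, sqint (G i) &
  forall e, 0 < e -> exists phi, [/\ test phi, sqn (fun x => phi x - z x) <= e &
    forall i, sqn (fun x => partial i phi x - G i x) <= e]].

Lemma H10_sqint z G : H10 z G -> sqint z. Proof. by case. Qed.

Lemma H10_sqint_grad z G i : H10 z G -> sqint (G i). Proof. by case. Qed.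

Lemma H10_closed z G : sqint z -> (forall i, sqint (G i)) ->
  (forall e, 0 < e -> exists w H, [/\ H10 w H, sqn (fun x => w x - z x) <= e &
    forall i, sqn (fun x => H i x - G i x) <= e]) -> H10 z G.
Proof.
move=> zi Gi Hc; split=> // e e0.
have e4 : 0 < e / 4 by rewrite divr_gt0.
have [w [H [[wi Hi Hw] zw GH]]] := Hc _ e4.
have [phi [tphi phiw phiH]] := Hw _ e4.
have ti := test_sqint oO bO tphi.
have tdi i := test_sqint oO bO (test_partial i tphi).
exists phi; split=> // [|i].
  by apply: le_trans (sqn_triangle mO ti wi zi) _; lra.
apply: le_trans (sqn_triangle mO (tdi i) (Hi i) (Gi i)) _.
have := phiH i; have := GH i; lra.
Qed.

Lemma H10_test phi : test phi -> H10 phi (fun i => partial i phi).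
Proof.
move=> tphi; split=> [|i|e e0]; [exact: test_sqint|exact/test_sqint/test_partial|].
by exists phi; split=> // [|i]; rewrite sqn_subrr// ltW.
Qed.

Lemma H10_linear k z G w H : H10 z G -> H10 w H ->
  H10 (fun x => z x + k * w x) (fun i x => G i x + k * H i x).
Proof.
move=> [zi Gi Hz] [wi Hi Hw].
have sum_sqn (f g f' g' : E -> R) : sqint f -> sqint g -> sqint f' -> sqint g' ->
  sqn (fun x => (f x + k * g x) - (f' x + k * g' x)) <=
  2 * sqn (fun x => f x - f' x) + 2 * (k ^+ 2 * sqn (fun x => g x - g' x)).
  move=> fi gi fi' gi'; rewrite -sqnZ//; last exact: sqintB.
  have := sqnD_le mO (sqintB mO fi fi') (sqintZ mO k (sqintB mO gi gi')).
  by under eq_fun do rewrite mulrBr addrACA -opprD.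
split=> [|i|e e0]; first exact/sqintD/sqintZ.
  exact/sqintD/sqintZ.
have K0 : 0 <= k ^+ 2 by rewrite sqr_ge0.
have d0 : 0 < e / (2 + 2 * k ^+ 2).
  by rewrite divr_gt0// ltr_pwDl// mulr_ge0.
have dE : 2 * (e / (2 + 2 * k ^+ 2)) + 2 * (k ^+ 2 * (e / (2 + 2 * k ^+ 2))) = e.
  by field; rewrite gt_eqF// ltr_pwDl// mulr_ge0.
have [phi [tphi phiz phiG]] := Hz _ d0.
have [psi [tpsi psiw psiH]] := Hw _ d0.
have [sphi spsi] := (test_smooth tphi, test_smooth tpsi).
exists (fun x => phi x + k * psi x); split.
- by apply: testD => //; exact: testZ.
- apply: le_trans (sum_sqn _ _ _ _ _ _ _ _) _ => //; try exact: test_sqint.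
  by rewrite -[leRHS]dE; apply: lerD; rewrite ler_pM2l// ler_wpM2l.
- move=> i.
  have -> : (fun x => partial i (fun x => phi x + k * psi x) x - (G i x + k * H i x)) =
     (fun x => (partial i phi x + k * partial i psi x) - (G i x + k * H i x)).
    apply/funext => x; rewrite partialD//; last 2 first.
    - exact: smooth_differentiable.
    - exact/smooth_differentiable/smoothZ.
    rewrite partialM; last 2 first.
    - exact: differentiable_cst.
    - exact: smooth_differentiable.
    by rewrite partial_cst mulr0 addr0.
  apply: le_trans (sum_sqn _ _ _ _ _ _ _ _) _ => //; try exact/test_sqint/test_partial.
  by rewrite -[leRHS]dE; apply: lerD; rewrite ler_pM2l// ler_wpM2l.
Qed.

(* Identities linear in (z, grad z) pass from test functions to the closure. *)
Lemma H10_identity i p q : sqint p -> sqint q ->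
  (forall phi, test phi -> \int[leb]_(x in Omega) (phi x * p x) +
     \int[leb]_(x in Omega) (partial i phi x * q x) = 0) ->
  forall z G, H10 z G -> \int[leb]_(x in Omega) (z x * p x) +
     \int[leb]_(x in Omega) (G i x * q x) = 0.
Proof.
move=> pi qi Hpq z G [zi Gi Hz].
(* Subtracting the identity for a nearby test function leaves the errors of [z] and of its
   derivative, which Cauchy-Schwarz bounds in terms of [e]. *)
set d := LHS.
have : d ^+ 2 <= 0.
  apply: (@le0_small _ _ (2 * sqn p + 2 * sqn q)) => e e0.
  have [phi [tphi phiz phiG]] := Hz _ e0.
  have ti := test_sqint oO bO tphi.
  have tdi := test_sqint oO bO (test_partial i tphi).
  have dE : d = - (\int[leb]_(x in Omega) ((phi x - z x) * p x) +
     \int[leb]_(x in Omega) ((partial i phi x - G i x) * q x)).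
    have sub f g h : sqint f -> sqint g -> sqint h ->
      \int[leb]_(x in Omega) ((f x - g x) * h x) =
      \int[leb]_(x in Omega) (f x * h x) - \int[leb]_(x in Omega) (g x * h x).
      move=> fi gi hi; rewrite -RintegralB//; try exact: sqint_mul.
      by apply: eq_Rintegral => x _; rewrite mulrBl.
    rewrite !sub// addrACA Hpq// add0r -opprD opprK//.
  have A := cauchy_schwarz_Rintegral mO (sqintB mO ti zi) pi.
  have B := cauchy_schwarz_Rintegral mO (sqintB mO tdi (Gi i)) qi.
  have p0 := sqn_ge0 leb Omega p; have q0 := sqn_ge0 leb Omega q.
  have {}A := le_trans A (ler_wpM2r p0 phiz).
  have {}B := le_trans B (ler_wpM2r q0 (phiG i)).
  rewrite dE; move: A B; set a := Rintegral _ _ _; set b := Rintegral _ _ _.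
  by move=> A B; have := sqr_ge0 (a - b); nra.
by rewrite -[X in _ -> X]/(d = 0) => d0; apply/eqP; rewrite -sqrf_eq0 eq_le d0 sqr_ge0.
Qed.

Lemma H10_weak z G : H10 z G -> forall phi i, test phi ->
  \int[leb]_(x in Omega) (z x * partial i phi x) =
  - \int[leb]_(x in Omega) (G i x * phi x).
Proof.
move=> zG phi i tphi; apply/eqP; rewrite -addr_eq0; apply/eqP.
apply: (@H10_identity i _ _ _ _ _ _ _ zG).
- exact/test_sqint/test_partial.
- exact/test_sqint.
- by move=> psi tpsi; rewrite (test_ibp oO bO)// addrC subrr.
Qed.

(** Integration by parts against the coordinate [x_i], which is not a test function: the boundary
    term disappears because [x_i phi] is one for every test function [phi]. It serves to compute the
    Laplacian of the barrier. *)
Lemma H10_coord_ibp i z G : H10 z G ->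
  \int[leb]_(x in Omega) (z x) + \int[leb]_(x in Omega) (G i x * x 0 i) = 0.
Proof.
move=> zG.
have [L L0 HL] := bounded_coord bO.
have xi : sqint (fun x : E => x 0 i).
  apply: (sqint_bnd mO Ooo (M := L)) => [|x Ox]; last exact: HL.
  by apply: smooth_measurable => //; exact: smooth_coord.
rewrite -[RHS](@H10_identity i _ _ (sqint_cst mO Ooo 1) xi _ _ _ zG).
  by congr (_ + _); apply: eq_Rintegral => x _; rewrite mulr1.
move=> phi tphi.
have sphi := test_smooth tphi.
rewrite -(Rintegral_partial_test i (testMl (smooth_coord i) tphi)) -RintegralD//.
- apply: eq_Rintegral => x _; rewrite partialM.
  + by rewrite partial_coord eqxx addrC [in RHS]mulrC.
  + exact: differentiable_coord.
  + exact: smooth_differentiable.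
- exact: (sqint_mul mO (test_sqint oO bO tphi) (sqint_cst mO Ooo 1)).
- exact: (sqint_mul mO (test_sqint oO bO (test_partial i tphi)) xi).
Qed.

(** Follows from [test_poincare] by approximation; splitting off the error twice multiplies the
    constant by 4. *)
Lemma H10_poincare i : exists2 C : R, 0 < C &
  forall z G, H10 z G -> sqn z <= C * sqn (G i).
Proof.
have [L L0 HL] := bounded_coord bO.
pose C := 16 * L ^+ 2.
have C0 : 0 < C by rewrite mulr_gt0// exprn_gt0.
exists (4 * C) => [|z G [zi Gi Hz]]; first by rewrite mulr_gt0.
rewrite -subr_le0; apply: (@le0_small _ _ (2 + 4 * C)) => e e0.
have [phi [tphi phiz phiG]] := Hz _ e0.
have ti := test_sqint oO bO tphi.
have tdi := test_sqint oO bO (test_partial i tphi).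
have P := test_poincare oO bO i L0 HL tphi.
have A := sqnD_le mO (sqintB mO zi ti) ti.
have B := sqnD_le mO (sqintB mO tdi (Gi i)) (Gi i).
have {}A : sqn z <= 2 * e + 2 * sqn phi.
  move: A; under eq_fun do rewrite subrK; move=> /le_trans; apply.
  by rewrite lerD2r ler_pM2l// sqnB_sym.
have {}B : sqn (partial i phi) <= 2 * e + 2 * sqn (G i).
  move: B; under eq_fun do rewrite subrK; move=> /le_trans; apply.
  by rewrite lerD2r ler_pM2l.
rewrite -/C in P; nra.
Qed.

Lemma weak_unique (G H : 'I_N -> E -> R) i : sqint (G i) -> sqint (H i) ->
  (forall phi, test phi -> \int[leb]_(x in Omega) (G i x * phi x) =
     \int[leb]_(x in Omega) (H i x * phi x)) ->
  {ae leb, forall x, Omega x -> G i x = H i x}.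
Proof.
move=> Gi Hi GH.
have GHi := sqintB mO Gi Hi.
have := test_ae_eq0 oO (sqint_integrable1 mO Ooo GHi).
have Z phi : test phi -> \int[leb]_(x in Omega) ((G i x - H i x) * phi x) = 0.
  move=> tphi; have ti := test_sqint oO bO tphi.
  rewrite -[RHS](subrr (\int[leb]_(x in Omega) (H i x * phi x))) -{1}GH//.
  rewrite -RintegralB//; try exact: sqint_mul.
  by apply: eq_Rintegral => x _; rewrite mulrBl.
move=> /(_ Z); apply: filterS => x + Ox => /(_ Ox) /eqP.
by rewrite subr_eq0 => /eqP.
Qed.

Lemma enorm_sqr (v : E) : enorm v ^+ 2 = \sum_i v 0 i ^+ 2.
Proof. by rewrite /enorm sqr_sqrtr// sumr_ge0// => i _; rewrite sqr_ge0. Qed.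

Lemma W12_wgrad z : W12 Omega z ->
  (forall i, sqint (fun x => wgrad Omega z x 0 i)) /\
  weak_gradient Omega z (wgrad Omega z).
Proof. by move=> [_ ez]; exact: (xgetPex (cst 0) ez). Qed.

(** At a rank where the convergent integral is finite and at most [e], each single square is
    dominated by the integrand. *)
Lemma W012_H10 z : W012 Omega z -> H10 z (fun i x => wgrad Omega z x 0 i).
Proof.
move=> [Wz [phi [tphi cphi]]]; have [Lg wg] := W12_wgrad Wz.
have Lz : sqint z := Wz.1.
split=> // e e0.
have ti k := test_sqint oO bO (tphi k).
have tdi k i := test_sqint oO bO (test_partial i (tphi k)).
have [k Hk] : exists k, (\int[leb]_(x in Omega)
       ((phi k x - z x) ^+ 2 +
        enorm (gradient (phi k) x - wgrad Omega z x) ^+ 2)%:E <= e%:E)%E.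
  have /fine_cvgP[fk ck] := cphi.
  have /cvgr0Pnorm_le /(_ _ e0) He := ck.
  near \oo => k; exists k.
  have fkk : (\int[leb]_(x in Omega)
       ((phi k x - z x) ^+ 2 +
        enorm (gradient (phi k) x - wgrad Omega z x) ^+ 2)%:E)%E \is a fin_num.
    by near: k.
  rewrite -(fineK fkk) lee_fin; apply: le_trans (ler_norm _) _.
  by near: k.
have mF : measurable_fun Omega (fun x => ((phi k x - z x) ^+ 2 +
        enorm (gradient (phi k) x - wgrad Omega z x) ^+ 2)).
  apply: measurable_funD; first exact/measurable_funX/sqint_meas/sqintB.
  under eq_fun do rewrite enorm_sqr.
  apply: measurable_sum => i; under eq_fun do rewrite !mxE.
  exact: (measurable_funX 2 (sqint_meas (sqintB mO (tdi k i) (Lg i)))).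
exists (phi k); split=> // [|i].
  rewrite -lee_fin -sqnE//; last exact: sqintB.
  apply: le_trans Hk; apply: ge0_le_integral => //.
  - by move=> x _; rewrite lee_fin sqr_ge0.
  - exact/measurable_EFinP/measurable_funX/sqint_meas/sqintB.
  - exact/measurable_EFinP.
  - by move=> x _; rewrite lee_fin lerDl sqr_ge0.
rewrite -lee_fin -sqnE//; last exact: sqintB.
apply: le_trans Hk; apply: ge0_le_integral => //.
- by move=> x _; rewrite lee_fin sqr_ge0.
- apply/measurable_EFinP.
  exact: (measurable_funX 2 (sqint_meas (sqintB mO (tdi k i) (Lg i)))).
- exact/measurable_EFinP.
- move=> x _; rewrite lee_fin enorm_sqr (bigD1 i)//= !mxE addrCA lerDl.
  by rewrite addr_ge0 ?sqr_ge0// sumr_ge0// => j _; rewrite sqr_ge0.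
Unshelve. all: by end_near. Qed.

Lemma H10_W12 z G : H10 z G -> W12 Omega z.
Proof.
move=> zG; split; first exact: H10_sqint zG.
exists (fun x => \row_i G i x); split=> [i|phi i tphi].
  by under eq_fun do rewrite mxE; exact: H10_sqint_grad zG.
by rewrite (H10_weak zG)//; congr (- _); apply: eq_Rintegral => x _; rewrite mxE.
Qed.

(** [wgrad] is an arbitrary choice among the weak gradients. By [weak_unique] it agrees with any
    gradient carried along in [H10], so the energy does not depend on the choice. *)
Lemma H10_wgrad z G i : H10 z G ->
  {ae leb, forall x, Omega x -> wgrad Omega z x 0 i = G i x}.
Proof.
move=> zG; have [Lg wg] := W12_wgrad (H10_W12 zG).
apply: (@weak_unique (fun i x => wgrad Omega z x 0 i) G i (Lg i)).
  exact: H10_sqint_grad zG.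
move=> phi tphi; apply: oppr_inj.
by rewrite -(H10_weak zG)// -(wg phi i tphi).
Qed.

Lemma H10_W012 z G : H10 z G -> W012 Omega z.
Proof.
move=> zG; have Wz := H10_W12 zG; split=> //.
have [Lg wg] := W12_wgrad Wz.
have [zi Gi Hz] := zG.
have /choice[phi Hphi] : forall k : nat, exists phi, [/\ test phi,
    sqn (fun x => phi x - z x) <= k.+1%:R^-1 &
    forall i, sqn (fun x => partial i phi x - G i x) <= k.+1%:R^-1].
  by move=> k; apply: Hz; rewrite invr_gt0.
have tphi k : test (phi k) by have [] := Hphi k.
exists phi; split=> //.
have ti k := test_sqint oO bO (tphi k).
have tdi k i := test_sqint oO bO (test_partial i (tphi k)).
have U k : (\int[leb]_(x in Omega)
       ((phi k x - z x) ^+ 2 +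
        enorm (gradient (phi k) x - wgrad Omega z x) ^+ 2)%:E <=
        (N.+1%:R * k.+1%:R^-1)%:E)%E.
  have Ii i : leb.-integrable Omega (EFin \o (fun x =>
      (partial i (phi k) x - wgrad Omega z x 0 i) ^+ 2)).
    exact: (sqint_integrable (sqintB mO (tdi k i) (Lg i))).
  have I0 : leb.-integrable Omega (EFin \o (fun x => (phi k x - z x) ^+ 2)).
    exact/sqint_integrable/sqintB.
  rewrite (eq_integral (fun x => ((phi k x - z x) ^+ 2 +
     \sum_i (partial i (phi k) x - wgrad Omega z x 0 i) ^+ 2)%:E)); last first.
    move=> x _; rewrite enorm_sqr; congr (_ + _)%:E.
    by apply: eq_bigr => i _; rewrite !mxE.
  rewrite -[leLHS]fineK; last first.
    apply/(integrable_fin_num mO)/integrableDR => //.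
    exact: (integrable_sumR mO).
  rewrite lee_fin -/(Rintegral _ _ _) RintegralD//; last exact: (integrable_sumR mO).
  rewrite Rintegral_sumR//.
  have [_ U0 UG] := Hphi k.
  (* One unit for the function and one for each of the [N] derivatives. *)
  rewrite -(addn1 N) natrD mulrDl mul1r addrC; apply: lerD => //.
  rewrite mulr_natl -[X in _ *+ X](card_ord N) -sumr_const; apply: ler_sum => i _.
  apply: le_trans (UG i); rewrite le_eqVlt; apply/orP; left; apply/eqP.
  apply: (ae_eq_Rintegral mO).
  - exact: (measurable_funX 2 (sqint_meas (sqintB mO (tdi k i) (Lg i)))).
  - exact: (measurable_funX 2 (sqint_meas (sqintB mO (tdi k i) (Gi i)))).
  - by apply: filterS (H10_wgrad i zG) => x h Ox; rewrite h.
apply: (@squeeze_cvge _ _ _ _ (cst 0%E) _ (fun k => (N.+1%:R * k.+1%:R^-1)%:E)).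
- apply: nearW => k; rewrite U andbT; apply: integral_ge0 => x _.
  by rewrite lee_fin addr_ge0 ?sqr_ge0.
- exact: cvg_cst.
- apply: cvg_EFin; first exact: nearW.
  rewrite -(mulr0 N.+1%:R); apply: cvgM; first exact: cvg_cst.
  exact: cvg_harmonic.
Qed.

End sobolev.

(** * Energy minimizers and weak solutions *)

Section energy.
Variables (R : realType) (N : nat) (Omega : set 'rV[R]_N).
Local Notation E := 'rV[R]_N.
Local Notation leb := (lebesgue_rV R N).
Hypotheses (oO : open Omega) (bO : bounded_set Omega).
Let mO : measurable Omega. Proof. exact: open_measurable_rV. Qed.
Let Ooo : (leb Omega < +oo)%E. Proof. exact: leb_bounded_lty. Qed.
Local Notation sqint := (sqint leb Omega).
Local Notation sqn := (sqn leb Omega).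
Local Notation H10 := (H10 Omega).

(* A function paired with its weak gradient. *)
Definition jet := ((E -> R) * ('I_N -> E -> R))%type.
Implicit Types (p q : jet) (z w f : E -> R) (k : R).

Definition jlin k p q : jet :=
  (fun x => p.1 x + k * q.1 x, fun i x => p.2 i x + k * q.2 i x).

Variables (V : E -> \bar R) (mV : measurable_fun Omega V).
Hypothesis V0 : forall x, Omega x -> (0 <= V x)%E.

(** [fine] sends [+oo] to 0: the weight ignores the set where [V] is infinite, and the last clause
    of [ES] takes over there. *)
Definition rootV (x : E) : R := Num.sqrt (fine (V x)).

Definition wtd z (x : E) : R := rootV x * z x.

(* The integral of V z^2 is finite exactly when rootV z is square integrable and
   z vanishes where V is infinite; this trades \bar R for R. *)
Definition ES p := [/\ H10 p.1 p.2, sqint (wtd p.1) &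
  {ae leb, forall x, Omega x -> V x = +oo%E -> p.1 x = 0}].

Lemma measurable_rootV : measurable_fun Omega rootV.
Proof.
rewrite (_ : rootV = Num.sqrt \o (fine \o V))//; apply: measurableT_comp.
  by apply: continuous_measurable_fun; exact: sqrt_continuous.
exact: measurableT_comp.
Qed.

Lemma measurable_potential z : measurable_fun Omega z ->
  measurable_fun Omega (fun x => V x * (z x ^+ 2)%:E)%E.
Proof.
by move=> mz; apply: emeasurable_funM => //; exact/measurable_EFinP/measurable_funX.
Qed.

Lemma measurable_wtd z : measurable_fun Omega z -> measurable_fun Omega (wtd z).
Proof. by move=> mz; apply: measurable_funM => //; exact: measurable_rootV. Qed.

Lemma potentialE z x : Omega x -> (V x = +oo%E -> z x = 0) ->
  (V x * (z x ^+ 2)%:E)%E = (wtd z x ^+ 2)%:E.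
Proof.
move=> Ox; have := V0 Ox; rewrite /wtd /rootV; case: (V x) => [r||]// r0 zx.
  by rewrite -EFinM /= exprMn sqr_sqrtr// -lee_fin.
by rewrite zx//= expr0n mule0 mulr0 expr0n.
Qed.

Lemma potential_lty z : sqint z ->
  (\int[leb]_(x in Omega) (V x * (z x ^+ 2)%:E) < +oo)%E ->
  sqint (wtd z) /\ {ae leb, forall x, Omega x -> V x = +oo%E -> z x = 0}.
Proof.
move=> zi Voo; have mz := sqint_meas zi.
have mVz := measurable_potential mz.
have Vz0 x : Omega x -> (0 <= V x * (z x ^+ 2)%:E)%E.
  by move=> Ox; rewrite mule_ge0 ?V0// lee_fin sqr_ge0.
have Vi : leb.-integrable Omega (fun x => V x * (z x ^+ 2)%:E)%E.
  apply/integrableP; split=> //.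
  by rewrite (eq_integral (fun x => V x * (z x ^+ 2)%:E)%E)// => x /set_mem Ox;
    rewrite gee0_abs// Vz0.
have az : {ae leb, forall x, Omega x -> V x = +oo%E -> z x = 0}.
  apply: filterS (integrable_ae mO Vi) => x + Ox Vx => /(_ Ox); rewrite Vx.
  have [->//|zx] := eqVneq (z x) 0.
  by rewrite gt0_mulye ?fin_numE// lte_fin exprn_even_gt0.
split=> //; split; first exact: measurable_wtd.
rewrite (ae_eq_integral (fun x => V x * (z x ^+ 2)%:E)%E)//.
- by apply/measurable_EFinP/measurable_funX; exact: measurable_wtd.
- by apply: filterS az => x h Ox; rewrite potentialE//; exact: h.
Qed.

Lemma potential_int p : ES p ->
  (\int[leb]_(x in Omega) (V x * (p.1 x ^+ 2)%:E) = (sqn (wtd p.1))%:E)%E.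
Proof.
move=> [pH wi ap]; rewrite -sqnE//.
have mp := sqint_meas (H10_sqint pH).
apply: ae_eq_integral => //.
- exact: measurable_potential.
- by apply/measurable_EFinP/measurable_funX; exact: measurable_wtd.
- by apply: filterS ap => x h Ox; rewrite potentialE//; exact: h.
Qed.

Lemma energy_space_ES z : energy_space Omega V z ->
  ES (z, fun i x => wgrad Omega z x 0 i).
Proof.
move=> [Wz Vz]; have zH := W012_H10 oO bO Wz.
by have [? ?] := potential_lty (H10_sqint zH) Vz; split.
Qed.

Lemma ES_energy_space p : ES p -> energy_space Omega V p.1.
Proof.
move=> pE; have [pH _ _] := pE; split; first exact: H10_W012 pH.
by rewrite (potential_int pE) ltry.
Qed.

Lemma H10_jlin k p q : H10 p.1 p.2 -> H10 q.1 q.2 -> H10 (jlin k p q).1 (jlin k p q).2.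
Proof. exact: H10_linear. Qed.

Lemma wtd_jlin k p q : wtd (jlin k p q).1 = (fun x => wtd p.1 x + k * wtd q.1 x).
Proof. by apply/funext => x; rewrite /wtd /=; ring. Qed.

Lemma ES_jlin k p q : ES p -> ES q -> ES (jlin k p q).
Proof.
move=> [pH pw pV] [qH qw qV]; split; first exact: H10_jlin.
  by rewrite wtd_jlin; exact/sqintD/sqintZ.
by apply: filterS2 pV qV => x hp hq Ox Vx; rewrite /= hp// hq// mulr0 addr0.
Qed.

Definition Q p : R := \sum_i sqn (p.2 i) + sqn (wtd p.1).

(** The bilinear form of the equation, polar form of [Q]; on the diagonal both agree by
    computation. *)
Definition A p q : R := \sum_i \int[leb]_(x in Omega) (p.2 i x * q.2 i x) +
  \int[leb]_(x in Omega) (wtd p.1 x * wtd q.1 x).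

Lemma Q_ge0 p : 0 <= Q p.
Proof. by rewrite addr_ge0 ?sqn_ge0// sumr_ge0// => i _; exact: sqn_ge0. Qed.

Lemma sqn_le_Q i p : sqn (p.2 i) <= Q p.
Proof.
rewrite /Q (bigD1 i)//= -addrA lerDl addr_ge0 ?sqn_ge0// sumr_ge0// => j _.
exact: sqn_ge0.
Qed.

Lemma sqn_wtd_le_Q p : sqn (wtd p.1) <= Q p.
Proof. by rewrite /Q lerDr sumr_ge0// => j _; exact: sqn_ge0. Qed.

Lemma sqn_linear k z w : sqint z -> sqint w ->
  sqn (fun x => z x + k * w x) =
  sqn z + 2 * k * \int[leb]_(x in Omega) (z x * w x) + k ^+ 2 * sqn w.
Proof.
move=> zi wi; rewrite sqnDE//; last exact: sqintZ.
rewrite sqnZ//; congr (_ + _ + _).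
rewrite -mulrA -RintegralZl//; last exact: sqint_mul.
by congr (_ * _); apply: eq_Rintegral => x _; rewrite mulrCA.
Qed.

Lemma Q_jlin k p q : ES p -> ES q -> Q (jlin k p q) = Q p + 2 * k * A p q + k ^+ 2 * Q q.
Proof.
move=> [pH pw _] [qH qw _]; rewrite /Q wtd_jlin sqn_linear//.
rewrite (eq_bigr (fun i => sqn (p.2 i) +
  2 * k * \int[leb]_(x in Omega) (p.2 i x * q.2 i x) + k ^+ 2 * sqn (q.2 i))).
  2: by move=> i _; apply: sqn_linear; [exact: H10_sqint_grad pH|exact: H10_sqint_grad qH].
by rewrite !big_split/= -!mulr_sumr /A; ring.
Qed.

Lemma Rintegral_linear k z w f : sqint z -> sqint w -> sqint f ->
  \int[leb]_(x in Omega) ((z x + k * w x) * f x) =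
  \int[leb]_(x in Omega) (z x * f x) + k * \int[leb]_(x in Omega) (w x * f x).
Proof.
move=> zi wi fi; rewrite -RintegralZl//; last exact: sqint_mul.
rewrite -RintegralD//; last 2 first.
- exact: sqint_mul.
- exact/integrableZR/sqint_mul.
by apply: eq_Rintegral => x _; rewrite mulrDl mulrA.
Qed.

Lemma A_sym p q : A p q = A q p.
Proof.
by rewrite /A; congr (_ + _); [apply: eq_bigr => i _|];
  apply: eq_Rintegral => x _; rewrite mulrC.
Qed.

Lemma A_jlinl k p q r : ES p -> ES q -> ES r ->
  A (jlin k p q) r = A p r + k * A q r.
Proof.
move=> [pH pw _] [qH qw _] [rH rw _]; rewrite /A wtd_jlin Rintegral_linear//.
rewrite (eq_bigr (fun i => \int[leb]_(x in Omega) (p.2 i x * r.2 i x) +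
  k * \int[leb]_(x in Omega) (q.2 i x * r.2 i x))).
  2: by move=> i _; apply: Rintegral_linear;
     [exact: H10_sqint_grad pH|exact: H10_sqint_grad qH|exact: H10_sqint_grad rH].
by rewrite big_split/= -mulr_sumr; ring.
Qed.

Lemma AQ p : A p p = Q p.
Proof.
by [].
Qed.

Lemma A_cauchy_schwarz p q : ES p -> ES q -> A p q ^+ 2 <= Q p * Q q.
Proof.
move=> pE qE; apply: quadratic_ge0; first exact: Q_ge0.
by move=> t; rewrite -Q_jlin// Q_ge0.
Qed.

Section functional.
Variables (f : E -> R) (fi : sqint f).

Definition J p : R := 2^-1 * Q p - \int[leb]_(x in Omega) (p.1 x * f x).

Lemma energyE p : ES p -> energy Omega V f p.1 = (J p)%:E.
Proof.
move=> pE; have [pH pw pV] := pE.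
have pi := H10_sqint pH; have gi i := H10_sqint_grad i pH.
rewrite /energy /J EFinB; congr (_ - _)%E; last first.
  rewrite /Rintegral fineK.
    by apply: eq_integral => x _; rewrite mulrC.
  exact/(integrable_fin_num mO)/sqint_mul.
rewrite EFinM; congr (_ * _)%E.
have Wi i : sqint (fun x => wgrad Omega p.1 x 0 i).
  exact: (W12_wgrad (H10_W12 oO bO pH)).1.
have mW : measurable_fun Omega (fun x => enorm (wgrad Omega p.1 x) ^+ 2).
  under eq_fun do rewrite enorm_sqr.
  by apply: measurable_sum => i; exact: (measurable_funX 2 (sqint_meas (Wi i))).
rewrite ge0_integralD//; first last.
- exact: measurable_potential (sqint_meas pi).
- by move=> x Ox; rewrite mule_ge0 ?V0// lee_fin sqr_ge0.
- exact/measurable_EFinP.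
- by move=> x _; rewrite lee_fin sqr_ge0.
rewrite (potential_int pE) EFinD; congr (_ + _)%E.
transitivity (\int[leb]_(x in Omega) (\sum_i p.2 i x ^+ 2)%:E)%E.
  apply: ae_eq_integral => //.
  - exact/measurable_EFinP.
  - apply/measurable_EFinP/measurable_sum => i.
    exact: (measurable_funX 2 (sqint_meas (gi i))).
  - have : {ae leb, forall x, forall i, Omega x -> wgrad Omega p.1 x 0 i = p.2 i x}.
      by apply: filter_forall => i; exact: H10_wgrad.
    apply: filterS => x h Ox; rewrite enorm_sqr; congr EFin.
    by apply: eq_bigr => i _; rewrite h.
have gsi i : leb.-integrable Omega (EFin \o (fun x => p.2 i x ^+ 2)).
  exact: (sqint_integrable (gi i)).
rewrite -Rintegral_sumR// /Rintegral fineK//.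
by apply: (integrable_fin_num mO); exact: (integrable_sumR mO).
Qed.

Lemma J_jlin k p q : ES p -> ES q ->
  J (jlin k p q) = J p + k * (A p q - \int[leb]_(x in Omega) (q.1 x * f x)) +
    k ^+ 2 / 2 * Q q.
Proof.
move=> pE qE; have [pH _ _] := pE; have [qH _ _] := qE.
rewrite /J Q_jlin// Rintegral_linear//; [by field|exact: H10_sqint pH|exact: H10_sqint qH].
Qed.

(** A quantitative Euler-Lagrange equation: [J (p + t q) >= m >= J p - e] for all [t], and the
    discriminant in [t] is nonpositive. It covers minimizing sequences, and minimizers with
    [e = 0]. *)
Lemma almost_minimizer m e p q : (forall r, ES r -> m <= J r) -> ES p -> ES q ->
  J p <= m + e ->
  (A p q - \int[leb]_(x in Omega) (q.1 x * f x)) ^+ 2 <= 2 * e * Q q.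
Proof.
move=> Hm pE qE pe.
have : ((A p q - \int[leb]_(x in Omega) (q.1 x * f x)) / 2) ^+ 2 <= e * (Q q / 2).
  apply: quadratic_ge0; first by rewrite divr_ge0 ?Q_ge0.
  move=> t; have := Hm _ (ES_jlin t pE qE); rewrite J_jlin//.
  set a := _ - _; move=> H.
  have -> : e + 2 * t * (a / 2) + t ^+ 2 * (Q q / 2) = e + t * a + t ^+ 2 / 2 * Q q.
    by field.
  by lra.
rewrite expr_div_n; nra.
Qed.

Definition weak_solution p := ES p /\
  forall q, ES q -> A p q = \int[leb]_(x in Omega) (q.1 x * f x).

(** Convexity: expanding [J] at [p] in the direction [q - p], the linear term vanishes and half of
    [Q (q - p)] remains. *)
Lemma weak_solution_minimizer p : weak_solution p -> energy_minimizer Omega V f p.1.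
Proof.
move=> [pE pf]; split; first exact: ES_energy_space.
move=> w /energy_space_ES wE; rewrite (energyE pE).
set q : jet := (w, _) in wE; rewrite -[w]/(q.1) (energyE wE) lee_fin.
have dE := ES_jlin (-1) wE pE.
have -> : J q = J (jlin 1 p (jlin (-1) q p)).
  by congr J; rewrite /jlin/=; congr pair; [apply/funext => x|apply/funext => i; apply/funext => x]; rewrite mul1r mulN1r addrC subrK.
rewrite J_jlin// pf// subrr mulr0 addr0 lerDl mulr_ge0 ?Q_ge0//.
Qed.

Lemma minimizer_weak_solution z : energy_minimizer Omega V f z ->
  weak_solution (z, fun i x => wgrad Omega z x 0 i).
Proof.
move=> [zE zm]; have pE := energy_space_ES zE.
set p : jet := (z, _) in pE *; split=> // q qE.
have : forall r, ES r -> J p <= J r.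
  move=> r rE; rewrite -lee_fin -(energyE pE) -(energyE rE).
  by apply: zm; exact: ES_energy_space.
move=> Hm; have := @almost_minimizer (J p) 0 p q Hm pE qE.
rewrite addr0 lexx mulr0 mul0r => /(_ isT) H.
by apply/eqP; rewrite -subr_eq0 -sqrf_eq0 eq_le H sqr_ge0.
Qed.

(** * Existence and uniqueness of weak solutions *)

Section existence.
Variable i0 : 'I_N.

Lemma Q_poincare : exists2 C : R, 0 < C & forall p, ES p -> sqn p.1 <= C * Q p.
Proof.
have [C C0 HC] := H10_poincare oO bO i0; exists C => // p [pH _ _].
by apply: le_trans (HC _ _ pH) _; rewrite ler_pM2l// sqn_le_Q.
Qed.

Lemma weak_solution_unique p q : weak_solution p -> weak_solution q ->
  {ae leb, forall x, Omega x -> p.1 x = q.1 x}.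
Proof.
move=> [pE pf] [qE qf]; have dE := ES_jlin (-1) pE qE.
have [C C0 HC] := Q_poincare.
have Q0 : Q (jlin (-1) p q) = 0.
  by rewrite -AQ A_jlinl// pf// qf// mulN1r subrr.
have := HC _ dE; rewrite Q0 mulr0 => /(sqn_eq0 mO _).
have [dH _ _] := dE; move=> /(_ (H10_sqint dH)); apply: filterS => x + Ox.
by move=> /(_ Ox) /eqP; rewrite /= mulN1r subr_eq0 => /eqP.
Qed.

Lemma ES0 : ES (fun=> 0, fun _ _ => 0).
Proof.
split.
- have := H10_test oO bO (test0 Omega).
  rewrite /= (_ : (fun i => partial i _) = fun _ _ => 0)//.
  by apply/funext => i; exact: partial_cst.
- rewrite (_ : wtd _ = fun=> 0); first exact: sqint_cst.
  by apply/funext => x; rewrite /wtd mulr0.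
- exact: aeW.
Qed.

Lemma J_bounded : exists m, forall p, ES p -> m <= J p.
Proof.
have [C C0 HC] := Q_poincare.
exists (- (2 * C * sqn f)) => p pE; have [pH _ _] := pE.
(* Chosen so that the Poincare inequality absorbs the term in [p] into the half of [Q p] that [J]
   contains. *)
have l0 : 0 < (2 * C)^-1 by rewrite invr_gt0 mulr_gt0.
have := young_Rintegral mO l0 (H10_sqint pH) fi; rewrite invrK ler_norml => /andP[_ Y].
have Hp := HC _ pE.
have : (2 * C)^-1 * sqn p.1 <= 2^-1 * Q p.
  by rewrite invfM -mulrA ler_pM2l// ler_pdivrMl.
rewrite /J; lra.
Qed.

(** The value of [J] at the midpoint is [(J p + J q)/2 - Q (q - p)/8], and it is at least [m].
    Minimizing sequences are therefore Cauchy. *)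
Lemma J_midpoint m p q : (forall r, ES r -> m <= J r) -> ES p -> ES q ->
  Q (jlin (-1) q p) <= 4 * (J p + J q - 2 * m).
Proof.
move=> Hm pE qE; have dE := ES_jlin (-1) qE pE.
set h := jlin (-1) q p in dE *.
have qh : q = jlin 1 p h.
  rewrite /jlin /h /=; case: q {qE dE h} => a b /=; congr pair.
    by apply/funext => x; rewrite mul1r mulN1r addrC subrK.
  by apply/funext => i; apply/funext => x; rewrite mul1r mulN1r addrC subrK.
have M := Hm _ (ES_jlin 2^-1 pE dE).
have Jq : J q = J (jlin 1 p h) by rewrite {1}qh.
rewrite J_jlin// in M; rewrite J_jlin// in Jq.
rewrite Jq; move: M; set a := _ - _; move=> M; nra.
Qed.

Lemma weak_solution_exists : exists p, weak_solution p.
Proof.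
have [C C0 HC] := Q_poincare.
have [m0 Hm0] := J_bounded.
pose S := [set y | exists2 p, ES p & y = J p].
have hS : has_inf S.
  split; first by exists (J (fun=> 0, fun _ _ => 0)); exists (fun=> 0, fun _ _ => 0) => //; exact: ES0.
  by exists m0 => _ [p pE ->]; exact: Hm0.
pose m := inf S.
have Hm p : ES p -> m <= J p.
  by move=> pE; apply: ge_inf; [exact: hS.2|exists p].
(* With tolerance [4^-n / 8], [J_midpoint] gives exactly the rate [4^-k] that [fast_L2_cvg] asks
   for. *)
have /choice[u Hu] : forall n : nat, exists p, ES p /\ J p <= m + 8^-1 * 4^-1 ^+ n.
  move=> n; have e0 : 0 < 8^-1 * 4^-1 ^+ n :> R by rewrite mulr_gt0// exprn_gt0.
  by have [_ [p pE ->] /ltW Hp] := inf_adherent e0 hS; exists p.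
have uE n : ES (u n) by have [] := Hu n.
have uH n : H10 (u n).1 (u n).2 by have [] := uE n.
have qpos n : 0 < 4^-1 ^+ n :> R by rewrite exprn_gt0.
have uQ (k n : nat) : (k <= n)%N -> Q (jlin (-1) (u n) (u k)) <= 1 * 4^-1 ^+ k.
  move=> kn; apply: le_trans (J_midpoint Hm (uE k) (uE n)) _.
  have := (Hu n).2; have := (Hu k).2.
  have : 4^-1 ^+ n <= 4^-1 ^+ k :> R.
    by apply: ler_wiXn2l => //; lra.
  move=> ? ? ?; lra.
have [z [zi zae zu]] : exists z, [/\ sqint z,
    {ae leb, forall x, Omega x -> (fun n => (u n).1 x) @ \oo --> z x} &
    forall k : nat, sqn (fun x => z x - (u k).1 x) <= C * 4^-1 ^+ k].
  apply: (fast_L2_cvg mO Ooo) => [k|k n kn]; first exact: H10_sqint (uH k).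
  have := HC _ (ES_jlin (-1) (uE n) (uE k)).
  rewrite /=; under eq_fun do rewrite mulN1r.
  move=> /le_trans; apply; rewrite ler_pM2l//.
  by have := uQ _ _ kn; rewrite mul1r.
have /choice[G HG] : forall i, exists g, [/\ sqint g,
    {ae leb, forall x, Omega x -> (fun n => (u n).2 i x) @ \oo --> g x} &
    forall k : nat, sqn (fun x => g x - (u k).2 i x) <= 1 * 4^-1 ^+ k].
  move=> i; apply: (fast_L2_cvg mO Ooo) => [k|k n kn]; first exact: H10_sqint_grad (uH k).
  apply: le_trans (uQ _ _ kn); apply: le_trans (sqn_le_Q i _).
  by rewrite /=; under [in leRHS]eq_fun do rewrite mulN1r.
(* The weighted functions converge on their own; almost everywhere convergence then identifies their
   limit with [wtd z]. *)
have [Y [Yi Yae Yu]] : exists Y, [/\ sqint Y,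
    {ae leb, forall x, Omega x -> (fun n => wtd (u n).1 x) @ \oo --> Y x} &
    forall k : nat, sqn (fun x => Y x - wtd (u k).1 x) <= 1 * 4^-1 ^+ k].
  apply: (fast_L2_cvg mO Ooo) => [k|k n kn]; first by have [] := uE k.
  apply: le_trans (uQ _ _ kn); apply: le_trans (sqn_wtd_le_Q _).
  by rewrite wtd_jlin; under [in leRHS]eq_fun do rewrite mulN1r.
have YE : {ae leb, forall x, Omega x -> Y x = wtd z x}.
  apply: filterS2 zae Yae => x hz hY Ox; apply: cvg_unique (hY Ox) _ => //.
  by apply: cvgM; [exact: cvg_cst|exact: hz].
have mz := sqint_meas zi.
pose p : jet := (z, G).
have small e : 0 < e -> exists n, Num.max C 1 * 4^-1 ^+ n <= e.
  move=> e0; have h4 : `|4^-1 : R| < 1 by rewrite ger0_norm; lra.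
  have /cvgr0Pnorm_le /(_ _ e0) := cvg_geometric (Num.max C 1) h4.
  move=> [n _ /(_ n (leqnn n)) Hn]; exists n.
  exact: le_trans (ler_norm _) Hn.
have pE : ES p.
  split.
  - apply: H10_closed => // [i|e e0]; first by have [] := HG i.
    have [n Hn] := small _ e0; exists (u n).1, (u n).2; split=> // [|i].
      rewrite sqnB_sym; apply: le_trans (zu n) _; apply: le_trans Hn.
      by rewrite ler_pM2r// le_max lexx.
    rewrite sqnB_sym; have [_ _ /(_ n) GH] := HG i; apply: le_trans GH _.
    by apply: le_trans Hn; rewrite ler_pM2r// le_max lexx orbT.
  - apply: ae_eq_sqint Yi => //; exact: measurable_wtd.
  (* Countably many null sets are discarded together, after which the constraint passes to the
     pointwise limit. *)
  - have : {ae leb, forall x, forall n, Omega x -> V x = +oo%E -> (u n).1 x = 0}.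
      by apply: ae_foralln => n; have [] := uE n.
    apply: filterS2 zae => x hz h0 Ox Vx; have := hz Ox.
    rewrite (_ : (fun n => _) = fun=> 0); last by apply/funext => n; exact: h0.
    by move=> /(cvg_unique _); apply => //; exact: cvg_cst.
have pu n : Q (jlin (-1) p (u n)) <= N.+1%:R * 4^-1 ^+ n.
  rewrite -(addn1 N) natrD mulrDl mul1r; apply: lerD.
    rewrite mulr_natl -[X in _ *+ X](card_ord N) -sumr_const; apply: ler_sum => i _.
    have [_ _ /(_ n)] := HG i; rewrite mul1r /=.
    by under [X in _ -> _ X <= _]eq_fun do rewrite mulN1r.
  rewrite wtd_jlin; have := Yu n; rewrite mul1r; apply: le_trans.
  rewrite le_eqVlt; apply/orP; left; apply/eqP; apply: (ae_eq_Rintegral mO).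
  - apply: measurable_funX; apply: measurable_funD; first exact: measurable_wtd.
    by apply: measurable_funM => //; exact: measurable_wtd (sqint_meas (H10_sqint (uH n))).
  - apply: measurable_funX; apply: measurable_funB; first exact: sqint_meas Yi.
    exact: measurable_wtd (sqint_meas (H10_sqint (uH n))).
  - by apply: filterS YE => x h Ox; rewrite h// mulN1r.
exists p; split=> // q qE.
set d := RHS; suff : (A p q - d) ^+ 2 <= 0.
  by move=> d0; apply/eqP; rewrite -subr_eq0 -sqrf_eq0 eq_le d0 sqr_ge0.
(* The defect of [p] is split at [u n]: Cauchy-Schwarz bounds [A p q - A (u n) q], and
   [almost_minimizer] bounds the defect of [u n]. *)
apply: (@le0_small _ _ ((2^-1 + 2 * N.+1%:R) * Q q)) => e e0.
have [n Hn] := small _ e0.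
have {}Hn : 4^-1 ^+ n <= e.
  by apply: le_trans Hn; rewrite ler_peMl ?(ltW (qpos n))// le_max lexx orbT.
have B := almost_minimizer Hm (uE n) qE (Hu n).2; rewrite -/d in B.
have D := A_cauchy_schwarz (ES_jlin (-1) pE (uE n)) qE.
rewrite A_jlinl// mulN1r in D.
have {}D := le_trans D (ler_wpM2r (Q_ge0 q) (pu n)).
have q0 := Q_ge0 q; have N0 : 0 <= N.+1%:R :> R by [].
have B' : 2 * (8^-1 * 4^-1 ^+ n) * Q q <= 4^-1 * e * Q q.
  by apply: ler_wpM2r => //; lra.
have D' : N.+1%:R * 4^-1 ^+ n * Q q <= N.+1%:R * e * Q q.
  by apply: ler_wpM2r => //; exact: ler_wpM2l.
move: (le_trans B B') (le_trans D D').
set a := A p q; set b := A (u n) q; move=> BB DD.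
have := sqr_ge0 ((a - b) - (b - d)).
nra.
Qed.

End existence.

End functional.

End energy.

(** * Truncation by a smooth positive part *)

Section small_factor.
Context d (T : measurableType d) (R : realType).
Variables (mu : {measure set T -> \bar R}) (D : set T) (mD : measurable D).
Implicit Types (f g h : T -> R).

Lemma sqn_truncation f e : sqint mu D f -> 0 < e ->
  exists2 M, 0 < M & sqn mu D (fun x => Num.max (`|f x| - M) 0) <= e.
Proof.
move=> fi e0; have mf := sqint_meas fi.
pose F n x := Num.max (`|f x| - n.+1%:R) 0.
have mF n : measurable_fun D (F n).
  apply: measurable_maxr => //; apply: measurable_funB => //.
  exact: measurableT_comp.
have F0 n x : 0 <= F n x by rewrite le_max lexx orbT.
have Ff n x : F n x <= `|f x|.
  by rewrite ge_max normr_ge0 gerBl ler0n.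
have [||||| _ _ C] := @dominated_convergence _ _ _ mu D mD
    (fun n x => (F n x ^+ 2)%:E) (cst 0%E) (fun x => (f x ^+ 2)%:E).
- by move=> n; apply/measurable_EFinP/measurable_funX.
- exact: measurable_cst.
- apply: aeW => x Dx; apply: cvg_near_cst.
  exists (Num.truncn `|f x|) => // n /= nx.
  suff -> : F n x = 0 by rewrite expr0n.
  apply/max_idPr; rewrite subr_le0; apply: le_trans (ltW (truncnS_gt _)) _.
  by rewrite ler_nat.
- exact: sqint_integrable.
- apply: aeW => x n Dx; rewrite lee_fin ger0_norm ?sqr_ge0//.
  by rewrite -[leRHS]real_normK ?num_real// ler_sqr ?nnegrE.
move: C; rewrite integral0 => /fine_cvgP[_ /cvgr0Pnorm_le /(_ _ e0)].
move=> [n _ /(_ n (leqnn n)) Hn]; exists n.+1%:R => //.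
exact: le_trans (ler_norm _) Hn.
Qed.

(** A uniform form of dominated convergence: with [|f| <= (|f| - M)^+ + M], the product is at most
    [(|f| - M)^+ + M c |h|]. First [M] is chosen, then the smallness of [h]. *)
Lemma sqn_small_factor (c : R) f e : 0 < c -> sqint mu D f -> 0 < e ->
  exists2 dl, 0 < dl & forall g h, measurable_fun D g ->
    (forall x, D x -> `|g x| <= 1) -> sqint mu D h ->
    (forall x, D x -> `|g x| <= c * `|h x|) ->
    sqn mu D h <= dl -> sqn mu D (fun x => g x * f x) <= e.
Proof.
move=> c0 fi e0; have mf := sqint_meas fi.
have e4 : 0 < e / 4 by rewrite divr_gt0.
have [M M0 HM] := sqn_truncation fi e4.
have Mc0 : 0 < M * c by rewrite mulr_gt0.
exists (e / 4 / (M * c) ^+ 2) => [|g h mg g1 hi gh hs].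
  by rewrite divr_gt0// exprn_gt0.
set F := (fun x => _) in HM.
have F0 x : 0 <= F x by rewrite /F le_max lexx orbT.
have Fi : sqint mu D F.
  apply: (sqint_le mD _ _ fi).
    by apply: measurable_maxr => //; apply: measurable_funB => //; exact: measurableT_comp.
  by move=> x _; rewrite ger0_norm /F ?le_max ?lexx ?orbT// ge_max normr_ge0 gerBl ltW.
have hMi : sqint mu D (fun x => (M * c) * `|h x|).
  apply: sqintZ => //; apply: (sqint_le mD _ _ hi) => [|x _]; last by rewrite normr_id.
  by apply: (measurableT_comp _ (sqint_meas hi)).
have S := sqnD_le mD Fi hMi.
apply: (@le_trans _ _ (sqn mu D (fun x => F x + M * c * `|h x|))).
  apply: le_sqn; [exact: mD|exact: measurable_funM| |exact: sqintD].
  move=> x Dx; rewrite normrM [leRHS]ger0_norm; last first.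
    by rewrite addr_ge0 ?F0// mulr_ge0// ltW.
  have fM : `|f x| <= F x + M by rewrite -lerBlDr le_max lexx.
  have gx := g1 x Dx; have ghx := gh x Dx.
  apply: (@le_trans _ _ (`|g x| * (F x + M))); first by rewrite ler_wpM2l.
  rewrite mulrDr; apply: lerD; first by rewrite ler_piMl// F0.
  by rewrite mulrC -mulrA ler_pM2l.
apply: le_trans S _.
have -> : sqn mu D (fun x => M * c * `|h x|) = (M * c) ^+ 2 * sqn mu D h.
  rewrite -sqnZ//; apply: eq_Rintegral => x _.
  by rewrite !exprMn real_normK ?num_real.
have : (M * c) ^+ 2 * sqn mu D h <= e / 4.
  by rewrite mulrC -ler_pdivlMr// exprn_gt0.
lra.
Qed.

End small_factor.

(** * Inequalities for the smooth positive part *)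

Section smooth_positive_part.
Variables (R : realType) (e : R) (e0 : 0 < e).
Implicit Types s t a b : R.

(** A smooth substitute for [|a|], above it by at most [e]; its derivative is [a / hyp a]. *)
Definition hyp a : R := Num.sqrt (a ^+ 2 + e ^+ 2).

Lemma hyp_gt0 a : 0 < hyp a.
Proof. by rewrite sqrtr_gt0 ltr_wpDl ?sqr_ge0// exprn_gt0. Qed.

Lemma hyp_sqr a : hyp a ^+ 2 = a ^+ 2 + e ^+ 2.
Proof. by rewrite sqr_sqrtr// addr_ge0// sqr_ge0. Qed.

Lemma hyp_ge_norm a : `|a| <= hyp a.
Proof.
rewrite -ler_sqr ?nnegrE ?(ltW (hyp_gt0 a))// hyp_sqr real_normK ?num_real//.
by rewrite lerDl sqr_ge0.
Qed.

Lemma hyp_ge a : e <= hyp a.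
Proof.
rewrite -ler_sqr ?nnegrE ?(ltW (hyp_gt0 a)) ?(ltW e0)// hyp_sqr.
by rewrite lerDr sqr_ge0.
Qed.

Lemma hyp_le a : hyp a <= `|a| + e.
Proof.
rewrite -ler_sqr ?nnegrE ?(ltW (hyp_gt0 a)) ?addr_ge0 ?(ltW e0)//.
rewrite hyp_sqr -[X in X + _ <= _]real_normK ?num_real//.
by have : 0 <= `|a| * e; [rewrite mulr_ge0 ?(ltW e0)|nra].
Qed.

Lemma hyp_lipschitz a b : `|hyp a - hyp b| <= `|a - b|.
Proof.
have h0 : 0 < hyp a + hyp b by rewrite addr_gt0 ?hyp_gt0.
rewrite -(ler_pM2r h0) -{1}(gtr0_norm h0) -normrM.
have -> : (hyp a - hyp b) * (hyp a + hyp b) = (a - b) * (a + b).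
  by rewrite -!subr_sqr !hyp_sqr; ring.
rewrite normrM ler_wpM2l// (le_trans (ler_normD _ _))// lerD ?hyp_ge_norm//.
Qed.

Lemma hyp_slope_lipschitz a b : `|a / hyp a - b / hyp b| <= 2 / e * `|a - b|.
Proof.
have [ha hb] := (hyp_gt0 a, hyp_gt0 b).
have -> : a / hyp a - b / hyp b =
    (a - b) / hyp a + (b / hyp b) * ((hyp b - hyp a) / hyp a).
  by field; rewrite !gt_eqF.
have ia : (hyp a)^-1 <= e^-1 by rewrite lef_pV2 ?posrE// hyp_ge.
have ia0 : 0 <= (hyp a)^-1 by rewrite invr_ge0 ltW.
apply: le_trans (ler_normD _ _) _.
have -> : 2 / e * `|a - b| = `|a - b| / e + 1 * (`|a - b| / e) by ring.
apply: lerD.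
  by rewrite normrM [X in _ * X]ger0_norm// ler_wpM2l.
rewrite normrM ler_pM//.
  by rewrite normrM normfV (gtr0_norm hb) ler_pdivrMr// mul1r hyp_ge_norm.
rewrite normrM [X in _ * X]ger0_norm// ler_pM// distrC.
exact: hyp_lipschitz.
Qed.

(* A smooth approximation of the positive part of s - t, vanishing at s = 0. *)
Definition spos s t : R := 2^-1 * (s + hyp (s - t) - hyp t).

(* Its derivative in s, and the sum of its derivatives in s and t. *)
Definition spos_s s t : R := 2^-1 * (1 + (s - t) / hyp (s - t)).
Definition spos_st t : R := 2^-1 * (1 - t / hyp t).

Lemma spos0 t : spos 0 t = 0.
Proof. by rewrite /spos sub0r /hyp sqrrN add0r subrr mulr0. Qed.

Lemma spos_norm_le s t : `|spos s t| <= `|s|.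
Proof.
have := hyp_lipschitz (s - t) (- t); rewrite opprK subrK.
have -> : hyp (- t) = hyp t by rewrite /hyp sqrrN.
rewrite /spos normrM ger0_norm ?invr_ge0// -addrA => h.
have := ler_normD s (hyp (s - t) - hyp t); lra.
Qed.

Lemma spos_lipschitz s s' t : `|spos s t - spos s' t| <= `|s - s'|.
Proof.
have := hyp_lipschitz (s - t) (s' - t).
rewrite opprB addrA subrK => h.
have -> : spos s t - spos s' t = 2^-1 * ((s - s') + (hyp (s - t) - hyp (s' - t))).
  by rewrite /spos; ring.
rewrite normrM ger0_norm ?invr_ge0//.
have := ler_normD (s - s') (hyp (s - t) - hyp (s' - t)); lra.
Qed.

(** The term [hyp (s - t) - hyp t] is at most [|s|] in size, so [spos s t] has the sign of [s]. This
    makes the potential term nonnegative in the comparison test. *)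
Lemma spos_mul_ge0 s t : 0 <= s * spos s t.
Proof.
have := hyp_lipschitz (s - t) (- t); rewrite opprK subrK.
have -> : hyp (- t) = hyp t by rewrite /hyp sqrrN.
rewrite /spos -addrA; set h := hyp _ - _; rewrite ler_norml => /andP[h1 h2].
have [s0|s0] := leP 0 s.
  by move: h1 h2; rewrite ger0_norm// => h1 h2; rewrite mulr_ge0// mulr_ge0 ?invr_ge0//; lra.
move: h1 h2; rewrite ltr0_norm// => h1 h2.
by rewrite mulr_le0 ?(ltW s0)// mulr_ge0_le0 ?invr_ge0//; lra.
Qed.

Lemma spos_s_bounds s t : 0 <= spos_s s t <= 1.
Proof.
have := hyp_ge_norm (s - t); rewrite ler_norml => /andP[h1 h2].
have h0 := hyp_gt0 (s - t).
have : -1 <= (s - t) / hyp (s - t) <= 1.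
  by rewrite ler_pdivlMr// mulN1r h1 ler_pdivrMr// mul1r.
by rewrite /spos_s => /andP[? ?]; apply/andP; split; lra.
Qed.

Lemma spos_s_lipschitz s s' t : `|spos_s s t - spos_s s' t| <= e^-1 * `|s - s'|.
Proof.
have := hyp_slope_lipschitz (s - t) (s' - t).
have -> : s - t - (s' - t) = s - s' by ring.
move=> h; have -> : spos_s s t - spos_s s' t =
    2^-1 * ((s - t) / hyp (s - t) - (s' - t) / hyp (s' - t)).
  by rewrite /spos_s; ring.
rewrite normrM ger0_norm ?invr_ge0// -(ler_pM2l (ltr0n R 2)) mulrA divff ?pnatr_eq0// mul1r.
by rewrite mulrA.
Qed.

Lemma spos_ge s t : 0 <= t -> - e <= spos s t.
Proof.
move=> t0; have := hyp_ge_norm (s - t); rewrite ler_norml => /andP[h1 h2].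
have := hyp_le t; rewrite ger0_norm// /spos; have := e0; lra.
Qed.

Lemma spos_approx s t : 0 <= t -> `|Num.max (s - t) 0 - spos s t| <= e.
Proof.
move=> t0; have := hyp_ge_norm (s - t); have := hyp_le (s - t).
have := hyp_le t; have := hyp_ge_norm t; rewrite ger0_norm// /spos.
have := e0; have [st|st] := leP (s - t) 0.
  by rewrite ler0_norm// => *; rewrite ler_norml; apply/andP; split; lra.
by rewrite gtr0_norm// => *; rewrite ler_norml; apply/andP; split; lra.
Qed.

(** [hyp t] times [spos_st t] is [(hyp t - t)/2], at most [e/2]. Where [t] is bounded below, the
    error due to a moving threshold is of order [e]. *)
Lemma spos_st_bounds t : 0 <= t -> 0 <= spos_st t /\ t * spos_st t <= e.
Proof.
move=> t0; have h0 := hyp_gt0 t.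
have := hyp_ge_norm t; have := hyp_le t; rewrite ger0_norm// => h1 h2.
have E : hyp t * spos_st t = 2^-1 * (hyp t - t) by rewrite /spos_st; field; rewrite gt_eqF.
have k0 : 0 <= spos_st t.
  by rewrite -(pmulr_rge0 _ h0) E mulr_ge0 ?invr_ge0// subr_ge0.
split=> //; apply: (@le_trans _ _ (hyp t * spos_st t)); first by rewrite ler_wpM2r.
by rewrite E; have := e0; lra.
Qed.

End smooth_positive_part.

Section truncation.
Variables (R : realType) (N : nat) (Omega : set 'rV[R]_N).
Local Notation E := 'rV[R]_N.
Local Notation leb := (lebesgue_rV R N).
Local Notation test := (test_function Omega).
Hypotheses (oO : open Omega) (bO : bounded_set Omega).
Let mO : measurable Omega. Proof. exact: open_measurable_rV. Qed.
Let Ooo : (leb Omega < +oo)%E. Proof. exact: leb_bounded_lty. Qed.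
Local Notation sqint := (sqint leb Omega).
Local Notation sqn := (sqn leb Omega).
Local Notation H10 := (H10 Omega).
Variables (e : R) (e0 : 0 < e) (phi : E -> R) (sphi : smooth phi).
Hypotheses (phi_ge0 : forall x, Omega x -> 0 <= phi x).
Hypotheses (phi_bnd : forall i, exists M : R, forall x, Omega x -> `|partial i phi x| <= M).
Implicit Types (z w psi : E -> R) (G : 'I_N -> E -> R).

Lemma smooth_hyp w : smooth w -> smooth (fun x => hyp e (w x)).
Proof.
move=> sw; apply: smooth_sqrt => [x|].
  by rewrite ltr_wpDl ?sqr_ge0// exprn_gt0.
by apply: smoothD; [exact: smooth_sqr|exact: smooth_cst].
Qed.

Lemma partial_hyp i w x : smooth w ->
  partial i (fun x => hyp e (w x)) x = w x / hyp e (w x) * partial i w x.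
Proof.
move=> sw; have w0 : 0 < w x ^+ 2 + e ^+ 2.
  by rewrite ltr_wpDl ?sqr_ge0// exprn_gt0.
have sw2 : smooth (fun x => w x ^+ 2 + e ^+ 2).
  by apply: smoothD; [exact: smooth_sqr|exact: smooth_cst].
have := (partial_comp i (is_derive1_sqrt w0) (smooth_differentiable x sw2)).2.
have -> : partial i (fun x => w x ^+ 2 + e ^+ 2) x = 2 * (w x * partial i w x).
  rewrite partialD; last 2 first.
  - exact/smooth_differentiable/smooth_sqr.
  - exact: differentiable_cst.
  rewrite partial_cst addr0 (_ : (fun x => w x ^+ 2) = (fun x => w x * w x))//.
  by rewrite partialM; [ring|exact: smooth_differentiable|exact: smooth_differentiable].
rewrite -/(hyp e (w x)) => ->.
have := hyp_gt0 e0 (w x); move: (hyp e (w x)) => h h0.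
by field; rewrite gt_eqF.
Qed.

Lemma measurable_hyp w : measurable_fun Omega w ->
  measurable_fun Omega (fun x => hyp e (w x)).
Proof.
move=> mw; rewrite (_ : (fun x => _) = Num.sqrt \o (fun x => w x ^+ 2 + e ^+ 2))//.
apply: measurableT_comp.
  by apply: continuous_measurable_fun; exact: sqrt_continuous.
by apply: measurable_funD => //; exact: measurable_funX.
Qed.

Lemma hyp_continuous : continuous (hyp e).
Proof.
rewrite (_ : hyp e = Num.sqrt \o (fun a => a ^+ 2 + e ^+ 2))// => a.
apply: continuous_comp; last exact: sqrt_continuous.
by apply: cvgD; [exact: exprn_continuous|exact: cvg_cst].
Qed.

Lemma measurable_inv_hyp w : measurable_fun Omega w ->
  measurable_fun Omega (fun x => (hyp e (w x))^-1).
Proof.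
move=> mw; rewrite (_ : (fun x => _) = (fun a => (hyp e a)^-1) \o w)//.
apply: measurableT_comp => //; apply: continuous_measurable_fun => a.
apply: cvgV; first by rewrite gt_eqF ?hyp_gt0.
exact: hyp_continuous.
Qed.

Definition trunc z : E -> R := fun x => spos e (z x) (phi x).

(** The chain rule, grouped around [G - grad phi] so that the energy of the difference shows up in
    the test. *)
Definition trunc_grad z G : 'I_N -> E -> R := fun i x =>
  spos_s e (z x) (phi x) * (G i x - partial i phi x) +
  spos_st e (phi x) * partial i phi x.

Let mphi : measurable_fun Omega phi. Proof. exact: smooth_measurable. Qed.
Let mdphi i : measurable_fun Omega (partial i phi).
Proof. by apply: smooth_measurable => //; exact: smooth_partial. Qed.

Let dphi_sqint i : sqint (partial i phi).
Proof. by have [M HM] := phi_bnd i; exact: (sqint_bnd mO Ooo _ HM). Qed.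

Lemma measurable_trunc z : measurable_fun Omega z -> measurable_fun Omega (trunc z).
Proof.
move=> mz; apply: measurable_funM => //; apply: measurable_funB.
  by apply: measurable_funD => //; apply: measurable_hyp; exact: measurable_funB.
exact: measurable_hyp.
Qed.

Lemma measurable_spos_s z : measurable_fun Omega z ->
  measurable_fun Omega (fun x => spos_s e (z x) (phi x)).
Proof.
move=> mz; apply: measurable_funM => //; apply: measurable_funD => //.
have md : measurable_fun Omega (fun x => z x - phi x) by exact: measurable_funB.
by apply: measurable_funM => //; exact: measurable_inv_hyp.
Qed.

Lemma measurable_spos_st : measurable_fun Omega (fun x => spos_st e (phi x)).
Proof.
apply: measurable_funM => //; apply: measurable_funB => //.
by apply: measurable_funM => //; exact: measurable_inv_hyp.
Qed.

Lemma trunc_test psi : test psi -> test (trunc psi) /\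
  forall i x, partial i (trunc psi) x = trunc_grad psi (fun i => partial i psi) i x.
Proof.
move=> tpsi; have [spsi [K [cK KO K0]]] := tpsi.
have sd : smooth (fun x => psi x - phi x) by exact: smoothB.
have s1 := smooth_hyp sd; have s2 := smooth_hyp sphi.
have s12 : smooth (fun x => psi x + hyp e (psi x - phi x) - hyp e (phi x)).
  by apply: smoothB => //; exact: smoothD.
split.
  split; first exact: smoothZ.
  by exists K; split=> // x Kx; rewrite /trunc K0// spos0.
have partialB (u w : E -> R) i x : smooth u -> smooth w ->
    partial i (fun x => u x - w x) x = partial i u x - partial i w x.
  move=> su sw; apply: deriveB; apply: diff_derivable; exact: smooth_differentiable.
move=> i x; rewrite /trunc /spos partialM; last 2 first.
- exact: differentiable_cst.
- exact: smooth_differentiable.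
rewrite partial_cst mulr0 addr0 partialB//; last exact: smoothD.
rewrite partialD; last 2 first.
- exact: smooth_differentiable.
- exact: smooth_differentiable.
rewrite (partial_hyp i x sd) (partial_hyp i x sphi) partialB//.
by rewrite /trunc_grad /spos_s /spos_st; ring.
Qed.

Lemma trunc_sqint z : sqint z -> sqint (trunc z).
Proof.
move=> zi; apply: (sqint_le mO _ _ zi); first exact: measurable_trunc (sqint_meas zi).
by move=> x _; exact: spos_norm_le.
Qed.

Lemma spos_s_mul_sqint z w : measurable_fun Omega z -> sqint w ->
  sqint (fun x => spos_s e (z x) (phi x) * w x).
Proof.
move=> mz wi; apply: (sqint_le mO _ _ wi).
  by apply: measurable_funM; [exact: measurable_spos_s|exact: sqint_meas wi].
move=> x _; rewrite normrM ler_piMl//.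
by have /andP[? ?] := spos_s_bounds e0 (z x) (phi x); rewrite ger0_norm.
Qed.

Lemma spos_st_mul_sqint w : sqint w -> sqint (fun x => spos_st e (phi x) * w x).
Proof.
move=> wi; apply: (sqint_le mO _ _ wi).
  by apply: measurable_funM; [exact: measurable_spos_st|exact: sqint_meas wi].
move=> x Ox; rewrite normrM ler_piMl//.
have [k0 _] := spos_st_bounds e0 (phi_ge0 Ox); rewrite ger0_norm//.
have : 0 <= phi x / hyp e (phi x).
  by rewrite divr_ge0 ?phi_ge0// ltW// hyp_gt0.
by rewrite /spos_st; lra.
Qed.

Lemma trunc_grad_sqint z G i : sqint z -> sqint (G i) -> sqint (trunc_grad z G i).
Proof.
move=> zi Gi; apply: sqintD => //; last exact: spos_st_mul_sqint.
by apply: spos_s_mul_sqint; [exact: sqint_meas zi|exact: sqintB].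
Qed.

(** Truncating test functions close to [z] gives test functions. In the gradient, the factor
    [spos_s] converges only with [z], while [K] is fixed and possibly unbounded: this product is the
    case of [sqn_small_factor]. *)
Lemma H10_trunc z G : H10 z G -> H10 (trunc z) (trunc_grad z G).
Proof.
move=> [zi Gi Hz]; split=> [|i|dl dl0]; first exact: trunc_sqint.
  exact: trunc_grad_sqint.
have dl4 : 0 < dl / 4 by rewrite divr_gt0.
pose K i x := G i x - partial i phi x.
have Ki i : sqint (K i) by exact: sqintB.
have ie0 : 0 < e^-1 by rewrite invr_gt0.
have /choice[m Hm] : forall i, exists m : R, 0 < m /\ forall g h : E -> R, measurable_fun Omega g ->
    (forall x, Omega x -> `|g x| <= 1) -> sqint h ->
    (forall x, Omega x -> `|g x| <= e^-1 * `|h x|) ->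
    sqn h <= m -> sqn (fun x => g x * K i x) <= dl / 4.
  by move=> i; have [m m0 Hm] := sqn_small_factor mO ie0 (Ki i) dl4; exists m.
(* One radius for all coordinates, the minimum of finitely many. *)
have [r r0 Hr] : exists2 r, 0 < r & r <= dl / 4 /\ forall i, r <= m i.
  exists (\big[Num.min/(dl / 4)]_i m i).
    by apply: lt_bigmin => // i _; exact: (Hm i).1.
  by split=> [|i]; [exact: bigmin_le_id|exact: bigmin_le_cond].
have [psi [tpsi psiz psiG]] := Hz _ r0.
have [tt dt] := trunc_test tpsi.
have ti := test_sqint oO bO tpsi.
have tdi i := test_sqint oO bO (test_partial i tpsi).
exists (trunc psi); split=> // [|i].
  apply: (@le_trans _ _ (sqn (fun x => psi x - z x))).
    apply: le_sqn => //; last exact: sqintB.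
      by apply: measurable_funB; apply: measurable_trunc; [exact: sqint_meas ti|exact: sqint_meas zi].
    by move=> x _; exact: spos_lipschitz.
  by apply: le_trans psiz _; apply: le_trans Hr.1 _; rewrite ler_pdivrMr// ler_peMr// ?ltW//; lra.
have -> : (fun x => partial i (trunc psi) x - trunc_grad z G i x) =
  (fun x => spos_s e (psi x) (phi x) * (partial i psi x - G i x) +
     (spos_s e (psi x) (phi x) - spos_s e (z x) (phi x)) * K i x).
  by apply/funext => x; rewrite dt /trunc_grad /K; ring.
have A : sqint (fun x => spos_s e (psi x) (phi x) * (partial i psi x - G i x)).
  by apply: spos_s_mul_sqint; [exact: sqint_meas ti|exact: sqintB].
have B : sqint (fun x => (spos_s e (psi x) (phi x) - spos_s e (z x) (phi x)) * K i x).
  have := sqintB mO (spos_s_mul_sqint (sqint_meas ti) (Ki i))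
    (spos_s_mul_sqint (sqint_meas zi) (Ki i)).
  by under eq_fun do rewrite -mulrBl.
apply: le_trans (sqnD_le mO A B) _.
have A' : sqn (fun x => spos_s e (psi x) (phi x) * (partial i psi x - G i x)) <= dl / 4.
  apply: le_trans Hr.1; apply: le_trans (psiG i); apply: le_sqn => //.
  - exact: sqint_meas A.
  - move=> x _; rewrite normrM ler_piMl//.
    by have /andP[? ?] := spos_s_bounds e0 (psi x) (phi x); rewrite ger0_norm.
  - exact: sqintB.
have B' : sqn (fun x => (spos_s e (psi x) (phi x) - spos_s e (z x) (phi x)) * K i x) <= dl / 4.
  apply: (Hm i).2 (le_trans psiz (Hr.2 i)).
  - by apply: measurable_funB; apply: measurable_spos_s; [exact: sqint_meas ti|exact: sqint_meas zi].
  - move=> x _; have /andP[? ?] := spos_s_bounds e0 (psi x) (phi x).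
    have /andP[? ?] := spos_s_bounds e0 (z x) (phi x).
    by rewrite ler_norml; apply/andP; split; lra.
  - exact: sqintB.
  - by move=> x _; exact: spos_s_lipschitz.
lra.
Qed.

End truncation.

(** * Comparison with a barrier *)

Section bounds.
Variables (R : realType) (N : nat) (Omega : set 'rV[R]_N).
Local Notation E := 'rV[R]_N.
Local Notation leb := (lebesgue_rV R N).
Hypotheses (oO : open Omega) (bO : bounded_set Omega).
Let mO : measurable Omega. Proof. exact: open_measurable_rV. Qed.
Let Ooo : (leb Omega < +oo)%E. Proof. exact: leb_bounded_lty. Qed.
Local Notation sqint := (sqint leb Omega).
Local Notation sqn := (sqn leb Omega).
Variables (i0 : 'I_N) (L : R) (L0 : 0 < L).
Hypothesis HL : forall x, Omega x -> forall j, `|x 0 j| <= L.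
Variables (V : E -> \bar R) (mV : measurable_fun Omega V).
Implicit Types (p : jet R N) (f : E -> R).

(* - Delta (barrier c) = 2 c *)
Definition barrier (c : R) : E -> R := fun x => c * (L ^+ 2 + 1 - x 0 i0 ^+ 2).

Lemma smooth_barrier c : smooth (barrier c).
Proof.
apply: smoothZ; apply: smoothB; first exact: smooth_cst.
by apply: smooth_sqr; exact: smooth_coord.
Qed.

Lemma partial_barrier c j x :
  partial j (barrier c) x = - (2 * c * x 0 i0 * (j == i0)%:R).
Proof.
have sc := @smooth_coord R N i0.
rewrite /barrier partialM; last 2 first.
- exact: differentiable_cst.
- apply: smooth_differentiable; apply: smoothB; first exact: smooth_cst.
  exact: smooth_sqr.
rewrite partial_cst mulr0 addr0.
have -> : partial j (fun x => L ^+ 2 + 1 - x 0 i0 ^+ 2) x = - (2 * (x 0 i0 * (j == i0)%:R)).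
  rewrite [LHS](@deriveB _ _ _ (fun=> L ^+ 2 + 1) (fun x : E => x 0 i0 ^+ 2)).
  - rewrite [X in X - _]derive_cst sub0r; congr (- _).
    rewrite [LHS](@partialM _ _ (fun x : E => x 0 i0) (fun x : E => x 0 i0)).
    + by rewrite partial_coord; ring.
    + exact: differentiable_coord.
    + exact: differentiable_coord.
  - by apply: diff_derivable; exact: differentiable_cst.
  - apply: diff_derivable; apply: smooth_differentiable; exact: smooth_sqr.
by ring.
Qed.

Lemma coord_sqr_le x : Omega x -> x 0 i0 ^+ 2 <= L ^+ 2.
Proof.
move=> Ox; rewrite -[leLHS]real_normK ?num_real// ler_sqr ?nnegrE ?(ltW L0)//.
exact: HL.
Qed.

(** The [+ 1] in the barrier provides this lower bound, which keeps the threshold away from 0 in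
    [kappa_bnd]. *)
Lemma barrier_ge c x : 0 <= c -> Omega x -> c <= barrier c x.
Proof.
by move=> c0 /coord_sqr_le Ox; rewrite /barrier ler_peMr//; lra.
Qed.

Lemma barrier_le c x : 0 <= c -> barrier c x <= c * (L ^+ 2 + 1).
Proof. by move=> c0; rewrite /barrier ler_wpM2l//; have := sqr_ge0 (x 0 i0); lra. Qed.

Lemma partial_barrier_bnd c j : 0 <= c ->
  exists M : R, forall x, Omega x -> `|partial j (barrier c) x| <= M.
Proof.
move=> c0; exists (2 * c * L) => x Ox; rewrite partial_barrier normrN.
have c2 : 0 <= 2 * c by rewrite mulr_ge0.
case: (j == i0); last by rewrite mulr0 normr0 mulr_ge0// ltW.
by rewrite mulr1 normrM (ger0_norm c2) ler_wpM2l// HL.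
Qed.

Section comparison.
Variables (f : E -> R) (fi : sqint f) (c : R) (c0 : 0 <= c).
Hypothesis fc : forall x, Omega x -> f x <= 2 * c.
Variables (p : jet R N) (pf : weak_solution Omega V f p).
Let phi := barrier c.
Let sphi : smooth phi. Proof. exact: smooth_barrier. Qed.
Let phi_ge0 x : Omega x -> 0 <= phi x.
Proof. by move=> Ox; apply: le_trans (barrier_ge c0 Ox). Qed.
Let K i x := p.2 i x - partial i phi x.

Let pH : H10 Omega p.1 p.2. Proof. by have [[]] := pf. Qed.
Let pi : sqint p.1. Proof. exact: H10_sqint pH. Qed.
Let Gi i : sqint (p.2 i). Proof. exact: H10_sqint_grad pH. Qed.

Let dphi_sqint i : sqint (partial i phi).
Proof.
have [M HM] := partial_barrier_bnd i c0.
apply: (sqint_bnd mO Ooo _ HM); apply: smooth_measurable => //.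
exact: smooth_partial.
Qed.

Let Ki i : sqint (K i). Proof. exact: sqintB. Qed.

Section test.
Variables (e : R) (e0 : 0 < e).

(* Testing with a smooth version of the positive part of p - phi. *)
Let q : jet R N := (trunc e phi p.1, trunc_grad e phi p.1 p.2).
Let theta x := spos_s e (p.1 x) (phi x).
Let kappa x := spos_st e (phi x).

Let qE : ES Omega V q.
Proof.
have [_ pw pV] := pf.1; split.
- apply: H10_trunc => // i; exact: partial_barrier_bnd.
- apply: (sqint_le mO _ _ pw).
    by apply: measurable_wtd => //; apply: measurable_trunc => //; exact: sqint_meas pi.
  move=> x _; have h : `|q.1 x| <= `|p.1 x| by exact: (spos_norm_le e0 (p.1 x) (phi x)).
  by rewrite /wtd (normrM _ (q.1 x)) (normrM _ (p.1 x)) ler_wpM2l.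
(* Here it matters that [spos] vanishes at [s = 0]: the constraint where [V] is infinite survives
   truncation. *)
- apply: filterS pV => x h Ox Vx; rewrite /q /= /trunc h// spos0//.
Qed.

Let qi : sqint q.1. Proof. by have [/H10_sqint] := qE. Qed.
Let Di i : sqint (q.2 i). Proof. by have [/(H10_sqint_grad i)] := qE. Qed.

Let theta_mul w : sqint w -> sqint (fun x => theta x * w x).
Proof. by move=> wi; apply: spos_s_mul_sqint => //; exact: sqint_meas pi. Qed.

Let kappa_mul w : sqint w -> sqint (fun x => kappa x * w x).
Proof. by move=> wi; apply: spos_st_mul_sqint. Qed.

Let kappa_bnd x : Omega x -> `|kappa x * partial i0 phi x| <= 2 * L * e.
Proof.
move=> Ox; have [k0 k1] := spos_st_bounds e0 (phi_ge0 Ox).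
have ck : c * kappa x <= e by apply: le_trans k1; rewrite ler_wpM2r// barrier_ge.
rewrite partial_barrier eqxx mulr1 mulrN normrN normrM (ger0_norm k0).
rewrite normrM ger0_norm ?mulr_ge0//.
have -> : kappa x * (2 * c * `|x 0 i0|) = 2 * `|x 0 i0| * (c * kappa x) by ring.
apply: ler_pM => //; first by rewrite mulr_ge0// mulr_ge0.
by rewrite ler_pM2l// HL.
Qed.

(** Test the equation with [q]. The potential term and the directions other than [i0] contribute
    nonnegatively; the barrier contributes [2 c] times the integral of [q], and [q >= -e] with
    [f <= 2 c] leaves an error of order [e]. *)
Let weighted_energy_le : \int[leb]_(x in Omega) (theta x * K i0 x * K i0 x) <=
  e * (\int[leb]_(x in Omega) (2 * c - f x) +
       2 * L * \int[leb]_(x in Omega) `|K i0 x|).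
Proof.
have tKK i : leb.-integrable Omega (EFin \o (fun x => theta x * K i x * K i x)).
  exact: (sqint_mul mO (theta_mul (Ki i)) (Ki i)).
have kKi : leb.-integrable Omega (EFin \o (fun x => kappa x * partial i0 phi x * K i0 x)).
  exact: (sqint_mul mO (kappa_mul (dphi_sqint i0)) (Ki i0)).
have dD : leb.-integrable Omega (EFin \o (fun x => partial i0 phi x * q.2 i0 x)).
  exact: (sqint_mul mO (dphi_sqint i0) (Di i0)).
have S0 : \int[leb]_(x in Omega) (p.2 i0 x * q.2 i0 x) =
    \int[leb]_(x in Omega) (theta x * K i0 x * K i0 x) +
    \int[leb]_(x in Omega) (kappa x * partial i0 phi x * K i0 x) +
    \int[leb]_(x in Omega) (partial i0 phi x * q.2 i0 x).
  rewrite -!RintegralD//; last exact: integrableDR.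
  by apply: eq_Rintegral => x _; rewrite /q /= /trunc_grad -/(theta x) -/(kappa x) /K; ring.
have Si i : i != i0 -> 0 <= \int[leb]_(x in Omega) (p.2 i x * q.2 i x).
  move=> ii0; apply: Rintegral_ge0 => x Ox.
  rewrite /q /= /trunc_grad partial_barrier (negPf ii0) mulr0 oppr0 mulr0 addr0 subr0.
  have /andP[t0 _] := spos_s_bounds e0 (p.1 x) (phi x).
  by rewrite mulrCA mulr_ge0// -expr2 sqr_ge0.
have Sw : 0 <= \int[leb]_(x in Omega) (wtd V p.1 x * wtd V q.1 x).
  apply: Rintegral_ge0 => x Ox; rewrite /wtd mulrACA mulr_ge0//.
    by rewrite -expr2 sqr_ge0.
  exact: spos_mul_ge0.
have SA : \int[leb]_(x in Omega) (p.2 i0 x * q.2 i0 x) <= \int[leb]_(x in Omega) (q.1 x * f x).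
  rewrite -(pf.2 _ qE) /A (bigD1 i0)//= -addrA lerDl addr_ge0// sumr_ge0//.
have Sd : \int[leb]_(x in Omega) (partial i0 phi x * q.2 i0 x) =
    2 * c * \int[leb]_(x in Omega) q.1 x.
  have [qH _ _] := qE.
  have /eqP := H10_coord_ibp oO bO i0 qH; rewrite addr_eq0 => /eqP ->.
  rewrite mulrN -mulNr -RintegralZl//; last first.
    have xi : sqint (fun x : E => x 0 i0).
      apply: (sqint_bnd mO Ooo (M := L)) => [|x Ox]; last exact: HL.
      by apply: smooth_measurable => //; exact: smooth_coord.
    exact: (sqint_mul mO (Di i0) xi).
  by apply: eq_Rintegral => x _; rewrite partial_barrier eqxx mulr1; ring.
have aKi : leb.-integrable Omega (EFin \o (fun x => `|K i0 x|)).
  exact/integrable_norm/(sqint_integrable1 mO Ooo).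
have fci : leb.-integrable Omega (EFin \o (fun x => 2 * c - f x)).
  apply: integrableBR => //; first exact: (integrable_cstR mO Ooo).
  exact: (sqint_integrable1 mO Ooo).
have q1i : leb.-integrable Omega (EFin \o q.1) by exact: (sqint_integrable1 mO Ooo qi).
have qfi : leb.-integrable Omega (EFin \o (fun x => q.1 x * f x)) by exact: sqint_mul.
have R1 : \int[leb]_(x in Omega) (q.1 x * f x) - 2 * c * \int[leb]_(x in Omega) q.1 x <=
    e * \int[leb]_(x in Omega) (2 * c - f x).
  rewrite -!RintegralZl// -RintegralB//; last exact: integrableZR.
  apply: le_Rintegral => //.
  - by apply: integrableBR => //; exact: integrableZR.
  - exact: integrableZR.
  - move=> x Ox; have h : - e <= q.1 x by exact: (spos_ge e0 (p.1 x) (phi_ge0 Ox)).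
    have hf := fc Ox.
    have : 0 <= (q.1 x + e) * (2 * c - f x).
      by rewrite mulr_ge0 ?subr_ge0// -lerBlDr sub0r.
    by move: (q.1 x) (f x) {h hf} => a b; lra.
have R2 : - (\int[leb]_(x in Omega) (kappa x * partial i0 phi x * K i0 x)) <=
    e * (2 * L * \int[leb]_(x in Omega) `|K i0 x|).
  have -> : e * (2 * L * \int[leb]_(x in Omega) `|K i0 x|) =
      2 * L * e * \int[leb]_(x in Omega) `|K i0 x| by ring.
  rewrite -RintegralZl//; apply: le_trans (ler_norm _) _; rewrite normrN.
  apply: le_trans (le_normr_Rintegral mO kKi) _; apply: le_Rintegral => //.
  - exact: integrable_norm.
  - exact: integrableZR.
  - by move=> x Ox; rewrite normrM ler_wpM2r// kappa_bnd.
rewrite mulrDr; lra.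
Qed.

(** Poincare for [q], whose derivative is controlled by the weighted energy since
    [theta^2 <= theta]. Finally [q] is within [e] of the true positive part. *)
Lemma sqn_positive_part_le (C : R) : 0 < C ->
  (forall z G, H10 Omega z G -> sqn z <= C * sqn (G i0)) ->
  sqn (fun x => Num.max (p.1 x - phi x) 0) <=
  4 * C * e * (\int[leb]_(x in Omega) (2 * c - f x) +
       2 * L * \int[leb]_(x in Omega) `|K i0 x|) +
  (16 * C * L ^+ 2 + 2) * fine (leb Omega) * e ^+ 2.
Proof.
move=> C0 HC; have [qH _ _] := qE.
have P := HC _ _ qH; rewrite /= in P.
have B : sqn (q.2 i0) <= 2 * sqn (fun x => theta x * K i0 x) +
    2 * sqn (fun x => kappa x * partial i0 phi x).
  exact: (sqnD_le mO (theta_mul (Ki i0)) (kappa_mul (dphi_sqint i0))).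
have T : sqn (fun x => theta x * K i0 x) <=
    \int[leb]_(x in Omega) (theta x * K i0 x * K i0 x).
  apply: le_Rintegral => //.
  - exact: (sqint_integrable (theta_mul (Ki i0))).
  - exact: (sqint_mul mO (theta_mul (Ki i0)) (Ki i0)).
  - move=> x Ox; have /andP[t0 t1] := spos_s_bounds e0 (p.1 x) (phi x).
    rewrite -/(theta x) in t0 t1 *.
    have -> : (theta x * K i0 x) ^+ 2 = theta x * (theta x * (K i0 x * K i0 x)) by ring.
    rewrite -mulrA ler_piMl// mulr_ge0// -expr2 sqr_ge0//.
have W := weighted_energy_le.
have cst_le (w : E -> R) (b : R) : measurable_fun Omega w ->
    (forall x, Omega x -> `|w x| <= b) -> sqn w <= b ^+ 2 * fine (leb Omega).
  move=> mw wb; rewrite -[leRHS](Rintegral_cst _ mO (b ^+ 2)).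
  change (sqn w <= sqn (fun=> b)).
  apply: le_sqn => //; last exact: sqint_cst.
  by move=> x Ox; rewrite (le_trans (wb x Ox))// ler_norm.
have k2 : sqn (fun x => kappa x * partial i0 phi x) <= (2 * L * e) ^+ 2 * fine (leb Omega).
  apply: cst_le; last exact: kappa_bnd.
  exact: (sqint_meas (kappa_mul (dphi_sqint i0))).
have mmax : measurable_fun Omega (fun x => Num.max (p.1 x - phi x) 0).
  apply: measurable_maxr => //; apply: measurable_funB; first exact: sqint_meas pi.
  exact: smooth_measurable.
have di : sqint (fun x => Num.max (p.1 x - phi x) 0 - q.1 x).
  apply: (sqint_bnd mO Ooo (M := e)) => [|x Ox]; last exact: spos_approx (phi_ge0 Ox).
  by apply: measurable_funB => //; exact: sqint_meas qi.
have d2 : sqn (fun x => Num.max (p.1 x - phi x) 0 - q.1 x) <= e ^+ 2 * fine (leb Omega).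
  by apply: cst_le => [|x Ox]; [exact: sqint_meas di|exact: spos_approx (phi_ge0 Ox)].
have := sqnD_le mO di qi; under eq_fun do rewrite subrK.
move=> /le_trans; apply.
have {}P : sqn q.1 <= C * (2 * (e * (\int[leb]_(x in Omega) (2 * c - f x) +
       2 * L * \int[leb]_(x in Omega) `|K i0 x|)) + 2 * ((2 * L * e) ^+ 2 * fine (leb Omega))).
  by apply: le_trans P _; rewrite ler_pM2l//; lra.
apply: (@le_trans _ _ (2 * (e ^+ 2 * fine (leb Omega)) + 2 * (C * (2 * (e * (\int[leb]_(x in Omega) (2 * c - f x) +
       2 * L * \int[leb]_(x in Omega) `|K i0 x|)) + 2 * ((2 * L * e) ^+ 2 * fine (leb Omega)))))).
  by apply: lerD; rewrite ler_pM2l.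
by rewrite le_eqVlt; apply/orP; left; apply/eqP; ring.
Qed.

End test.

Lemma weak_solution_le_barrier : {ae leb, forall x, Omega x -> p.1 x <= barrier c x}.
Proof.
have [C C0 HC] := H10_poincare oO bO i0.
have mmax : measurable_fun Omega (fun x => Num.max (p.1 x - phi x) 0).
  apply: measurable_maxr => //; apply: measurable_funB; first exact: sqint_meas pi.
  exact: smooth_measurable.
have dsq : sqint (fun x => p.1 x - phi x).
  apply: sqintB => //; apply: (sqint_bnd mO Ooo (M := c * (L ^+ 2 + 1))).
    exact: smooth_measurable.
  by move=> x Ox; rewrite ger0_norm ?phi_ge0// barrier_le.
have mi : sqint (fun x => Num.max (p.1 x - phi x) 0).
  apply: (sqint_le mO mmax _ dsq) => x _.
  rewrite ger0_norm ?le_max ?lexx ?orbT// ge_max normr_ge0 andbT ler_norm//.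
have : sqn (fun x => Num.max (p.1 x - phi x) 0) <= 0.
  set I1 := \int[leb]_(x in Omega) (2 * c - f x) +
       2 * L * \int[leb]_(x in Omega) `|K i0 x|.
  have I1_ge0 : 0 <= I1.
    apply: addr_ge0; first by apply: Rintegral_ge0 => x /fc; rewrite subr_ge0.
    by rewrite mulr_ge0 ?mulr_ge0 ?(ltW L0)//; exact: Rintegral_ge0.
  have m0 : 0 <= fine (leb Omega) by rewrite fine_ge0.
  pose B := (16 * C * L ^+ 2 + 2) * fine (leb Omega).
  have B0 : 0 <= B by rewrite mulr_ge0// addr_ge0// !mulr_ge0// ?sqr_ge0// ltW.
  have CI0 : 0 <= 4 * C * I1 by rewrite !mulr_ge0// ltW.
  apply: (@le0_small _ _ (4 * C * I1 + B)) => e e0.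
  (* Capped at 1 so that the quadratic error is also at most linear in [e]. *)
  pose e' := Num.min e 1.
  have e'0 : 0 < e' by rewrite lt_min e0 ltr01.
  apply: le_trans (sqn_positive_part_le e'0 C0 HC) _; rewrite -/I1 -/B.
  have e'e : e' <= e by rewrite ge_min lexx.
  have e'1 : e' <= 1 by rewrite ge_min lexx orbT.
  have : e' ^+ 2 <= e by rewrite expr2 (le_trans _ e'e)// ler_piMl// ltW.
  move=> h; apply: (@le_trans _ _ (4 * C * I1 * e + B * e)); last by rewrite -mulrDl mulrC.
  apply: lerD; last by rewrite ler_wpM2l.
  by rewrite mulrAC ler_wpM2l.
move=> /(sqn_eq0 mO mi); apply: filterS => x + Ox => /(_ Ox) h.
by rewrite -subr_le0 -[leRHS]h le_max lexx.
Qed.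

End comparison.

(** The upper bound is the barrier with [c = 1/2], as [f <= 1]. The lower bound is the comparison of
    [-p], which has datum [-f <= 0], with the zero barrier. *)
Lemma weak_solution_bounds f p : sqint f -> (forall x, Omega x -> 0 <= f x <= 1) ->
  weak_solution Omega V f p ->
  {ae leb, forall x, Omega x -> 0 <= p.1 x <= 2^-1 * (L ^+ 2 + 1)}.
Proof.
move=> fi f01 pf; have [pE pfe] := pf.
have h2 : 0 <= 2^-1 :> R by rewrite invr_ge0.
have f1 x : Omega x -> f x <= 2 * 2^-1.
  by rewrite divff ?pnatr_eq0// => /f01/andP[].
have up := weak_solution_le_barrier fi h2 f1 pf.
pose z0 : jet R N := (fun=> 0, fun _ _ => 0).
have z0E : ES Omega V z0 := ES0 oO bO V.
have nE := ES_jlin oO bO (-1) z0E pE.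
have nf : weak_solution Omega V (fun x => - f x) (jlin (-1) z0 p).
  split=> // q qE; rewrite A_jlinl// pfe// mulN1r.
  have -> : A Omega V z0 q = 0.
    have z (w : E -> R) : \int[leb]_(x in Omega) (0 * w x) = 0.
      rewrite (eq_Rintegral _ (g := fun=> 0)) ?Rintegral_cst ?mul0r// => x _.
      by rewrite mul0r.
    rewrite /A big1 ?add0r => [|i _]; last exact: z.
    by rewrite (eq_Rintegral _ (g := fun x => 0 * wtd V q.1 x))// => x _; rewrite /wtd /= mulr0.
  have [qH _ _] := qE.
  rewrite add0r -[LHS]mulN1r -RintegralZl//; last first.
    exact: (sqint_mul mO (H10_sqint qH) fi).
  by apply: eq_Rintegral => x _; ring.
have Nfi : sqint (fun x => - f x).
  by have := sqintZ mO (-1) fi; under eq_fun do rewrite mulN1r.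
have Nf0 x : Omega x -> - f x <= 2 * 0.
  by rewrite mulr0 oppr_le0 => /f01/andP[].
have dn := weak_solution_le_barrier Nfi (lexx 0) Nf0 nf.
apply: filterS2 up dn => x hu hd Ox; apply/andP; split.
  by have := hd Ox; rewrite /barrier mul0r /= add0r mulN1r oppr_le0.
by apply: le_trans (hu Ox) _; exact: barrier_le.
Qed.

End bounds.

(** * Duality solutions *)

Section precise_representative.
Variables (R : realType) (N : nat) (Omega : set 'rV[R]_N).
Local Notation E := 'rV[R]_N.
Local Notation leb := (lebesgue_rV R N).
Hypothesis oO : open Omega.

Lemma eballE (x : E) r : 0 < r -> eball x r = [set y | sqdist x y < r ^+ 2].
Proof.
move=> r0; apply/seteqP; split=> y; rewrite /eball /mkset.
  rewrite -ltr_sqr ?nnegrE ?(ltW r0) ?sqrtr_ge0//.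
  by rewrite enorm_sqr; under eq_bigr do rewrite !mxE.
move=> h; rewrite -ltr_sqr ?nnegrE ?(ltW r0) ?sqrtr_ge0//.
by rewrite enorm_sqr; under eq_bigr do rewrite !mxE.
Qed.

Lemma eball_sub_box (x : E) r : 0 < r -> eball x r `<=` [set y | forall j, `|y 0 j - x 0 j| <= r].
Proof.
by move=> r0 y; rewrite eballE// => /ltW h j; exact: sqdist_coord (ltW r0) h.
Qed.

Lemma open_eball (x : E) r : 0 < r -> open (eball x r).
Proof.
move=> r0; rewrite eballE//.
rewrite (_ : [set y | _] = sqdist x @^-1` [set y | y < r ^+ 2])//.
apply: open_comp; last exact: open_lt.
by move=> y _; exact: (smooth_continuous (smooth_sqdist x)).
Qed.

Lemma lebesgue_eball (x : E) r : 0 < r -> (0 < leb (eball x r) < +oo)%E.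
Proof.
move=> r0; have mB : measurable (eball x r).
  by apply: open_measurable_rV; exact: open_eball.
apply/andP; split; last first.
  apply: (@lebesgue_compact_lty R N _ (`|x| + r)) => // y /eball_sub_box h j.
  rewrite -(subrK (x 0 j) (y 0 j)) (le_trans (ler_normD _ _))// addrC lerD//.
    exact: norm_coord_le.
  exact: h.
pose dl := r / N.+1%:R.
have dl0 : 0 < dl by rewrite divr_gt0.
apply: (@lt_le_trans _ _ (leb (box x dl))).
  by rewrite lebesgue_box// lte_fin exprn_gt0// pmulrn_rgt0.
apply: le_measure; rewrite ?inE//; first exact: measurable_box.
move=> y h; rewrite eballE//.
apply: (@le_lt_trans _ _ (\sum_(i < N) dl ^+ 2)).
  apply: ler_sum => i _; rewrite -real_normK ?num_real// ler_sqr ?nnegrE ?(ltW dl0)//.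
  by rewrite distrC ltW//; exact: h.
rewrite sumr_const card_ord -mulr_natl /dl expr_div_n mulrCA.
rewrite gtr_pMr ?exprn_gt0// ltr_pdivrMr ?exprn_gt0// mul1r -natrX ltr_nat.
by rewrite expnS expn1; exact: leq_pmull.
Qed.

(** If a value [c < 0] were admissible, [|z - c| >= -c] almost everywhere would keep the averages on
    small balls away from 0. The default value is 0, also nonnegative. *)
Lemma precise_ge0 (z : E -> R) : measurable_fun Omega z ->
  {ae leb, forall x, Omega x -> 0 <= z x} ->
  forall x, Omega x -> 0 <= precise z x.
Proof.
move=> mz z0 x Ox; rewrite /precise; case: xgetP => [c _ /= cz|]; last by rewrite lexx.
rewrite leNgt; apply/negP => c0.
have Nc0 : 0 < - c by rewrite oppr_gt0.
have /nbhs_ballP[d /= d0 dO] : nbhs x Omega by exact: open_nbhs_nbhs.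
have low r : 0 < r -> r < d ->
    ((- c)%:E <= (fine (leb (eball x r)))^-1%:E * \int[leb]_(y in eball x r) `|z y - c|%:E)%E.
  move=> r0 rd; have /andP[B0 Boo] := lebesgue_eball x r0.
  have BO : eball x r `<=` Omega.
    move=> y /(eball_sub_box r0) h; apply: dO; rewrite -box_ball// => j.
    by rewrite distrC; apply: le_lt_trans (h j) rd.
  have mB : measurable (eball x r).
    by apply: open_measurable_rV; exact: open_eball.
  have Bfin : leb (eball x r) \is a fin_num by rewrite ge0_fin_numE.
  have f0 : 0 < fine (leb (eball x r)) by rewrite fine_gt0// B0.
  rewrite lee_pdivlMl// -(fineK Bfin)/=.
  apply: (@le_trans _ _ (\int[leb]_(y in eball x r) (- c)%:E)%E).
    have -> : (\int[leb]_(y in eball x r) (- c)%:E = (- c)%:E * leb (eball x r))%E.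
      exact: integral_cst.
    by rewrite muleC fineK.
  have mzB : measurable_fun (eball x r) z.
    by apply: measurable_funS mz => //; exact: open_measurable_rV.
  apply: ae_ge0_le_integral => //.
  - by move=> y _; rewrite lee_fin ltW.
  - apply/measurable_EFinP; apply: measurableT_comp => //; exact: measurable_funB.
  - apply: filterS z0 => y h By; rewrite lee_fin.
    by rewrite (le_trans _ (ler_norm _))// lerDr; apply: h; exact: BO.
have : (0 >= (- c)%:E)%E; last by rewrite lee_fin leNgt Nc0.
apply: (@cvge_ge _ _ _ _ _ _ _ _ cz).
near=> r; apply: low; near: r; [exact: nbhs_right_gt|exact: nbhs_right_lt].
Unshelve. all: by end_near. Qed.

End precise_representative.

(** * Change of potential and the estimate on superlevel sets *)

Section domination.
Variables (R : realType) (N : nat) (Omega : set 'rV[R]_N).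
Local Notation E := 'rV[R]_N.
Local Notation leb := (lebesgue_rV R N).
Hypotheses (oO : open Omega) (bO : bounded_set Omega).
Let mO : measurable Omega. Proof. exact: open_measurable_rV. Qed.
Let Ooo : (leb Omega < +oo)%E. Proof. exact: leb_bounded_lty. Qed.
Local Notation sqint := (sqint leb Omega).
Local Notation sqn := (sqn leb Omega).
Variables (i0 : 'I_N) (V : E -> \bar R) (mV : measurable_fun Omega V).
Hypothesis V0 : forall x, Omega x -> (0 <= V x)%E.

Lemma zeta_weak_solution f : sqint f ->
  weak_solution Omega V f
    (zeta Omega V f, fun i x => wgrad Omega (zeta Omega V f) x 0 i).
Proof.
move=> fi; apply: minimizer_weak_solution => //.
have [p pf] := weak_solution_exists oO bO mV fi i0.
have ex : exists z, energy_minimizer Omega V f z.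
  by exists p.1; exact: weak_solution_minimizer.
exact: (xgetPex (cst 0) ex).
Qed.

Section shift.
Variables (a : E -> R) (ma : measurable_fun Omega a).
Hypothesis a01 : forall x, Omega x -> 0 <= a x <= 1.

Definition shift_pot (x : E) : \bar R := (V x + (a x)%:E)%E.

Lemma measurable_shift_pot : measurable_fun Omega shift_pot.
Proof. by apply: emeasurable_funD => //; exact/measurable_EFinP. Qed.

Lemma shift_pot_infty x : shift_pot x = +oo%E <-> V x = +oo%E.
Proof. by rewrite /shift_pot; case: (V x). Qed.

(** Where [V] is infinite both weights are 0 by the convention of [fine], and the last term is
    killed by [z x = 0]. *)
Lemma wtd_shift_pot (z w : E -> R) x : Omega x -> (V x = +oo%E -> z x = 0) ->
  wtd shift_pot z x * wtd shift_pot w x = wtd V z x * wtd V w x + z x * (a x * w x).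
Proof.
move=> Ox; have := V0 Ox; have /andP[a0 _] := a01 Ox.
rewrite /wtd /rootV /shift_pot; case: (V x) => [r||]//= r0 zx; last first.
  by rewrite zx// !mul0r !mulr0 mul0r addr0.
rewrite lee_fin in r0.
have S (s : R) : 0 <= s -> Num.sqrt s * Num.sqrt s = s.
  by move=> s0; rewrite -expr2 sqr_sqrtr.
have E2 : Num.sqrt r * z x * (Num.sqrt r * w x) = r * (z x * w x).
  by rewrite mulrACA S.
by rewrite mulrACA S ?addr_ge0// E2; ring.
Qed.

Lemma rootV_shift_pot_ge x : Omega x -> rootV V x <= rootV shift_pot x.
Proof.
move=> Ox; have := V0 Ox; have /andP[a0 _] := a01 Ox.
rewrite /rootV /shift_pot; case: (V x) => [r||]//= r0.
by rewrite ler_wsqrtr// lerDl.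
Qed.

(** A bounded nonnegative perturbation changes neither the finiteness of the energy nor the set
    where the potential is infinite. *)
Lemma ES_shift_potP p : ES Omega V p <-> ES Omega shift_pot p.
Proof.
split=> -[pH pw pV]; split=> //; try by apply: filterS pV => x h Ox /shift_pot_infty; exact: h.
- have pi := H10_sqint pH; have mp := sqint_meas pi.
  have mw : measurable_fun Omega (wtd shift_pot p.1).
    exact: (measurable_wtd measurable_shift_pot).
  have api : sqint (fun x => a x * p.1 x).
    apply: (sqint_le mO _ _ pi) => [|x Ox]; first exact: measurable_funM.
    by have /andP[? ?] := a01 Ox; rewrite normrM ler_piMl// ger0_norm.
  apply: (integrable_sqint mO mw).
  apply: (ae_eq_integrable mO _ _ (integrableDR mO (sqint_integrable pw) (sqint_mul mO pi api))).
    exact: measurable_funX.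
  apply: filterS pV => x h Ox; rewrite [RHS]expr2 wtd_shift_pot// ?expr2//.
  exact: h.
- apply: (sqint_le mO _ _ pw).
    by apply: measurable_wtd => //; exact: sqint_meas (H10_sqint pH).
  move=> x Ox; rewrite /wtd (normrM _ (p.1 x)) [leRHS](normrM _ (p.1 x)).
  by rewrite ler_wpM2r// !ger0_norm ?sqrtr_ge0// rootV_shift_pot_ge.
Qed.

Lemma A_shift_pot p q : ES Omega V p -> ES Omega V q ->
  A Omega shift_pot p q =
  A Omega V p q + \int[leb]_(x in Omega) (p.1 x * (a x * q.1 x)).
Proof.
move=> pE qE; have [pH pw pV] := pE; have [qH qw _] := qE.
have [_ pw' _] := (ES_shift_potP p).1 pE; have [_ qw' _] := (ES_shift_potP q).1 qE.
have pi := H10_sqint pH; have qi := H10_sqint qH.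
have aqi : sqint (fun x => a x * q.1 x).
  apply: (sqint_le mO _ _ qi) => [|x Ox].
    by apply: measurable_funM => //; exact: sqint_meas qi.
  by have /andP[? ?] := a01 Ox; rewrite normrM ler_piMl// ger0_norm.
rewrite /A -addrA; congr (_ + _).
rewrite -RintegralD//; last 2 first.
- exact: sqint_mul.
- exact: sqint_mul.
apply: (ae_eq_Rintegral mO).
- by apply: measurable_funM; [exact: sqint_meas pw'|exact: sqint_meas qw'].
- apply: measurable_funD; apply: measurable_funM.
  + exact: sqint_meas pw.
  + exact: sqint_meas qw.
  + exact: sqint_meas pi.
  + exact: sqint_meas aqi.
- by apply: filterS pV => x h Ox; rewrite wtd_shift_pot//; exact: h.
Qed.

End shift.

Variables (u : E -> R) (ui : leb.-integrable Omega (EFin \o u)).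

(* All that is used of a duality solution with a nonnegative datum. *)
Hypothesis u_dual : forall f, Linfty Omega f ->
  {ae leb, forall x, Omega x -> 0 <= zeta Omega V f x} ->
  0 <= \int[leb]_(x in Omega) (u x * f x).

Let mu_ : measurable_fun Omega u.
Proof. by apply/measurable_EFinP; exact: measurable_int ui. Qed.

Lemma integrable_mul_bounded (w f : E -> R) (M : R) :
  leb.-integrable Omega (EFin \o w) -> measurable_fun Omega f ->
  (forall x, Omega x -> `|f x| <= M) -> leb.-integrable Omega (EFin \o (fun x => w x * f x)).
Proof.
move=> wi mf fM; have mw : measurable_fun Omega w.
  by apply/measurable_EFinP; exact: measurable_int wi.
apply: (le_integrableR mO _ _ (integrableZR mO M (integrable_norm wi))).
  exact: measurable_funM.
by move=> x Ox; rewrite normrM mulrC ler_wpM2r// fM.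
Qed.

Lemma bool_measurable (b : E -> bool) : measurable_fun Omega b ->
  measurable_fun Omega (fun x => (b x)%:R : R).
Proof.
move=> mb; rewrite (_ : (fun x => _) = (fun x => if b x then 1 else 0)).
  by apply: measurable_fun_if.
by apply/funext => x; case: (b x).
Qed.

Section level.
Variable L : R.
Hypotheses (L0 : 0 < L) (HL : forall x, Omega x -> forall j, `|x 0 j| <= L).
Let C : R := 2^-1 * (L ^+ 2 + 1).
Let C0 : 0 < C. Proof. by rewrite mulr_gt0 ?invr_gt0// ltr_wpDl ?sqr_ge0. Qed.

Variables (g : E -> R) (mg : measurable_fun Omega g).
Hypothesis g01 : forall x, Omega x -> 0 <= g x <= 1.
Let gi : sqint g.
Proof.
apply: (sqint_bnd mO Ooo (M := 1)) => // x Ox.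
by have /andP[? ?] := g01 Ox; rewrite ger0_norm.
Qed.

Lemma dual_ge0 : 0 <= \int[leb]_(x in Omega) (u x * g x).
Proof.
apply: u_dual.
  split=> //; exists 1; apply: aeW => x Ox.
  by have /andP[? ?] := g01 Ox; rewrite ger0_norm.
have := weak_solution_bounds oO bO i0 L0 HL mV gi g01 (zeta_weak_solution gi).
by apply: filterS => x h Ox; have /andP[] := h Ox.
Qed.

(* Maximum principle for the potential of the superlevel set {u > t}: test u
   against g - 1_{u > t} z, where z solves the equation with datum g for the
   potential V + 1_{u > t}; its potential is z >= 0. *)
Lemma superlevel_bound p (t : R) : 0 < t -> weak_solution Omega V g p ->
  \int[leb]_(x in Omega) (p.1 x * (t < u x)%R%:R) <=
  (1 + C) / t * \int[leb]_(x in Omega) (u x * g x).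
Proof.
move=> t0 pg; pose a x : R := (t < u x)%R%:R.
have ma : measurable_fun Omega a.
  by apply: bool_measurable; apply: measurable_fun_ltr.
have a01 x : Omega x -> 0 <= a x <= 1 by rewrite /a; case: (t < u x)%R; rewrite !lexx ?ler01.
have ai : sqint a.
  apply: (sqint_bnd mO Ooo (M := 1)) => // x Ox.
  by have /andP[? ?] := a01 _ Ox; rewrite ger0_norm.
have [z zg] := weak_solution_exists oO bO (measurable_shift_pot ma) gi i0.
have [zE' zeq] := zg; have zE := (ES_shift_potP ma a01 z).2 zE'.
have zb := weak_solution_bounds oO bO i0 L0 HL (measurable_shift_pot ma) gi g01 zg.
have [zH _ _] := zE; have zi := H10_sqint zH.
(* The bounds on [z] hold almost everywhere; clamping makes them hold at every point, so that [f] is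
   bounded and integrands compare pointwise. *)
pose zc x := Num.max 0 (Num.min (z.1 x) C).
have zc0 x : 0 <= zc x by rewrite le_max lexx.
have zcC x : zc x <= C by rewrite ge_max (ltW C0) ge_min lexx orbT.
have mzc : measurable_fun Omega zc.
  by apply: measurable_maxr => //; apply: measurable_minr => //; exact: sqint_meas zi.
have zcE : {ae leb, forall x, Omega x -> z.1 x = zc x}.
  apply: filterS zb => x h Ox; have /andP[h0 h1] := h Ox.
  by rewrite /zc min_l// max_r.
have zci : sqint zc.
  by apply: (sqint_bnd mO Ooo (M := C)) => // x Ox; rewrite ger0_norm.
have azi : sqint (fun x => a x * zc x).
  apply: (sqint_le mO _ _ zci) => [|x Ox]; first exact: measurable_funM.
  by have /andP[? ?] := a01 _ Ox; rewrite normrM ler_piMl// ger0_norm.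
pose f x := g x - a x * zc x.
have fi : sqint f by exact: sqintB.
(* The extra potential term is moved to the right-hand side, where it becomes part of the datum. *)
have zf : weak_solution Omega V f z.
  split=> // q qE; have [qH _ _] := qE; have qi := H10_sqint qH.
  have := zeq q ((ES_shift_potP ma a01 q).1 qE); rewrite (A_shift_pot ma a01)//.
  move=> /(canRL (addrK _)) ->; rewrite -RintegralB//; last 2 first.
  - exact: sqint_mul.
  - apply: (sqint_mul mO zi); apply: (sqint_le mO _ _ qi) => [|x Ox].
      by apply: measurable_funM => //; exact: sqint_meas qi.
    by have /andP[? ?] := a01 _ Ox; rewrite normrM ler_piMl// ger0_norm.
  apply: (ae_eq_Rintegral mO).
  - apply: measurable_funB; apply: measurable_funM => //; try exact: sqint_meas qi.
      exact: sqint_meas zi.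
    by apply: measurable_funM => //; exact: sqint_meas qi.
  - by apply: measurable_funM; [exact: sqint_meas qi|exact: sqint_meas fi].
  - by apply: filterS zcE => x h Ox; rewrite h// /f; ring.
have uf : 0 <= \int[leb]_(x in Omega) (u x * f x).
  apply: u_dual.
    split; first exact: sqint_meas fi.
    exists (1 + C); apply: aeW => x Ox; rewrite /f.
    have /andP[? ?] := g01 Ox; have /andP[? ?] := a01 _ Ox.
    rewrite (le_trans (ler_normB _ _))// lerD//; first by rewrite ger0_norm.
    by rewrite normrM (ger0_norm (zc0 x)) ger0_norm// (le_trans _ (zcC x))// ler_piMl.
  have ze := weak_solution_unique oO bO i0 zf (zeta_weak_solution fi).
  by apply: filterS2 ze zcE => x h1 h2 Ox; have /= <- := h1 Ox; rewrite h2.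
have ugi : leb.-integrable Omega (EFin \o (fun x => u x * g x)).
  apply: (integrable_mul_bounded (M := 1)) => // x Ox.
  by have /andP[? ?] := g01 Ox; rewrite ger0_norm.
have uazi : leb.-integrable Omega (EFin \o (fun x => u x * (a x * zc x))).
  apply: (integrable_mul_bounded (M := C)) => //; first exact: sqint_meas azi.
  move=> x Ox; have /andP[? ?] := a01 _ Ox.
  by rewrite normrM (ger0_norm (zc0 x)) ger0_norm// (le_trans _ (zcC x))// ler_piMl.
have azi1 : leb.-integrable Omega (EFin \o (fun x => a x * zc x)).
  exact: (sqint_integrable1 mO Ooo).
have step1 : t * \int[leb]_(x in Omega) (a x * zc x) <= \int[leb]_(x in Omega) (u x * g x).
  apply: (@le_trans _ _ (\int[leb]_(x in Omega) (u x * (a x * zc x)))).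
    rewrite -RintegralZl//; apply: le_Rintegral => //; first exact: integrableZR.
    move=> x Ox; rewrite /a; case: ltP => tu; last by rewrite mul0r !mulr0.
    by rewrite mul1r ler_wpM2r// ltW.
  rewrite -subr_ge0 -RintegralB//; rewrite (eq_Rintegral _ (g := fun x => u x * f x))//.
  by move=> x _; rewrite /f mulrBr.
have [e ea] := weak_solution_exists oO bO mV ai i0.
have eb := weak_solution_bounds oO bO i0 L0 HL mV ai a01 ea.
have [eE eeq] := ea; have [pE peq] := pg; have [eH _ _] := eE; have ei := H10_sqint eH.
have pa : \int[leb]_(x in Omega) (p.1 x * a x) = \int[leb]_(x in Omega) (e.1 x * g x).
  by rewrite -eeq// -peq// A_sym.
rewrite -/(\int[leb]_(x in Omega) (p.1 x * a x)) pa.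
have ef : \int[leb]_(x in Omega) (e.1 x * f x) = \int[leb]_(x in Omega) (z.1 x * a x).
  by rewrite -eeq// -(zf.2 e eE) A_sym.
have step2 : \int[leb]_(x in Omega) (e.1 x * g x) <=
    (1 + C) * \int[leb]_(x in Omega) (a x * zc x).
  have -> : \int[leb]_(x in Omega) (e.1 x * g x) =
     \int[leb]_(x in Omega) (e.1 x * f x) + \int[leb]_(x in Omega) (e.1 x * (a x * zc x)).
    rewrite -RintegralD//; [|exact: sqint_mul|exact: sqint_mul].
    by apply: eq_Rintegral => x _; rewrite /f; ring.
  rewrite mulrDl mul1r ef; apply: lerD.
    rewrite le_eqVlt; apply/orP; left; apply/eqP; apply: (ae_eq_Rintegral mO).
    - by apply: measurable_funM => //; exact: sqint_meas zi.
    - exact: sqint_meas azi.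
    - by apply: filterS zcE => x h Ox; rewrite h// mulrC.
  rewrite -RintegralZl//.
  (* An upper cap suffices, as [ec] is multiplied by the nonnegative [a zc]. *)
  pose ec x := Num.min (e.1 x) C.
  rewrite (_ : \int[leb]_(x in Omega) (e.1 x * (a x * zc x)) =
     \int[leb]_(x in Omega) (ec x * (a x * zc x))).
    have eci : sqint ec.
      apply: (ae_eq_sqint mO _ _ ei).
        by apply: measurable_minr => //; exact: sqint_meas ei.
      by apply: filterS eb => x h Ox; rewrite /ec min_l//; have /andP[] := h Ox.
    apply: le_Rintegral => //; [exact: sqint_mul|exact: integrableZR|].
    move=> x Ox; have /andP[? ?] := a01 _ Ox.
    by rewrite ler_wpM2r ?mulr_ge0// ge_min lexx orbT.
  apply: (ae_eq_Rintegral mO).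
  - by apply: measurable_funM; [exact: sqint_meas ei|exact: sqint_meas azi].
  - apply: measurable_funM; last exact: sqint_meas azi.
    by apply: measurable_minr => //; exact: sqint_meas ei.
  - by apply: filterS eb => x h Ox; rewrite /ec min_l//; have /andP[] := h Ox.
apply: le_trans step2 _; rewrite -mulrA ler_wpM2l ?addr_ge0 ?(ltW C0)//.
by rewrite ler_pdivlMl.
Qed.

End level.
End domination.

(** * The function H and its dyadic layers *)

Section damping.
Variable R : realType.

Definition damping (c t : R) : R := c * Num.min (Num.max t 0) 1 ^+ 2.

Lemma continuous_damping c : continuous (damping c).
Proof.
move=> t; apply: cvgMr; rewrite /=.
have m : {for t, continuous (fun s : R => Num.min (Num.max s 0) 1)}.
  apply: (@continuous_min _ _ (fun s : R => Num.max s 0) (fun=> 1)).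
    by apply: (@continuous_max _ _ id (fun=> 0)); [exact: cvg_id|exact: cvg_cst].
  exact: cvg_cst.
by under eq_fun do rewrite expr2; rewrite expr2; exact: cvgM.
Qed.

Variables (c : R) (c0 : 0 < c).

Lemma damping_ge0 t : 0 <= damping c t.
Proof. by rewrite mulr_ge0 ?sqr_ge0// ltW. Qed.

Lemma damping_gt0 t : 0 < t -> 0 < damping c t.
Proof. by move=> t0; rewrite mulr_gt0 ?exprn_gt0// lt_min ltr01 lt_max t0. Qed.

Lemma damping_le t s : 0 <= s -> t <= s -> damping c t <= c * s ^+ 2.
Proof.
move=> s0 ts; rewrite ler_pM2l// ler_sqr ?nnegrE// ?le_min ?ler01 ?le_max ?lexx ?orbT//.
by rewrite ge_min ge_max ts s0.
Qed.

Lemma damping_le1 t : damping c t <= c.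
Proof.
rewrite ger_pMr// expr_le1// ?ge_min ?lexx ?orbT//.
by rewrite le_min ler01 le_max lexx orbT.
Qed.

Lemma damping_homo s t : s <= t -> damping c s <= damping c t.
Proof.
move=> st; have p0 (r : R) : 0 <= Num.min (Num.max r 0) 1.
  by rewrite le_min ler01 le_max lexx orbT.
rewrite ler_pM2l// ler_sqr ?nnegrE//.
by rewrite le_min !ge_min lexx orbT andbT ge_max !le_max st lexx orbT.
Qed.

(** Induction on [n]: if [t] exceeds [2^-(n+1)], the new layer is worth exactly the old remainder
    [c 4^-n]; otherwise [damping c t] is itself below the new remainder. *)
Lemma damping_layers n t : damping c t <=
  \sum_(k < n) c * (2^-1 ^+ k) ^+ 2 * (2^-1 ^+ k.+1 < t)%R%:R + c * (2^-1 ^+ n) ^+ 2.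
Proof.
have h0 k : 0 <= 2^-1 ^+ k :> R by rewrite exprn_ge0// invr_ge0.
have s0 k : 0 <= c * (2^-1 ^+ k) ^+ 2 :> R by rewrite mulr_ge0 ?sqr_ge0// ltW.
elim: n => [|n IH].
  by rewrite big_ord0 add0r expr0 expr1n mulr1 damping_le1.
case: (ltP (2^-1 ^+ n.+1) t) => tn.
  rewrite big_ord_recr /= tn mulr1; apply: le_trans IH _.
  by rewrite lerDl.
apply: le_trans (damping_le (h0 n.+1) tn) _; rewrite lerDr sumr_ge0// => k _.
by rewrite mulr_ge0.
Qed.

End damping.

(** * Summation over the levels and conclusion *)

Section conclusion.
Variables (R : realType) (N : nat) (Omega : set 'rV[R]_N).
Local Notation E := 'rV[R]_N.
Local Notation leb := (lebesgue_rV R N).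
Hypotheses (oO : open Omega) (bO : bounded_set Omega).
Let mO : measurable Omega. Proof. exact: open_measurable_rV. Qed.
Let Ooo : (leb Omega < +oo)%E. Proof. exact: leb_bounded_lty. Qed.
Local Notation sqint := (sqint leb Omega).
Variables (i0 : 'I_N) (V : E -> \bar R) (mV : measurable_fun Omega V).
Hypothesis V0 : forall x, Omega x -> (0 <= V x)%E.
Variables (u : E -> R) (ui : leb.-integrable Omega (EFin \o u)).
Hypothesis u_dual : forall f, Linfty Omega f ->
  {ae leb, forall x, Omega x -> 0 <= zeta Omega V f x} ->
  0 <= \int[leb]_(x in Omega) (u x * f x).
Let mu_ : measurable_fun Omega u.
Proof. by apply/measurable_EFinP; exact: measurable_int ui. Qed.
Variables (L : R) (L0 : 0 < L).
Hypothesis HL : forall x, Omega x -> forall j, `|x 0 j| <= L.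
Variables (c : R) (c0 : 0 < c) (Hc : 4 * c * (1 + 2^-1 * (L ^+ 2 + 1)) = 1).
Let w x := damping c (u x).
Let mw : measurable_fun Omega w.
Proof.
apply: (@measurable_comp _ _ _ _ _ _ setT (damping c)) => //.
by apply: continuous_measurable_fun; exact: continuous_damping.
Qed.
Let w_bnd x : `|w x| <= c.
Proof. by rewrite ger0_norm ?damping_ge0 ?damping_le1. Qed.
Let wi : sqint w. Proof. exact: (sqint_bnd mO Ooo (M := c)). Qed.

Lemma dual_damping (g : E -> R) (p : jet R N) : measurable_fun Omega g ->
  (forall x, Omega x -> 0 <= g x <= 1) -> weak_solution Omega V g p ->
  \int[leb]_(x in Omega) (p.1 x * w x) <= \int[leb]_(x in Omega) (u x * g x).
Proof.
move=> mg g01 pg; have [[pH _ _] _] := pg; have pi := H10_sqint pH.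
have gi : sqint g.
  apply: (sqint_bnd mO Ooo (M := 1)) => // x Ox.
  by have /andP[? ?] := g01 _ Ox; rewrite ger0_norm.
set I := \int[leb]_(x in Omega) (u x * g x).
have I0 : 0 <= I by exact: (dual_ge0 oO bO i0 mV V0 u_dual L0 HL mg g01).
pose pc x := Num.max (p.1 x) 0.
have pc0 x : 0 <= pc x by rewrite le_max lexx orbT.
have mpc : measurable_fun Omega pc by apply: measurable_maxr => //; exact: sqint_meas pi.
have pE : {ae leb, forall x, Omega x -> p.1 x = pc x}.
  apply: filterS (weak_solution_bounds oO bO i0 L0 HL mV gi g01 pg) => x h Ox.
  by rewrite /pc max_l//; have /andP[] := h Ox.
have pci : sqint pc by exact: (ae_eq_sqint mO mpc pE pi).
have pcE f : measurable_fun Omega f ->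
    \int[leb]_(x in Omega) (p.1 x * f x) = \int[leb]_(x in Omega) (pc x * f x).
  move=> mf; apply: (ae_eq_Rintegral mO).
  - by apply: measurable_funM => //; exact: sqint_meas pi.
  - exact: measurable_funM.
  - by apply: filterS pE => x h Ox; rewrite h.
rewrite -subr_le0; apply: (@le0_small _ _ (c * \int[leb]_(x in Omega) pc x)) => e e0.
have [n ne] : exists n : nat, 2^-1 ^+ n <= e.
  have [n _ Hn] := near_infty_natSinv_lt (PosNum e0).
  exists n; have /= /ltW := Hn n (leqnn n); apply: le_trans.
  by rewrite exprVn lef_pV2 ?posrE ?exprn_gt0 ?ltr0n// -natrX ler_nat ltn_expl.
pose s k x : R := (2^-1 ^+ k.+1 < u x)%R%:R.
have ms k : measurable_fun Omega (s k).
  by apply: (bool_measurable oO); apply: measurable_fun_ltr.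
have si k : sqint (s k).
  by apply: (sqint_bnd mO Ooo (M := 1)) => // x _; rewrite /s; case: (_ < _)%R; rewrite ?normr0 ?normr1.
have psi k : leb.-integrable Omega (EFin \o (fun x => pc x * s k x)) by exact: sqint_mul.
have pci1 : leb.-integrable Omega (EFin \o pc) by exact: (sqint_integrable1 mO Ooo pci).
have sumi : leb.-integrable Omega
    (EFin \o (fun x => \sum_(k < n) c * (2^-1 ^+ k) ^+ 2 * (pc x * s k x))).
  by apply: (integrable_sumR mO) => k; exact: integrableZR.
(* Finitely many layers and a remainder replace the infinite sum; the remainder is absorbed by
   [le0_small]. *)
have ub : \int[leb]_(x in Omega) (pc x * w x) <=
    \sum_(k < n) c * (2^-1 ^+ k) ^+ 2 * \int[leb]_(x in Omega) (pc x * s k x) +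
    c * (2^-1 ^+ n) ^+ 2 * \int[leb]_(x in Omega) pc x.
  under eq_bigr do rewrite -RintegralZl//.
  rewrite -(Rintegral_sumR mO) => [|k]; last exact: integrableZR.
  rewrite -RintegralZl// -RintegralD//; last exact: integrableZR.
  apply: le_Rintegral => //; first exact: sqint_mul.
    by apply: integrableDR => //; exact: integrableZR.
  move=> x Ox; apply: le_trans (ler_wpM2l (pc0 x) (damping_layers c0 n (u x))) _.
  rewrite mulrDr mulr_sumr [X in _ <= _ + X]mulrC lerD2r; apply: ler_sum => k _.
  by rewrite mulrCA.
(* The loss [2^(k+1)] of [superlevel_bound] against the weight [4^-k] leaves [2^-(k+1)], and [Hc] is
   the normalization that makes the constant 1. *)
have layer k : c * (2^-1 ^+ k) ^+ 2 * \int[leb]_(x in Omega) (pc x * s k x) <= 2^-1 ^+ k.+1 * I.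
  have h1 : 0 < 2^-1 ^+ k.+1 :> R by rewrite exprn_gt0// invr_gt0.
  have := superlevel_bound oO bO i0 mV V0 ui u_dual L0 HL mg g01 h1 pg.
  rewrite (pcE (s k))// => /(ler_wpM2l (_ : 0 <= c * (2^-1 ^+ k) ^+ 2)).
  move=> /(_ _)/le_trans; apply; first by rewrite mulr_ge0 ?sqr_ge0// ltW.
  rewrite -/I mulrA ler_wpM2r//.
  have -> : c * (2^-1 ^+ k) ^+ 2 * ((1 + 2^-1 * (L ^+ 2 + 1)) / 2^-1 ^+ k.+1) =
      2^-1 ^+ k.+1 * (4 * c * (1 + 2^-1 * (L ^+ 2 + 1))).
    by rewrite !exprS; field; rewrite gt_eqF.
  by rewrite Hc mulr1.
have geo : \sum_(k < n) 2^-1 ^+ k.+1 = 1 - 2^-1 ^+ n :> R.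
  elim: n {ne sumi ub} => [|n IH]; first by rewrite big_ord0 expr0 subrr.
  by rewrite big_ord_recr /= IH exprS; field.
have hn1 : 2^-1 ^+ n <= 1 :> R by rewrite exprn_ile1// invf_le1// ler1n.
have P0 : 0 <= \int[leb]_(x in Omega) pc x by exact: Rintegral_ge0.
rewrite pcE// lerBlDr; apply: le_trans ub _; rewrite addrC; apply: lerD.
  rewrite -mulrA mulrCA ler_wpM2r ?mulr_ge0 ?(ltW c0)//.
  by rewrite (le_trans _ ne)// expr2 ler_piMl.
apply: (@le_trans _ _ (\sum_(k < n) 2^-1 ^+ k.+1 * I)).
  by apply: ler_sum => k _; exact: layer.
by rewrite -mulr_suml geo ler_piMl// gerBl.
Qed.

Lemma zeta_damping_le : {ae leb, forall x, Omega x -> zeta Omega V w x <= u x}.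
Proof.
have zw := zeta_weak_solution oO bO i0 mV V0 wi; set z := (zeta Omega V w, _) in zw.
have [zE zeq] := zw; have [zH _ _] := zE; have zi := H10_sqint zH.
pose g x : R := (u x < z.1 x)%R%:R.
have mg : measurable_fun Omega g.
  have mz : measurable_fun Omega z.1 by exact: sqint_meas zi.
  exact: (bool_measurable oO (measurable_fun_ltr mu_ mz)).
have g01 x : Omega x -> 0 <= g x <= 1.
  by rewrite /g; case: (_ < _)%R; rewrite !lexx ?ler01.
have gi : sqint g.
  apply: (sqint_bnd mO Ooo (M := 1)) => // x Ox.
  by have /andP[? ?] := g01 _ Ox; rewrite ger0_norm.
have [p pg] := weak_solution_exists oO bO mV gi i0.
have [pE peq] := pg.
have zgi : leb.-integrable Omega (EFin \o (fun x => z.1 x * g x)) by exact: sqint_mul.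
have ugi : leb.-integrable Omega (EFin \o (fun x => u x * g x)).
  apply: (integrable_mul_bounded oO (M := 1)) => // x Ox.
  by have /andP[? ?] := g01 _ Ox; rewrite ger0_norm.
(* By symmetry the integral of [z g] is that of [p w], to which [dual_damping] applies. The
   integrand is nonnegative by the choice of [g], hence zero almost everywhere. *)
have zu : \int[leb]_(x in Omega) (z.1 x * g x - u x * g x) <= 0.
  rewrite RintegralB// subr_le0 -(peq z)// A_sym zeq//.
  exact: dual_damping.
have d0 x : Omega x -> 0 <= z.1 x * g x - u x * g x.
  move=> _; rewrite -mulrBl /g; case: ltP => h; last by rewrite mulr0.
  by rewrite mulr1 subr_ge0 ltW.
have di : leb.-integrable Omega (EFin \o (fun x => z.1 x * g x - u x * g x)).
  exact: integrableBR.
apply: filterS (ae_eq0_ge0_Rintegral mO di d0 zu) => x h Ox.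
have := h Ox; rewrite /g leNgt -/(z.1 x); case: ltP => //= uz.
by rewrite !mulr1 => /eqP; rewrite subr_eq0 gt_eqF.
Qed.

End conclusion.

Theorem proposition7p1 (R : realType) (N : nat) (N_gt0 : (0 < N)%N)
    (Omega : set 'rV[R]_N) (Omega_open : open Omega)
    (Omega_connected : connected Omega) (Omega_bounded : bounded_set Omega)
    (Omega_smooth : smooth_boundary Omega) :
  exists H : R -> R,
    [/\ (exists M : R, forall t, 0 <= t -> H t <= M),
        {within `[0, +oo[, continuous H},
        {in `[0, +oo[ &, {homo H : s t / s <= t}},
        (forall t, 0 <= t -> 0 <= H t) &
        (forall t, 0 < t -> 0 < H t)] /\
    forall V : 'rV[R]_N -> \bar R,
      measurable_fun Omega V -> (forall x, Omega x -> (0 <= V x)%E) ->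
    forall (mu : {finite_measure set 'rV[R]_N -> \bar R}) (u : 'rV[R]_N -> R),
      duality_solution Omega V mu u ->
      {ae lebesgue_rV R N, forall x, Omega x -> zeta Omega V (H \o u) x <= u x}.
Proof.
have [L L0 HL] := bounded_coord Omega_bounded.
pose C := 1 + 2^-1 * (L ^+ 2 + 1).
have C0 : 0 < C by rewrite ltr_wpDr// mulr_ge0 ?invr_ge0// addr_ge0// sqr_ge0.
pose c := (4 * C)^-1.
have c0 : 0 < c by rewrite invr_gt0 mulr_gt0.
exists (damping c); split; first split.
- by exists c => t _; exact: damping_le1.
- by apply: continuous_subspaceT; exact: continuous_damping.
- by move=> s t _ _; exact: damping_homo.
- by move=> t _; exact: damping_ge0.
- by move=> t; exact: damping_gt0.
move=> V mV V0 mu u [ui u_dual].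
(* [N > 0] supplies the coordinate along which the Poincare inequality and the barrier are taken. *)
apply: (zeta_damping_le Omega_open Omega_bounded (Ordinal N_gt0) mV V0 ui _ L0 HL c0).
  move=> f fi zf; rewrite fine_ge0// u_dual//; apply: integral_ge0 => x Ox.
  rewrite lee_fin; apply: (precise_ge0 Omega_open _ zf) => //.
  (* [zeta] is measurable in either case: a minimizer is square integrable, and the default is
     constant. *)
  rewrite /zeta; case: xgetP => [z _ [[[[[mz _] _] _] _] _]|_]; last exact: measurable_cst.
  exact: mz.
by rewrite /c -/C; field; rewrite gt_eqF.
Qed.
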